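(* Let $\Omega$, the decomposition of $\partial\Omega$, the equations of state, the transport coefficients, the potential $G$ and the boundary data be as in the context. Suppose $$\Gamma^{\mathbf u}_D\neq\emptyset,\qquad\Gamma^\vartheta_D=\emptyset,$$ and that $b_\nu$, $\mathbf b_\tau$ are independent of $t$, with $$\Gamma^{\mathbf B}_D\neq\emptyset,\quad\text{where }\ \mathbf b_\tau\cdot\mathbf n=0\ \text{ and }\ \mathrm{div}_\tau\mathbf b_\tau\not\equiv0\ \text{ on }\Gamma^{\mathbf B}_D,$$ $\mathrm{div}_\tau$ denoting the tangential (surface) divergence. Then $$\int_\Omega E(\varrho,\vartheta,\mathbf u,\mathbf B)(\tau,\cdot)\,\mathrm dx\to\infty\quad\text{as }\tau\to\infty$$ for any global-in-time weak solution $(\varrho,\vartheta,\mathbf u,\mathbf B)$ to the compressible MHD system (in $(T,\infty)\times\Omega$ for some $T$).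
   Context: **Domain.** $\Omega\subset\mathbb R^3$ is a bounded domain of class $C^{2+\nu}$ with outer normal $\mathbf n$ and $\partial\Omega=\Gamma^{\mathbf u}_D\cup\Gamma^{\mathbf u}_N=\Gamma^\vartheta_D\cup\Gamma^\vartheta_N=\Gamma^{\mathbf B}_D\cup\Gamma^{\mathbf B}_N$, where all six sets are compact and $\Gamma^{*}_D\cap\Gamma^{*}_N=\emptyset$ for $*=\mathbf u,\vartheta,\mathbf B$ (so each is empty or a finite union of connected components of $\partial\Omega$). **System (compressible MHD).** Unknowns: density $\varrho$, temperature $\vartheta$, velocity $\mathbf u$, magnetic field $\mathbf B$, with $\partial_t\varrho+\mathrm{div}(\varrho\mathbf u)=0$; $\partial_t(\varrho\mathbf u)+\mathrm{div}(\varrho\mathbf u\otimes\mathbf u)+\boldsymbol\omega\times\varrho\mathbf u+\nabla p=\mathrm{div}\,\mathbb S+\mathrm{curl}\,\mathbf B\times\mathbf B+\varrho\nabla M$; $\partial_t\mathbf B+\mathrm{curl}(\mathbf B\times\mathbf u)+\mathrm{curl}(\zeta(\vartheta)\mathrm{curl}\,\mathbf B)=0$, $\mathrm{div}\,\mathbf B=0$; $\partial_t(\varrho e)+\mathrm{div}(\varrho e\mathbf u)+\mathrm{div}\,\mathbf q=\mathbb S:\nabla\mathbf u+\zeta(\vartheta)|\mathrm{curl}\,\mathbf B|^2-p\,\mathrm{div}\,\mathbf u$. Here $M=G+\frac12|\boldsymbol\omega\times x|^2$, $\boldsymbol\omega\in\mathbb R^3$ is a constant vector, $G=G(t,x)\in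 BC^1(\mathbb R\times\overline\Omega)$ ($BC$ = bounded continuous), $\mathbb S(\vartheta,\nabla\mathbf u)=\mu(\vartheta)\left(\nabla\mathbf u+\nabla^t\mathbf u-\frac23\mathrm{div}\,\mathbf u\,\mathbb I\right)+\eta(\vartheta)\mathrm{div}\,\mathbf u\,\mathbb I$, and $\mathbf q(\vartheta,\nabla\vartheta)=-\kappa(\vartheta)\nabla\vartheta$. Boundary conditions: $\mathbf u=0$ on $\Gamma^{\mathbf u}_D$; $\mathbf u\cdot\mathbf n=0$, $[\mathbb S\mathbf n]\times\mathbf n=0$ on $\Gamma^{\mathbf u}_N$; $\vartheta=\vartheta_B$ on $\Gamma^\vartheta_D$; $\mathbf q\cdot\mathbf n=0$ on $\Gamma^\vartheta_N$; $\mathbf B\times\mathbf n=\mathbf b_\tau$ on $\Gamma^{\mathbf B}_D$; $\mathbf B\cdot\mathbf n=b_\nu$, $[(\mathbf B\times\mathbf u)+\zeta\,\mathrm{curl}\,\mathbf B]\times\mathbf n=0$ on $\Gamma^{\mathbf B}_N$. (If $\Gamma^\vartheta_D=\emptyset$, all conditions on $\Gamma^\vartheta_D$, here and below, are void.) **Equations of state.** With $a>0$ and $P\in C^1[0,\infty)$: $p=\vartheta^{5/2}P(\varrho\vartheta^{-3/2})+\frac a3\vartheta^4$, $\ e=\frac32\frac{\vartheta^{5/2}}{\varrho}P(\varrho\vartheta^{-3/2})+\frac a\varrho\vartheta^4$, $\ s=\mathcal S(\varrho\vartheta^{-3/2})+\frac{4a}{3}\frac{\vartheta^3}{\varrho}$,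 with $\mathcal S'(Z)=-\frac32\frac{\frac53P(Z)-P'(Z)Z}{Z^2}$ (so Gibbs' equation $\vartheta Ds=De+pD(1/\varrho)$ holds); $P(0)=0$, $P'(Z)>0$, $\frac{\frac53P(Z)-P'(Z)Z}{Z}>0$ for all $Z\ge0$ (at $Z=0$ as a limit); $\lim_{Z\to\infty}P(Z)/Z^{5/3}=p_\infty>0$; $\lim_{Z\to\infty}\mathcal S(Z)=0$. **Transport coefficients.** $\mu,\eta,\kappa,\zeta$ are $C^1$, and for all $\vartheta\ge0$ (with fixed positive constants $\underline\mu,\overline\mu,\overline\eta,\underline\kappa,\overline\kappa,\underline\zeta,\overline\zeta,c$): $\underline\mu(1+\vartheta)\le\mu\le\overline\mu(1+\vartheta)$, $|\mu'|\le c$; $0\le\eta\le\overline\eta(1+\vartheta)$; $\underline\kappa(1+\vartheta^\beta)\le\kappa\le\overline\kappa(1+\vartheta^\beta)$ with some $\beta>6$; $\underline\zeta(1+\vartheta)\le\zeta\le\overline\zeta(1+\vartheta)$, $|\zeta'|\le c$. **Magnetic boundary data.** $\mathbf b_\tau\in C^2(\Gamma^{\mathbf B}_D;\mathbb R^3)$, $b_\nu\in C^2(\Gamma^{\mathbf B}_N)$ (time-independent). $\mathbf B_B$ denotes a (sufficiently regular, in $W^{1,p}(\Omega;\mathbb R^3)$ for all finite $p$) extension with $\mathrm{div}\,\mathbf B_B=0$ in $\Omega$, $\mathbf B_B\times\mathbf n=\mathbf b_\tau$ on $\Gamma^{\mathbf B}_D$, $\mathbf B_B\cdot\mathbf n=b_\nu$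 on $\Gamma^{\mathbf B}_N$; the notion of weak solution below does not depend on its choice. **Spaces.** $\mathcal H(\Omega)=\{\mathbf h\in L^2(\Omega;\mathbb R^3):\mathrm{curl}\,\mathbf h=0,\ \mathrm{div}\,\mathbf h=0,\ \mathbf h\times\mathbf n|_{\Gamma^{\mathbf B}_D}=0,\ \mathbf h\cdot\mathbf n|_{\Gamma^{\mathbf B}_N}=0\}$; $H_{0,\sigma}=\{\mathbf b\in L^2:\mathrm{curl}\,\mathbf b\in L^2,\ \mathrm{div}\,\mathbf b=0,\ \mathbf b\times\mathbf n|_{\Gamma^{\mathbf B}_D}=0,\ \mathbf b\cdot\mathbf n|_{\Gamma^{\mathbf B}_N}=0\}$ with norm $(\|\mathrm{curl}\,\mathbf b\|_{L^2}^2+\|\mathbf b\|_{L^2}^2)^{1/2}$. **Weak solution in $(T,\infty)\times\Omega$.** $(\varrho,\vartheta,\mathbf u,\mathbf B)$ such that: (1) $\varrho\in L^\infty_{\rm loc}(T,\infty;L^{5/3}(\Omega))$, $\varrho\ge0$; $\int_T^\infty\int_\Omega(\varrho\partial_t\varphi+\varrho\mathbf u\cdot\nabla\varphi)\,\mathrm dx\,\mathrm dt=0$ and $\int_T^\infty\int_\Omega\left(b(\varrho)\partial_t\varphi+b(\varrho)\mathbf u\cdot\nabla\varphi+(b(\varrho)-b'(\varrho)\varrho)\mathrm{div}\,\mathbf u\,\varphi\right)\mathrm dx\,\mathrm dt=0$ for all $\varphi\in C^1_c((T,\infty)\times\overline\Omega)$ and all $b\in C^1(\mathbb R)$, $b'\in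 C_c(\mathbb R)$. (2) $\varrho\mathbf u\in L^\infty_{\rm loc}(T,\infty;L^{5/4}(\Omega;\mathbb R^3))$, $\mathbf u\in L^2_{\rm loc}(T,\infty;W^{1,2}(\Omega;\mathbb R^3))$, $\mathbf u|_{\Gamma^{\mathbf u}_D}=0$, $\mathbf u\cdot\mathbf n|_{\Gamma^{\mathbf u}_N}=0$, and $\int_T^\infty\int_\Omega(\varrho\mathbf u\cdot\partial_t\boldsymbol\varphi+\varrho\mathbf u\otimes\mathbf u:\nabla\boldsymbol\varphi+(\varrho\mathbf u\times\boldsymbol\omega)\cdot\boldsymbol\varphi+p\,\mathrm{div}\,\boldsymbol\varphi)=\int_T^\infty\int_\Omega\mathbb S:\nabla\boldsymbol\varphi+\int_T^\infty\int_\Omega(\mathbf B\otimes\mathbf B-\frac12|\mathbf B|^2\mathbb I):\nabla\boldsymbol\varphi-\int_T^\infty\int_\Omega\varrho\nabla M\cdot\boldsymbol\varphi$ for all $\boldsymbol\varphi\in C^1_c((T,\infty)\times\overline\Omega;\mathbb R^3)$ with $\boldsymbol\varphi|_{\Gamma^{\mathbf u}_D}=0$, $\boldsymbol\varphi\cdot\mathbf n|_{\Gamma^{\mathbf u}_N}=0$. (3) $\mathbf B\in L^\infty_{\rm loc}((T,\infty);L^2(\Omega;\mathbb R^3))$, $\mathrm{div}\,\mathbf B(\tau,\cdot)=0$ for any $\tau>T$, $\mathbf B-\mathbf B_B\in L^2_{\rm loc}(T,\infty;H_{0,\sigma})$, and $\int_T^\infty\int_\Omega(\mathbf B\cdot\partial_t\boldsymbol\varphi-(\mathbf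 B\times\mathbf u)\cdot\mathrm{curl}\,\boldsymbol\varphi-\zeta(\vartheta)\mathrm{curl}\,\mathbf B\cdot\mathrm{curl}\,\boldsymbol\varphi)=0$ for all $\boldsymbol\varphi\in C^1_c((T,\infty)\times\overline\Omega;\mathbb R^3)$ with $\boldsymbol\varphi\times\mathbf n|_{\Gamma^{\mathbf B}_D}=0$, $\boldsymbol\varphi\cdot\mathbf n|_{\Gamma^{\mathbf B}_N}=0$. (4) $\vartheta\in L^\infty_{\rm loc}(T,\infty;L^4(\Omega))\cap L^2_{\rm loc}(T,\infty;W^{1,2}(\Omega))$, $\vartheta>0$ a.a., $\log\vartheta\in L^2_{\rm loc}(T,\infty;W^{1,2}(\Omega))$, $\vartheta|_{\Gamma^\vartheta_D}=\vartheta_B$, and $\int_T^\infty\int_\Omega(\varrho s\,\partial_t\varphi+\varrho s\,\mathbf u\cdot\nabla\varphi+\frac{\mathbf q}{\vartheta}\cdot\nabla\varphi)\le-\int_T^\infty\int_\Omega\frac\varphi\vartheta\left(\mathbb S:\nabla\mathbf u-\frac{\mathbf q\cdot\nabla\vartheta}{\vartheta}+\zeta|\mathrm{curl}\,\mathbf B|^2\right)$ for all $\varphi\in C^1_c((T,\infty)\times\overline\Omega)$, $\varphi\ge0$, $\varphi|_{\Gamma^\vartheta_D}=0$. (5) (Ballistic energy inequality) $\int_T^\infty\partial_t\psi\int_\Omega(\frac12\varrho|\mathbf u|^2+\varrho e+\frac12|\mathbf B|^2-\tilde\vartheta\varrho s-\mathbf B_B\cdot\mathbf B)-\int_T^\infty\psi\int_\Omega\frac{\tilde\vartheta}{\vartheta}\left(\mathbb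 S:\nabla\mathbf u-\frac{\mathbf q\cdot\nabla\vartheta}\vartheta+\zeta|\mathrm{curl}\,\mathbf B|^2\right)\ge\int_T^\infty\psi\int_\Omega(\varrho s\,\partial_t\tilde\vartheta+\varrho s\,\mathbf u\cdot\nabla\tilde\vartheta+\frac{\mathbf q}\vartheta\cdot\nabla\tilde\vartheta)+\int_T^\infty\psi\int_\Omega(\mathbf B\cdot\partial_t\mathbf B_B-(\mathbf B\times\mathbf u)\cdot\mathrm{curl}\,\mathbf B_B-\zeta\,\mathrm{curl}\,\mathbf B\cdot\mathrm{curl}\,\mathbf B_B)-\int_T^\infty\psi\int_\Omega\varrho\nabla M\cdot\mathbf u$ for all $\psi\in C^1_c(T,\infty)$, $\psi\ge0$, and all $\tilde\vartheta\in C^1((T,\infty)\times\overline\Omega)$, $\tilde\vartheta>0$, $\tilde\vartheta|_{\Gamma^\vartheta_D}=\vartheta_B$. **Standing conventions.** The total mass $m_0=\int_\Omega\varrho(t,\cdot)\,\mathrm dx>0$ is a constant of motion, and all weak solutions are assumed to satisfy $\int_\Omega\mathbf B\cdot\mathbf h\,\mathrm dx=0$ for all $\mathbf h\in\mathcal H(\Omega)$. $E(\varrho,\vartheta,\mathbf u,\mathbf B)=\frac12\varrho|\mathbf u|^2+\varrho e(\varrho,\vartheta)+\frac12|\mathbf B|^2$; time values of energy functionals, a priori defined for a.a. $t$, are understood in the essential sense. *)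

(* Defs.v *)
From HB Require Import structures.
From mathcomp Require Import all_boot all_order all_algebra.
From mathcomp Require Import all_classical all_reals all_analysis.

Set Implicit Arguments.
Unset Strict Implicit.
Unset Printing Implicit Defensive.

Import Order.TTheory GRing.Theory Num.Theory.
Import numFieldNormedType.Exports.

Local Open Scope classical_set_scope.
Local Open Scope ring_scope.

(** Points of R^3 are triples in [pt R], which carries both a normed-space and a
  measurable structure; [spt R] is space-time.  Vectors and tensors are values
  in ['rV[R]_3] and ['M[R]_3].  Since ['I_3] is the ring Z/3, index arithmetic
  [i + 1], [i + 2] in [cross] and [curl_of] is modulo 3. *)

Notation pt R := (R * R * R)%type.
Notation spt R := (R * (R * R * R))%type.

Section Vectors.
Context {R : realType}.
Implicit Types (x : pt R) (u v : 'rV[R]_3) (A C : 'M[R]_3).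

Definition pos x : 'rV[R]_3 := \row_i [:: x.1.1; x.1.2; x.2]`_i.
Definition bas (i : 'I_3) : pt R :=
  ((i == 0 :> nat)%:R, (i == 1 :> nat)%:R, (i == 2 :> nat)%:R).

Definition dot u v : R := \sum_i u 0 i * v 0 i.
Definition cross u v : 'rV[R]_3 :=
  \row_i (u 0 (i + 1) * v 0 (i + 2) - u 0 (i + 2) * v 0 (i + 1)).
Definition ddot A C : R := \sum_i \sum_j A i j * C i j.

(** [A i j] stands for the derivative of component [i] in direction [j]. *)
Definition curl_of A : 'rV[R]_3 :=
  \row_i (A (i + 2) (i + 1) - A (i + 1) (i + 2)).

Definition grad (f : pt R -> R) x : 'rV[R]_3 := \row_j 'D_(bas j) f x.
Definition jac (f : pt R -> 'rV[R]_3) x : 'M[R]_3 :=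
  \matrix_(i, j) 'D_(bas j) (fun y => f y 0 i) x.
Definition div f x : R := \tr (jac f x).
Definition curl f x : 'rV[R]_3 := curl_of (jac f x).

Definition dt (f : spt R -> R) (y : spt R) : R :=
  derive1 (fun t => f (t, y.2)) y.1.
Definition dtv (f : spt R -> 'rV[R]_3) (y : spt R) : 'rV[R]_3 :=
  \row_i dt (fun z => f z 0 i) y.
Definition gradx (f : spt R -> R) (y : spt R) : 'rV[R]_3 :=
  grad (fun x => f (y.1, x)) y.2.
Definition jacx (f : spt R -> 'rV[R]_3) (y : spt R) : 'M[R]_3 :=
  jac (fun x => f (y.1, x)) y.2.

End Vectors.

Definition entrywise (R U : Type) (m n : nat) (Pr : (U -> R) -> Prop)
  (F : U -> 'M[R]_(m, n)) := forall i j, Pr (fun y => F y i j).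

Section Regularity.
Context {R : realType}.

(** [U] is meant to be open; all directional derivatives up to order [k] exist
  and are continuous on [U]. *)
Fixpoint Ck (V : normedModType R) (k : nat) (U : set V) (f : V -> R) : Prop :=
  match k with
  | 0 => forall x, U x -> {for x, continuous f}
  | k'.+1 => (forall x, U x -> {for x, continuous f}) /\
      forall v, (forall x, U x -> derivable f x v) /\
                Ck k' U (fun x => 'D_v f x)
  end.

Definition C2nu (nu : R) (f : pt R -> R) :=
  Ck 2 setT f /\
  forall v w, exists C : R, forall x y,
    `| 'D_w (fun z => 'D_v f z) x - 'D_w (fun z => 'D_v f z) y |
      <= C * `|x - y| `^ nu.

(** [f] is of class C^1 on [0, +oo[ with derivative [df] (one-sided at 0). *)
Definition C1_halfline (f df : R -> R) :=
  (forall x, 0 <= x ->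
     (f y - f x) / (y - x) @[y --> within `[0, +oo[ x^'] --> df x) /\
  {within `[0, +oo[, continuous df}.

End Regularity.

Section Domain.
Context {R : realType}.
Implicit Types (Omega Gam GD GN : set (pt R)).

Definition bdry Omega := closure Omega `\` interior Omega.

(** Near [x0], [Omega] is the region above the graph of a C^{2+nu} function,
  after relabelling and reorienting the coordinate axes (Evans, Partial
  Differential Equations, Appendix C.1): the [k]-th axis, reversed if [s], is
  the vertical one and [gam] is a function of the two other coordinates. *)
Definition bdry_chart (nu : R) Omega (x0 : pt R) (k : 'I_3) (s : bool)
    (gam : pt R -> R) :=
  [/\ C2nu nu gam,
      forall x (h : R), gam (x + h *: bas k) = gam x &
      exists2 r : R, 0 < r & forall x, ball x0 r x ->
        (Omega x <-> gam x < (-1) ^+ s * pos x 0 k)].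

Definition C2nu_domain (nu : R) Omega :=
  [/\ Omega !=set0, open Omega, connected Omega, bounded_set Omega &
      forall x0, bdry Omega x0 -> exists k s gam, bdry_chart nu Omega x0 k s gam].

(** In a chart, [Omega] is the sublevel set at 0 of
  [gam x - (-1) ^+ s * pos x 0 k]. *)
Definition outer_normal (nu : R) Omega (x : pt R) (n : 'rV[R]_3) :=
  exists k s gam, bdry_chart nu Omega x k s gam /\
    let m := grad gam x - (-1) ^+ s *: delta_mx 0 k in
    n = (Num.sqrt (dot m m))^-1 *: m.

Definition bdry_splits Omega GD GN :=
  [/\ bdry Omega = GD `|` GN, compact GD, compact GN & GD `&` GN = set0].

(** C^2 functions on a compact part of the boundary are the restrictions of
  C^2 functions on R^3. *)
Definition C2_extends Gam (b bt : pt R -> 'rV[R]_3) :=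
  entrywise (Ck 2 setT) bt /\ forall x, Gam x -> bt x = b x.

(** [delta] is the surface divergence of [b] at the boundary point [x], i.e.
  div b - n . (Db) n, which does not depend on the extension [bt]. *)
Definition surface_divergence Gam (n b : pt R -> 'rV[R]_3) (x : pt R)
    (delta : R) :=
  exists bt, C2_extends Gam b bt /\
    delta = div bt x - (n x *m jac bt x *m (n x)^T) 0 0.

End Domain.

(** The library's canonical sigma-finiteness of product measures only covers
  subprobabilities, hence the explicit instances. *)

Lemma product_sigma_finite d1 d2 (T1 : measurableType d1)
    (T2 : measurableType d2) (R : realType)
    (m1 : {sigma_finite_measure set T1 -> \bar R})
    (m2 : {sigma_finite_measure set T2 -> \bar R}) :
  sigma_finite setT (m1 \x m2)%E.
Proof.
have /sigma_finiteP[F [TF ndF Foo]] := sigma_finiteT m1.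
have /sigma_finiteP[H [TH ndH Hoo]] := sigma_finiteT m2.
exists (fun n => F n `*` H n).
  rewrite -setXTT TF TH predeqE => -[x y]; split.
    move=> [/= [n _ Fnx] [k _ Hky]]; exists (maxn n k) => //; split.
    - by move: x Fnx; exact/subsetPset/ndF/leq_maxl.
    - by move: y Hky; exact/subsetPset/ndH/leq_maxr.
  by move=> [n _ []/= ? ?]; split; exists n.
move=> k; have [? ?] := Foo k; have [? ?] := Hoo k.
split; first exact: measurableX.
by rewrite product_measure1E// lte_mul_pinfty// ge0_fin_numE.
Qed.

Section Lebesgue.
Context {R : realType}.

Definition leb : {sigma_finite_measure set (measurableTypeR R) -> \bar R} :=
  @lebesgue_measure R.

Definition leb2 := (leb \x leb)%E.
HB.instance Definition _ := Measure.on leb2.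
HB.instance Definition _ :=
  Measure_isSigmaFinite.Build _ _ _ leb2 (product_sigma_finite leb leb).

Definition vol := (leb2 \x leb)%E.
HB.instance Definition _ := Measure.on vol.
HB.instance Definition _ :=
  Measure_isSigmaFinite.Build _ _ _ vol (product_sigma_finite leb2 leb).

Definition stvol := (leb \x vol)%E.
HB.instance Definition _ := Measure.on stvol.
HB.instance Definition _ :=
  Measure_isSigmaFinite.Build _ _ _ stvol (product_sigma_finite leb vol).

End Lebesgue.

Section Spaces.
Context {R : realType}.
Implicit Types (Omega Gam GD GN : set (pt R)).

Definition Qcyl (T : R) Omega : set (spt R) := `]T, +oo[ `*` Omega.

Definition Lp Omega (p : R) (f : pt R -> R) :=
  measurable_fun Omega f /\
  vol.-integrable Omega (EFin \o (fun x => `|f x| `^ p)).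

(** L^p_loc(T, oo; L^p(Omega)), i.e. local in time only *)
Definition Lploc (T : R) Omega (p : R) (f : spt R -> R) :=
  measurable_fun (Qcyl T Omega) f /\
  forall t1 t2, T < t1 -> t1 < t2 ->
    stvol.-integrable (`[t1, t2] `*` Omega) (EFin \o (fun y => `|f y| `^ p)).

(** L^oo_loc(T, oo; L^p(Omega)) *)
Definition Linfloc (T : R) Omega (p : R) (f : spt R -> R) :=
  measurable_fun (Qcyl T Omega) f /\
  forall t1 t2, T < t1 -> t1 < t2 -> exists C : R,
    {ae leb, forall t, t1 <= t <= t2 ->
      (\int[vol]_(x in Omega) (`|f (t, x)| `^ p)%:E <= C%:E)%E}.

Definition C1c Omega (f : pt R -> R) :=
  Ck 1 setT f /\
  exists K, [/\ compact K, K `<=` Omega & forall x, ~ K x -> f x = 0].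

(** C^1_c test functions, as in Gilbarg-Trudinger, Section 7.3; smooth ones
  give the same notion. *)
Definition weak_grad Omega (f : pt R -> R) (g : pt R -> 'rV[R]_3) :=
  forall phi j, C1c Omega phi ->
    \int[vol]_(x in Omega) (f x * grad phi x 0 j) =
    - \int[vol]_(x in Omega) (g x 0 j * phi x).
Definition weak_jac Omega (f : pt R -> 'rV[R]_3) (F : pt R -> 'M[R]_3) :=
  forall i, weak_grad Omega (fun x => f x 0 i) (fun x => row i (F x)).
Definition weak_divfree Omega (b : pt R -> 'rV[R]_3) :=
  forall phi, C1c Omega phi ->
    \int[vol]_(x in Omega) dot (b x) (grad phi x) = 0.
Definition weak_curl Omega (b c : pt R -> 'rV[R]_3) :=
  forall phi, entrywise (C1c Omega) phi ->
    \int[vol]_(x in Omega) dot (b x) (curl phi x) =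
    \int[vol]_(x in Omega) dot (c x) (phi x).

(** Homogeneous traces on the part [Gam] of the boundary, understood through
  Green's formula; [g], [d], [c] are the weak gradient of [f], the weak
  divergence of [b] and the weak curl of [b]. *)
Definition zero_trace Omega Gam (f : pt R -> R) (g : pt R -> 'rV[R]_3) :=
  forall phi : pt R -> 'rV[R]_3, entrywise (Ck 1 setT) phi ->
    (forall x, (bdry Omega `\` Gam) x -> phi x = 0) ->
    \int[vol]_(x in Omega) (f x * div phi x + dot (g x) (phi x)) = 0.
Definition zero_normal_trace Omega Gam (b : pt R -> 'rV[R]_3) (d : pt R -> R) :=
  forall phi : pt R -> R, Ck 1 setT phi ->
    (forall x, (bdry Omega `\` Gam) x -> phi x = 0) ->
    \int[vol]_(x in Omega) (dot (b x) (grad phi x) + d x * phi x) = 0.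
Definition zero_tangential_trace Omega Gam (b c : pt R -> 'rV[R]_3) :=
  forall phi : pt R -> 'rV[R]_3, entrywise (Ck 1 setT) phi ->
    (forall x, (bdry Omega `\` Gam) x -> phi x = 0) ->
    \int[vol]_(x in Omega) (dot (b x) (curl phi x) - dot (c x) (phi x)) = 0.

(** [b] is in [H_{0,sigma}] and has weak curl [c]. *)
Definition H0sigma Omega GD GN (b c : pt R -> 'rV[R]_3) :=
  [/\ entrywise (Lp Omega 2) b /\ entrywise (Lp Omega 2) c,
      weak_curl Omega b c, weak_divfree Omega b,
      zero_tangential_trace Omega GD b c &
      zero_normal_trace Omega GN b (fun=> 0)].

Definition harmonic Omega GD GN (h : pt R -> 'rV[R]_3) :=
  H0sigma Omega GD GN h (fun=> 0).

End Spaces.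

(** The primed coefficients are fields of their own so that one-sided
  derivatives at 0 can be mentioned.  [btau] and [bnu] do not depend on time.
  [G] is the potential, [arad] the radiation constant a, [entS] the function S
  of the entropy, [thB] the temperature prescribed on [GtD]. *)
Record mhd (R : realType) := Mhd {
  Omega : set (pt R);
  nrm : pt R -> 'rV[R]_3;
  GuD : set (pt R); GuN : set (pt R);
  GtD : set (pt R); GtN : set (pt R);
  GBD : set (pt R); GBN : set (pt R);
  omega : 'rV[R]_3;
  G : spt R -> R;
  arad : R;
  P : R -> R; P' : R -> R;
  entS : R -> R;
  mu : R -> R; mu' : R -> R;
  eta : R -> R; eta' : R -> R;
  kappa : R -> R; kappa' : R -> R;
  zeta : R -> R; zeta' : R -> R;
  thB : spt R -> R;
  btau : pt R -> 'rV[R]_3;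
  bnu : pt R -> R
}.

Section Problem.
Context {R : realType}.
Variable d : mhd R.

Definition domain_assumptions (nu : R) :=
  [/\ 0 < nu < 1, C2nu_domain nu (Omega d),
      forall x, bdry (Omega d) x -> outer_normal nu (Omega d) x (nrm d x) &
      [/\ bdry_splits (Omega d) (GuD d) (GuN d),
          bdry_splits (Omega d) (GtD d) (GtN d) &
          bdry_splits (Omega d) (GBD d) (GBN d)]].

Definition potential_assumptions :=
  Ck 1 setT (G d) /\
  exists C : R, forall t x, closure (Omega d) x ->
    [/\ `|G d (t, x)| <= C, `|dt (G d) (t, x)| <= C &
        forall i, `|gradx (G d) (t, x) 0 i| <= C].

Definition eos_assumptions :=
  [/\ 0 < arad d /\ C1_halfline (P d) (P' d),
      P d 0 = 0 /\ (forall Z : R, 0 <= Z -> 0 < P' d Z),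
      (forall Z : R, 0 < Z -> 0 < (5 / 3 * P d Z - P' d Z * Z) / Z) /\
      (exists2 l : R, 0 < l &
         (5 / 3 * P d Z - P' d Z * Z) / Z @[Z --> 0^'+] --> l),
      exists2 pinf : R, 0 < pinf &
        P d Z / Z `^ (5 / 3) @[Z --> +oo] --> pinf &
      (forall Z : R, 0 < Z -> is_derive Z 1 (entS d)
         (- (3 / 2) * ((5 / 3 * P d Z - P' d Z * Z) / Z ^+ 2))) /\
      entS d Z @[Z --> +oo] --> (0 : R)].

Definition transport_assumptions :=
  [/\ C1_halfline (mu d) (mu' d) /\ C1_halfline (eta d) (eta' d),
      C1_halfline (kappa d) (kappa' d) /\ C1_halfline (zeta d) (zeta' d) &
      exists mu1 mu2 eta2 kap1 kap2 zet1 zet2 c beta : R,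
        [/\ [/\ 0 < mu1, 0 < mu2 & 0 < eta2],
            [/\ 0 < kap1, 0 < kap2 & 6 < beta],
            [/\ 0 < zet1, 0 < zet2 & 0 < c] &
            forall th : R, 0 <= th ->
              [/\ mu1 * (1 + th) <= mu d th <= mu2 * (1 + th)
                    /\ `|mu' d th| <= c,
                  0 <= eta d th <= eta2 * (1 + th),
                  kap1 * (1 + th `^ beta) <= kappa d th
                    <= kap2 * (1 + th `^ beta) &
                  zet1 * (1 + th) <= zeta d th <= zet2 * (1 + th)
                    /\ `|zeta' d th| <= c]]].

Definition magnetic_data_assumptions :=
  (exists bt, C2_extends (GBD d) (btau d) bt) /\
  (exists bt : pt R -> R,
     Ck 2 setT bt /\ forall x, GBN d x -> bt x = bnu d x).

(** [BB] is an admissible extension of the magnetic boundary data, given by its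
  representative that is continuous up to the boundary, with weak Jacobian
  [DBB]. *)
Definition magnetic_extension (BB : pt R -> 'rV[R]_3) (DBB : pt R -> 'M[R]_3) :=
  [/\ entrywise (fun f : pt R -> R =>
        {within closure (Omega d), continuous f}) BB,
      (forall p : R, 1 <= p ->
        entrywise (Lp (Omega d) p) BB /\ entrywise (Lp (Omega d) p) DBB),
      weak_jac (Omega d) BB DBB /\
        {ae vol, forall x, Omega d x -> \tr (DBB x) = 0},
      forall x, GBD d x -> cross (BB x) (nrm d x) = btau d x &
      forall x, GBN d x -> dot (BB x) (nrm d x) = bnu d x].

(** [rho_e] and [rho_s] are the products of the density with the specific
  internal energy and entropy: these products, unlike the specific quantities,
  make sense in vacuum ([r = 0]), where the radiation part survives. *)
Definition zz (r th : R) : R := r * th `^ (- (3 / 2)).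
Definition pressure (r th : R) : R :=
  th `^ (5 / 2) * P d (zz r th) + arad d / 3 * th ^+ 4.
Definition rho_e (r th : R) : R :=
  3 / 2 * th `^ (5 / 2) * P d (zz r th) + arad d * th ^+ 4.
Definition rho_s (r th : R) : R :=
  r * entS d (zz r th) + 4 * arad d / 3 * th ^+ 3.

Definition stress (th : R) (Du : 'M[R]_3) : 'M[R]_3 :=
  mu d th *: (Du + Du^T - (2 / 3 * \tr Du)%:M) + (eta d th * \tr Du)%:M.
Definition heat_flux (th : R) (g : 'rV[R]_3) : 'rV[R]_3 := - kappa d th *: g.

Definition force_potential (y : spt R) : R :=
  G d y + 1 / 2 * dot (cross (omega d) (pos y.2)) (cross (omega d) (pos y.2)).

Definition dissipation (th : R) (Du : 'M[R]_3) (g c : 'rV[R]_3) : R :=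
  ddot (stress th Du) Du - dot (heat_flux th g) g / th + zeta d th * dot c c.

Definition energy (r th : R) (u b : 'rV[R]_3) : R :=
  1 / 2 * r * dot u u + rho_e r th + 1 / 2 * dot b b.

(** C^1 functions up to the boundary are restrictions of C^1 functions defined
  for all points of R^3.  [Du], [Dth], [Dlog] are the weak spatial gradients of
  the velocity, the temperature and its logarithm, [cB] is the weak curl of [B];
  [DBB] is the weak Jacobian of the extension [BB].  Every integral occurring
  in the weak formulation is required to exist. *)
Section Weak.
Variables (BB : pt R -> 'rV[R]_3) (DBB : pt R -> 'M[R]_3) (T : R).
Variables (rho th : spt R -> R) (u B : spt R -> 'rV[R]_3).
Variables (Du : spt R -> 'M[R]_3) (Dth Dlog cB : spt R -> 'rV[R]_3).

Local Notation Om := (Omega d).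
Local Notation Q := (Qcyl T Om).
Local Notation integrableQ f := (stvol.-integrable Q (EFin \o f)).
Local Notation "\intQ f" := (\int[stvol]_(y in Q) f y)
  (at level 36, f at level 35).

Definition test_fun (phi : spt R -> R) :=
  Ck 1 setT phi /\
  exists t1 t2, T < t1 /\ forall t x, ~~ (t1 <= t <= t2) -> phi (t, x) = 0.
Definition test_field (phi : spt R -> 'rV[R]_3) := entrywise test_fun phi.
Definition test_time (psi : R -> R) :=
  Ck 1 setT psi /\
  exists t1 t2, T < t1 /\ forall t, ~~ (t1 <= t <= t2) -> psi t = 0.

Definition continuity_weak :=
  [/\ Linfloc T Om (5 / 3) rho,
      {ae stvol, forall y, Q y -> 0 <= rho y},
      forall phi, test_fun phi ->
        let f y := rho y * dt phi y + dot (rho y *: u y) (gradx phi y) in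
        integrableQ f /\ \intQ f = 0 &
      forall b phi, Ck 1 setT b ->
        (exists M : R, forall r, M < `|r| -> derive1 b r = 0) ->
        test_fun phi ->
        let f y := b (rho y) * dt phi y + dot (b (rho y) *: u y) (gradx phi y)
          + (b (rho y) - derive1 b (rho y) * rho y) * \tr (Du y) * phi y in
        integrableQ f /\ \intQ f = 0].

Definition momentum_weak :=
  [/\ entrywise (Linfloc T Om (5 / 4)) (fun y => rho y *: u y),
      [/\ entrywise (Lploc T Om 2) u, entrywise (Lploc T Om 2) Du &
          {ae leb, forall t, T < t ->
             weak_jac Om (fun x => u (t, x)) (fun x => Du (t, x))}],
      {ae leb, forall t, T < t ->
         (forall i, zero_trace Om (GuD d) (fun x => u (t, x) 0 i)
                                          (fun x => row i (Du (t, x)))) /\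
         zero_normal_trace Om (GuN d) (fun x => u (t, x))
                                      (fun x => \tr (Du (t, x)))} &
      forall phi, test_field phi ->
        (forall t x, GuD d x -> phi (t, x) = 0) ->
        (forall t x, GuN d x -> dot (phi (t, x)) (nrm d x) = 0) ->
        let f y := dot (rho y *: u y) (dtv phi y)
          + ddot (rho y *: ((u y)^T *m u y)) (jacx phi y)
          + dot (cross (rho y *: u y) (omega d)) (phi y)
          + pressure (rho y) (th y) * \tr (jacx phi y) in
        let g y := ddot (stress (th y) (Du y)) (jacx phi y) in
        let h y := ddot ((B y)^T *m B y - (1 / 2 * dot (B y) (B y))%:M)
                        (jacx phi y) in
        let k y := dot (rho y *: gradx force_potential y) (phi y) in
        [/\ integrableQ f, integrableQ g, integrableQ h, integrableQ k &
            \intQ f = \intQ g + \intQ h - \intQ k]].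

Definition induction_weak :=
  [/\ entrywise (Linfloc T Om 2) B,
      (forall t, T < t -> entrywise (Lp Om 2) (fun x => B (t, x)) /\
                          weak_divfree Om (fun x => B (t, x))),
      entrywise (Lploc T Om 2) cB,
      {ae leb, forall t, T < t ->
         H0sigma Om (GBD d) (GBN d)
           (fun x => B (t, x) - BB x)
           (fun x => cB (t, x) - curl_of (DBB x))} &
      forall phi, test_field phi ->
        (forall t x, GBD d x -> cross (phi (t, x)) (nrm d x) = 0) ->
        (forall t x, GBN d x -> dot (phi (t, x)) (nrm d x) = 0) ->
        let f y := dot (B y) (dtv phi y)
          - dot (cross (B y) (u y)) (curl_of (jacx phi y))
          - zeta d (th y) * dot (cB y) (curl_of (jacx phi y)) in
        integrableQ f /\ \intQ f = 0].

Definition temperature_extension (tt : spt R -> R) :=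
  [/\ Ck 1 [set y : spt R | T < y.1] tt,
      forall t x, T < t -> closure Om x -> 0 < tt (t, x) &
      forall t x, T < t -> GtD d x -> tt (t, x) = thB d (t, x)].

Definition entropy_weak :=
  [/\ [/\ Linfloc T Om 4 th, Lploc T Om 2 th, entrywise (Lploc T Om 2) Dth &
          {ae leb, forall t, T < t ->
             weak_grad Om (fun x => th (t, x)) (fun x => Dth (t, x))}],
      {ae stvol, forall y, Q y -> 0 < th y},
      [/\ Lploc T Om 2 (fun y => ln (th y)), entrywise (Lploc T Om 2) Dlog &
          {ae leb, forall t, T < t ->
             weak_grad Om (fun x => ln (th (t, x))) (fun x => Dlog (t, x))}],
      (exists tt, temperature_extension tt /\
        {ae leb, forall t, T < t ->
           zero_trace Om (GtD d) (fun x => th (t, x) - tt (t, x))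
             (fun x => Dth (t, x) - gradx tt (t, x))}) &
      forall phi, test_fun phi ->
        (forall t x, closure Om x -> 0 <= phi (t, x)) ->
        (forall t x, GtD d x -> phi (t, x) = 0) ->
        let f y := rho_s (rho y) (th y) * dt phi y
          + rho_s (rho y) (th y) * dot (u y) (gradx phi y)
          + dot ((th y)^-1 *: heat_flux (th y) (Dth y)) (gradx phi y) in
        let g y := phi y / th y * dissipation (th y) (Du y) (Dth y) (cB y) in
        [/\ integrableQ f, integrableQ g & \intQ f <= - \intQ g]].

(** The term containing the time derivative of [BB] vanishes, the extension
  being independent of time. *)
Definition ballistic_energy :=
  forall psi tt, test_time psi -> (forall t, 0 <= psi t) ->
    temperature_extension tt ->
    let f y := derive1 psi y.1 *
      (energy (rho y) (th y) (u y) (B y) - tt y * rho_s (rho y) (th y)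
       - dot (BB y.2) (B y)) in
    let g y := psi y.1 *
      (tt y / th y * dissipation (th y) (Du y) (Dth y) (cB y)) in
    let h y := psi y.1 *
      (rho_s (rho y) (th y) * dt tt y
       + rho_s (rho y) (th y) * dot (u y) (gradx tt y)
       + dot ((th y)^-1 *: heat_flux (th y) (Dth y)) (gradx tt y)) in
    let k y := psi y.1 *
      (- dot (cross (B y) (u y)) (curl_of (DBB y.2))
       - zeta d (th y) * dot (cB y) (curl_of (DBB y.2))) in
    let l y := psi y.1 * dot (rho y *: gradx force_potential y) (u y) in
    [/\ integrableQ f, integrableQ g, integrableQ h,
        integrableQ k /\ integrableQ l &
        \intQ f - \intQ g >= \intQ h + \intQ k - \intQ l].

End Weak.

Definition weak_solution BB DBB T rho th u B :=
  exists Du Dth Dlog cB,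
    [/\ continuity_weak T rho u Du,
        momentum_weak T rho th u B Du,
        induction_weak BB DBB T th u B cB,
        entropy_weak T rho th u Du Dth Dlog cB &
        ballistic_energy BB DBB T rho th u B Du Dth cB].

(** Constant positive total mass; no component of [B] along harmonic fields *)
Definition standing_conventions (T : R) (rho : spt R -> R)
    (B : spt R -> 'rV[R]_3) :=
  (exists2 m0 : R, 0 < m0 & {ae leb, forall t, T < t ->
     (\int[vol]_(x in Omega d) (rho (t, x))%:E)%E = m0%:E}) /\
  (forall h, harmonic (Omega d) (GBD d) (GBN d) h ->
     {ae leb, forall t, T < t ->
        \int[vol]_(x in Omega d) dot (B (t, x)) (h x) = 0}).

Definition total_energy (rho th : spt R -> R) (u B : spt R -> 'rV[R]_3)
    (t : R) : \bar R :=
  \int[vol]_(x in Omega d)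
    (energy (rho (t, x)) (th (t, x)) (u (t, x)) (B (t, x)))%:E.

End Problem.

(** [f t --> +oo] as [t --> +oo] in the essential sense *)
Definition ess_cvg_pinfty (R : realType) (f : R -> \bar R) :=
  forall K : R, exists t0 : R,
    {ae leb, forall t : R, t0 < t -> (K%:E <= f t)%E}.

(* Main.v *)
(** The boundary data force a current that never dies out.  Near a boundary point
  where [div_tau b_tau <> 0] choose a localized [chi], vanishing near the other
  boundary components.  Since curl grad = 0 and [B - BB] has vanishing tangential
  trace on [GBD], Green's formula gives, for almost every time,
    int curl B . grad chi = int curl BB . grad chi =: c0,
  and [c0] is a boundary integral of [div_tau b_tau * chi], so that [c0 <> 0].
  The Joule heating bounds the entropy production from below by
  [zet1 * |curl B|^2], hence, by Young's inequality, by a positive constant.  As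
  [GtD] is empty, test functions of time alone are admissible in the entropy
  inequality, and the total entropy grows at least linearly; it is bounded by a
  multiple of mass + volume + energy, and the mass is constant. *)
Require Import Defs.
From mathcomp Require Import all_boot all_order all_algebra.
From mathcomp Require Import all_classical all_reals all_analysis.
From mathcomp Require Import measurable_realfun ring lra.

Set Implicit Arguments.
Unset Strict Implicit.
Unset Printing Implicit Defensive.

Import Order.TTheory GRing.Theory Num.Theory.
Import numFieldNormedType.Exports.

Local Open Scope classical_set_scope.
Local Open Scope ring_scope.

(** * Directional calculus for the classes [Ck] *)

Section Calculus.
Context {R : realType}.
Implicit Types (V : normedModType R).

(** The boundary integral of [div_tau b_tau * chi] is never formed. [BB] is only continuous up to
    the boundary, with a weak Jacobian, so its weak curl can be tested solely against C^1 fields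
    with compact support in the domain. In a chart the domain is [Phi > 0]; the test fields are
    [eta n * grad chi], where [eta n] is a function of [Phi] rising from 0 to 1 in a layer whose
    width is of order 1/n. With [chi = bmp r (Phi) * m] and [m] constant along the chart axis, the
    curl of the test field lives in that layer and is parallel to [grad Phi x grad m], so it sees
    only [BB x grad Phi]. There this trace is replaced by a field [W] that equals it on the boundary
    and is constant along the axis. Integration by parts along the axis and the divergence theorem
    in the whole space turn the layer integral into a volume integral of [dbmp r (Phi) * div W * m].
    At the chosen point [div W] is minus [|grad Phi|] times the surface divergence, so a small
    support gives the integrand a fixed sign. In time the entropy inequality is only distributional;
    the bound at almost every time comes from Lebesgue points. *)

Lemma Ck_continuous V k U (f : V -> R) : Ck k U f -> forall x, U x -> {for x, continuous f}.
Proof. by case: k => [|k] // -[]. Qed.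

Lemma CkS V k U (f : V -> R) : Ck k.+1 U f -> Ck k U f.
Proof.
elim: k f => [|k IH] f; first by case.
move=> [cf df]; split=> // v; have [dfv cfv] := df v.
by split=> //; exact: IH.
Qed.

Lemma Ck_derivable V k U (f : V -> R) (x v : V) : Ck k.+1 U f -> U x -> derivable f x v.
Proof. by move=> [_ /(_ v)[+ _]]; exact. Qed.

Lemma Ck_derive V k U (f : V -> R) v : Ck k.+1 U f -> Ck k U (fun x => 'D_v f x).
Proof. by move=> [_ /(_ v)[]]. Qed.

Lemma Ck_cst V k U (a : R) : Ck k U (fun _ : V => a).
Proof.
elim: k a => [|k IH] a /=; first by move=> x _; exact: cvg_cst.
split=> [x _|v]; first exact: cvg_cst.
split=> [x _|]; first exact: derivable_cst.
under eq_fun do rewrite derive_cst.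
exact: IH.
Qed.

Lemma CkD V k (f g : V -> R) :
  Ck k setT f -> Ck k setT g -> Ck k setT (fun x => f x + g x).
Proof.
elim: k f g => [|k IH] f g /= cf cg.
  by move=> x _; apply: cvgD; [exact: cf|exact: cg].
split=> [x _|v]; first by apply: cvgD; [exact: cf.1|exact: cg.1].
split=> [x _|].
  by apply: derivableD; [exact: (cf.2 v).1|exact: (cg.2 v).1].
rewrite (_ : (fun x => _) = (fun x => 'D_v f x + 'D_v g x)).
  by apply: IH; [exact: (cf.2 v).2|exact: (cg.2 v).2].
apply/funext => x; rewrite deriveD//; [exact: (cf.2 v).1|exact: (cg.2 v).1].
Qed.

Lemma CkM V k (f g : V -> R) :
  Ck k setT f -> Ck k setT g -> Ck k setT (fun x => f x * g x).
Proof.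
elim: k f g => [|k IH] f g cf cg.
  by move=> x _; apply: cvgM; [exact: cf|exact: cg].
split=> [x _|v]; first by apply: cvgM; [exact: cf.1|exact: cg.1].
split=> [x _|].
  by apply: derivableM; [exact: (cf.2 v).1|exact: (cg.2 v).1].
rewrite (_ : (fun x => _) = (fun x => f x * 'D_v g x + g x * 'D_v f x)).
  by apply: CkD; apply: IH;
    [exact: CkS|exact: (cg.2 v).2|exact: CkS|exact: (cf.2 v).2].
apply/funext => x.
by rewrite (@deriveM _ _ f g)//; [exact: (cf.2 v).1|exact: (cg.2 v).1].
Qed.

Lemma CkN V k (f : V -> R) : Ck k setT f -> Ck k setT (fun x => - f x).
Proof.
move=> cf; rewrite (_ : (fun x => _) = (fun x => -1 * f x)).
  by apply: CkM => //; exact: Ck_cst.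
by apply/funext => x; rewrite mulN1r.
Qed.

Lemma CkB V k (f g : V -> R) :
  Ck k setT f -> Ck k setT g -> Ck k setT (fun x => f x - g x).
Proof. by move=> cf cg; apply: CkD => //; exact: CkN. Qed.

Lemma Ck_sum V k (I : Type) (s : seq I) (F : I -> V -> R) :
  (forall i, Ck k setT (F i)) -> Ck k setT (fun x => \sum_(i <- s) F i x).
Proof.
move=> cF; elim: s => [|i s IH].
  by under eq_fun do rewrite big_nil; exact: Ck_cst.
by under eq_fun do rewrite big_cons; exact: CkD.
Qed.

Lemma growth_line V (f : V -> R) (x v : V) (t : R) :
  (fun h : R => h^-1 *: (((fun s : R => f (x + s *: v)) \o shift t) (h *: 1) -
     f (x + t *: v))) =
  (fun h => h^-1 *: ((f \o shift (x + t *: v)) (h *: v) - f (x + t *: v))).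
Proof.
apply/funext => h /=; congr (_ *: (f _ - _)).
by rewrite [h%:A]mulr1 scalerDl addrCA.
Qed.

Lemma is_derive_line V (f : V -> R) (x v : V) (t : R) : derivable f (x + t *: v) v ->
  is_derive t (1 : R) (fun s : R => f (x + s *: v)) ('D_v f (x + t *: v)).
Proof.
move=> df; split; first by rewrite /derivable growth_line; exact: df.
by rewrite /derive growth_line.
Qed.

Lemma is_derive_of_line V (f : V -> R) (x v : V) (l : R) :
  is_derive 0 (1 : R) (fun s : R => f (x + s *: v)) l -> is_derive x v f l.
Proof.
move=> [d1 d2]; have E := growth_line f x v 0.
rewrite scale0r addr0 in E; split.
  by move: d1; rewrite /derivable scale0r addr0 E.
by move: d2; rewrite /derive scale0r addr0 E.
Qed.

Lemma is_derive_comp1 V (g : R -> R) (f : V -> R) (x v : V) :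
  derivable g (f x) 1 -> derivable f x v ->
  is_derive x v (fun y => g (f y)) ('D_1 g (f x) * 'D_v f x).
Proof.
move=> dg df; apply: is_derive_of_line.
have L := @is_derive_line V f x v 0.
rewrite scale0r addr0 in L; have {}L := L df.
have G : is_derive (f (x + 0 *: v)) 1 g ('D_1 g (f x)).
  have -> : x + 0 *: v = x by rewrite scale0r addr0.
  exact: (DeriveDef dg erefl).
exact: (@is_derive1_comp R g (fun s => f (x + s *: v)) 0 _ _ G L).
Qed.

Lemma derive_comp1 V (g : R -> R) (f : V -> R) (x v : V) :
  derivable g (f x) 1 -> derivable f x v ->
  'D_v (fun y => g (f y)) x = 'D_1 g (f x) * 'D_v f x.
Proof. by move=> dg df; case: (is_derive_comp1 dg df). Qed.

Lemma Ck_comp V k (g : R -> R) (f : V -> R) :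
  Ck k setT g -> Ck k setT f -> Ck k setT (fun x => g (f x)).
Proof.
have cc (h : R -> R) (e : V -> R) : (forall y, [set: R] y -> {for y, continuous h}) ->
    (forall y, [set: V] y -> {for y, continuous e}) ->
    forall x, [set: V] x -> {for x, continuous (fun x => h (e x))}.
  by move=> ch ce x _; exact: (continuous_comp (ce x I) (ch (e x) I)).
elim: k g f => [|k IH] g f cg cf; first exact: cc.
split=> [|v]; first exact: cc cg.1 cf.1.
have dg x : derivable g x 1 by exact: Ck_derivable cg _.
have df x : derivable f x v by exact: Ck_derivable cf _.
split=> [x _|]; first by case: (is_derive_comp1 (dg (f x)) (df x)).
under eq_fun do rewrite derive_comp1//.
apply: CkM; last exact: Ck_derive.
by apply: (IH (fun y => 'D_1 g y)); [exact: Ck_derive|exact: CkS].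
Qed.

(** Bounding [|t|] by [|h|] treats increments of either sign, and zero, uniformly. *)
Lemma MVT_line V (f : V -> R) (x v : V) (h : R) : Ck 1 setT f ->
  exists2 t : R, `|t| <= `|h| & f (x + h *: v) - f x = h * 'D_v f (x + t *: v).
Proof.
move=> cf; pose g (s : R) := f (x + s *: v).
have dg (s : R) : is_derive s (1 : R) g ('D_v f (x + s *: v)).
  exact: (@is_derive_line V f x v s (Ck_derivable cf I)).
have cg : continuous g.
  move=> s; apply/differentiable_continuous/derivable1_diffP.
  by case: (dg s).
have g0 : g 0 = f x by rewrite /g scale0r addr0.
have [h0|h0|->] := ltgtP h 0; last first.
- by exists 0; rewrite ?normr0// scale0r addr0 subrr mul0r.
- have [|c /andP[c0 ch]] := MVT h0 (fun s _ => dg s).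
    exact: continuous_subspaceT.
  rewrite g0 subr0 => E; exists c.
    by rewrite !gtr0_norm//; apply: ltW.
  by rewrite -/(g h) E mulrC.
- have [|c /andP[c0 ch]] := MVT h0 (fun s _ => dg s).
    exact: continuous_subspaceT.
  rewrite g0 sub0r => E; exists c.
    by rewrite !ltr0_norm// lerN2; apply: ltW.
  by apply/eqP; rewrite -/(g h) -eqr_opp opprB E; apply/eqP; ring.
Qed.

Lemma continuous_normP V (f : V -> R) x : {for x, continuous f} ->
  forall e : R, 0 < e -> exists2 r : R, 0 < r &
    forall h, `|h| < r -> `|f (x + h) - f x| < e.
Proof.
move=> cf e e0.
have /cvgrPdist_lt/(_ e e0) := cf.
move/nbhs_normP => [r /= r0 H]; exists r => // h hr.
rewrite distrC; apply: H; rewrite /ball_ /= -normrN opprB addrAC subrr add0r //.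
Qed.

(** A chain rule that needs no Fréchet differentiability. The increment is split into the motion
    along [w] alone, a one-variable composition, and the difference [p], a motion along [v] from a
    moving base point. The mean value theorem writes the latter as a derivative in the fixed
    direction [v] at a point tending to [x], and that derivative is continuous. *)
Lemma is_derive_path V (f : V -> R) (x v : V) w (b : R -> R) (l : R) :
  Ck 1 setT f -> b 0 = 0 -> is_derive (0 : R) (1 : R) b l ->
  is_derive (0 : R) (1 : R) (fun s => f (x + s *: v + b s *: w))
    ('D_v f x + l * 'D_w f x).
Proof.
move=> cf b0 db.
pose p s := f (x + s *: v + b s *: w) - f (x + b s *: w).
have dq : is_derive (0 : R) (1 : R) (fun s => f (x + b s *: w)) (l * 'D_w f x).
  have L := @is_derive_line V f x w 0.
  rewrite scale0r addr0 in L.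
  have {}L := L (Ck_derivable cf I).
  rewrite -b0 in L.
  by rewrite mulrC; exact: (@is_derive1_comp R (fun s => f (x + s *: w)) b 0 _ _ L db).
suff dp : is_derive (0 : R) (1 : R) p ('D_v f x).
  have := is_deriveD dp dq.
  by congr is_derive; apply/funext => s; rewrite /p /= subrK.
have p0 : p 0 = 0 by rewrite /p scale0r addr0 subrr.
suff Q : (fun h : R => h^-1 *: (p (h *: 1 + 0) - p 0)) h @[h --> 0^'] --> 'D_v f x.
  by split; [apply/cvg_ex; exists ('D_v f x)|apply/cvg_lim].
apply/cvgrPdist_lt => e e0.
have [r r0 Hr] := continuous_normP ((cf.2 v).2 x I) e0.
have cb : {for 0, continuous b}.
  by apply/differentiable_continuous/derivable1_diffP; case: db.
have cN : (fun h => `|b h| * `|w| + `|h| * `|v|) h @[h --> (0 : R)] --> (0 : R).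
  rewrite [X in _ --> X](_ : _ = `|b 0| * `|w| + `|0 : R| * `|v|); last first.
    by rewrite b0 !normr0 !mul0r addr0.
  apply: cvgD; apply: cvgM; try exact: cvg_cst; apply: cvg_norm => //.
have /cvgrPdist_lt/(_ r r0) cN0 := cN.
near=> h.
have h0 : h != 0 by near: h; exact: nbhs_dnbhs_neq.
have : `|0 - (`|b h| * `|w| + `|h| * `|v|)| < r by near: h; exact: nbhs_dnbhs.
rewrite sub0r normrN ger0_norm; last by rewrite addr_ge0// mulr_ge0.
move=> hr; rewrite p0 subr0 [h%:A]mulr1 addr0 /p.
have [t th] := MVT_line (x + b h *: w) v h cf.
rewrite addrAC => ->.
rewrite -[_ *: _]/(h^-1 * _) mulKf//.
rewrite -normrN opprB -addrA; apply: Hr; apply: le_lt_trans hr.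
rewrite (le_trans (ler_normD _ _))// !normrZ lerD2l ler_wpM2r//.
Unshelve. all: by end_near.
Qed.

(** [Ck] treats each direction separately, so linearity in the direction has to be proved: a line in
    direction [v + a *: w] is the path with [b s = a * s]. *)
Lemma derive_linear V (f : V -> R) (x v : V) w (a : R) : Ck 1 setT f ->
  'D_(v + a *: w) f x = 'D_v f x + a * 'D_w f x.
Proof.
move=> cf.
have da : is_derive (0 : R) (1 : R) (fun s : R => a * s) a.
  by apply: is_derive_eq; rewrite [LHS]mulr1.
have := is_derive_path x v w cf (mulr0 a) da.
rewrite (_ : (fun s => _) = (fun s => f (x + s *: (v + a *: w)))).
  by move=> /is_derive_of_line[].
apply/funext => s.
by rewrite scalerDr scalerA addrA [a * s]mulrC.
Qed.

Lemma growth_translate V (f : V -> R) (x u c : V) :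
  (fun t : R => t^-1 *: (((fun y => f (y + c)) \o shift x) (t *: u) - f (x + c))) =
  (fun t => t^-1 *: ((f \o shift (x + c)) (t *: u) - f (x + c))).
Proof. by apply/funext => t /=; rewrite addrA. Qed.

Lemma derive_translate V (f : V -> R) (x u c : V) :
  'D_u (fun y => f (y + c)) x = 'D_u f (x + c).
Proof. by rewrite /derive growth_translate. Qed.

Lemma Ck_translate V k (f : V -> R) (c : V) :
  Ck k setT f -> Ck k setT (fun y => f (y + c)).
Proof.
have ca y : {for y, continuous (fun y : V => y + c)}.
  by apply: cvgD; [exact: cvg_id|exact: cvg_cst].
elim: k f => [|k IH] f cf.
  by move=> y _; exact: (continuous_comp (ca y) (cf _ I)).
split=> [y _|u]; first exact: (continuous_comp (ca y) (cf.1 _ I)).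
split=> [y _|].
  by have := (cf.2 u).1 (y + c) I; rewrite /derivable -growth_translate.
under eq_fun do rewrite derive_translate.
by apply: (IH (fun y => 'D_u f y)); exact: (cf.2 u).2.
Qed.

Lemma dist_halves (a b c e : R) :
  `|a - b| < e / 2 -> `|a - c| < e / 2 -> `|c - b| <= e.
Proof. by rewrite !ltr_norml ler_norml; lra. Qed.

(** The second difference of [f] over the parallelogram spanned by [h *: v] and [h *: w] is
    symmetric in [v] and [w]. Two applications of the mean value theorem, in either order, equate it
    with [h ^+ 2] times one or the other mixed derivative at a point near [x]. *)
Lemma derive_swap V (f : V -> R) (x v : V) w : Ck 2 setT f ->
  'D_v (fun y => 'D_w f y) x = 'D_w (fun y => 'D_v f y) x.
Proof.
move=> cf.
have diff2 (a b : V) (h : R) : exists2 z, `|z| <= `|h| * (`|a| + `|b|) &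
    f (x + h *: a + h *: b) - f (x + h *: a) - (f (x + h *: b) - f x) =
    h ^+ 2 * 'D_b (fun y => 'D_a f y) (x + z).
  pose g y := f (y + h *: b) - f y.
  have cg : Ck 1 setT g.
    by apply: CkB; [apply: Ck_translate|]; exact: CkS.
  have [t th E] := MVT_line x a h cg.
  have [s sh E'] := MVT_line (x + t *: a) b h (Ck_derive a cf).
  exists (t *: a + s *: b).
    by rewrite (le_trans (ler_normD _ _))// !normrZ mulrDr lerD// ler_wpM2r.
  rewrite -/(g (x + h *: a)) -/(g x) E expr2 -mulrA addrA -E'; congr (_ * _).
  have d1 : derivable (fun y => f (y + h *: b)) (x + t *: a) a.
    exact: (Ck_derivable (Ck_translate (h *: b) (CkS cf)) I).
  rewrite (deriveB d1 (Ck_derivable (CkS cf) I)).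
  by rewrite derive_translate addrAC.
apply/eqP; rewrite -subr_eq0 -normr_le0; apply/ler_addgt0Pr => e e0; rewrite add0r.
have e2 : 0 < e / 2 by rewrite divr_gt0.
have [r1 r10 H1] := continuous_normP (((cf.2 w).2.2 v).2 x I) e2.
have [r2 r20 H2] := continuous_normP (((cf.2 v).2.2 w).2 x I) e2.
pose N := `|v| + `|w|.
have N0 : 0 <= N by rewrite addr_ge0.
(* Chosen so that both intermediate points, at distance at most [|h| * N], fall within both radii of
   continuity; [N + 1] covers [v = w = 0]. *)
pose h := Num.min r1 r2 / (N + 1).
have h0 : 0 < h by rewrite divr_gt0 ?lt_min ?r10//; lra.
have hN : `|h| * N < Num.min r1 r2.
  rewrite gtr0_norm// /h mulrAC -mulrA gtr_pMr ?lt_min ?r10//.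
  by rewrite ltr_pdivrMr; lra.
have [z1 z1h E1] := diff2 v w h.
have [z2 z2h E2] := diff2 w v h.
have E : 'D_w (fun y => 'D_v f y) (x + z1) = 'D_v (fun y => 'D_w f y) (x + z2).
  have h2 : h ^+ 2 != 0 by rewrite expf_neq0// gt_eqF.
  apply: (mulfI h2); refine (etrans (etrans (esym E1) _) E2).
  rewrite [x + h *: w + h *: v]addrAC.
  move: (f (x + h *: v + h *: w)) (f (x + h *: v)) (f (x + h *: w)) (f x) => p q r s.
  by rewrite !opprB !addrA addrAC [RHS]addrAC; congr (_ + _); rewrite addrAC.
move: hN; rewrite lt_min => /andP[hN1 hN2].
have A1 : `|z2| < r1 by apply: le_lt_trans z2h _; rewrite (addrC `|w| `|v|).
have A2 : `|z1| < r2 by rewrite (le_lt_trans z1h).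
have B1 := H1 _ A1; have B2 := H2 _ A2; rewrite E in B2.
exact: dist_halves B2 B1.
Qed.

End Calculus.

(** * Measurability and integrals of partial derivatives on R^3 *)

Section Measure.
Context {R : realType}.
Implicit Types (U : set (pt R)) (f : pt R -> R).

Definition box (r : R) : set (pt R) := `[- r, r] `*` `[- r, r] `*` `[- r, r].

Lemma measurable_ball_pt (x : pt R) (e : R) : measurable (ball x e).
Proof.
rewrite [ball x e](_ : _ = (ball x.1.1 e `*` ball x.1.2 e) `*` ball x.2 e)//.
by apply: measurableX => //; [apply: measurableX|];
  rewrite ball_itv; exact: measurable_itv.
Qed.

(** Triples carry the product sigma-algebra, so openness has to be reduced to rectangles: the balls
    are cubes, and [U] is the countable union of those with rational centre and radius [1 / (n + 1)]
    that it contains. *)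
Lemma open_measurable_pt U : open U -> measurable U.
Proof.
move=> oU.
pose c (i : rat * rat * rat * nat) : pt R :=
  (ratr i.1.1.1, ratr i.1.1.2, ratr i.1.2).
pose F i := if `[< ball (c i) i.2.+1%:R^-1 `<=` U >]
  then ball (c i) i.2.+1%:R^-1 else set0.
have -> : U = \bigcup_i F i.
  apply/seteqP; split => [x Ux|x [i _]]; last first.
    by rewrite /F; case: asboolP => // + Bx; exact.
  have /nbhs_ballP[e /= e0 eU] : nbhs x U by exact: open_nbhs_nbhs.
  have e2 : 0 < e / 2 by rewrite divr_gt0.
  have [n _ /(_ n (leqnn n)) ne] := near_infty_natSinv_lt (PosNum e2).
  have {}ne : n.+1%:R^-1 < e / 2 := ne.
  have n0 : 0 < n.+1%:R^-1 :> R by rewrite invr_gt0.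
  have dq (y : R) : exists q : rat, `|y - ratr q| < n.+1%:R^-1.
    have [z []] := @dense_rat R (ball y n.+1%:R^-1)
      (ex_intro _ y (ballxx _ n0)) (ball_open _ _).
    by move=> yz [q _ qz]; exists q; rewrite qz.
  have [q1 h1] := dq x.1.1; have [q2 h2] := dq x.1.2; have [q3 h3] := dq x.2.
  have xc : ball (c (q1, q2, q3, n)) n.+1%:R^-1 x.
    by split; [split|]; rewrite /ball/= distrC.
  exists (q1, q2, q3, n) => //; rewrite /F; case: asboolP => // -[].
  move=> y cy; apply: eU; rewrite (splitr e).
  apply: (ball_triangle (y := c (q1, q2, q3, n))).
    by apply/ball_sym; apply: le_ball xc; exact: ltW.
  by apply: le_ball cy; exact: ltW.
apply: countable_bigcupT_measurable => // i.
by rewrite /F; case: asboolP => // _; exact: measurable_ball_pt.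
Qed.

Lemma continuous_measurable_pt f : continuous f -> measurable_fun setT f.
Proof.
move=> /continuousP cf; apply: (measurability _ (RGenOpens.measurableE R)).
move=> _ [_ [a [b ->] <-]]; rewrite setTI; apply: open_measurable_pt.
exact/cf/interval_open.
Qed.

Lemma measurable_box r : measurable (box r).
Proof. by apply: measurableX => //; exact: measurableX. Qed.

Lemma leb_itv_fin (r : R) : leb `[- r, r]%classic \is a fin_num.
Proof. by rewrite /leb/= lebesgue_measure_itv/=; case: ifP. Qed.

Lemma leb2_box_fin (r : R) :
  leb2 (`[- r, r]%classic `*` `[- r, r]%classic) \is a fin_num.
Proof. by rewrite /leb2/= product_measure1E// fin_numM// leb_itv_fin. Qed.

Lemma vol_box_lty r : (vol (box r) < +oo)%E.
Proof.
rewrite /vol/= product_measure1E//; last exact: measurableX.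
by rewrite ltey_eq fin_numM// ?leb2_box_fin ?leb_itv_fin.
Qed.

Lemma compact_box r : compact (box r).
Proof.
by apply: compact_setX; [apply: compact_setX|]; exact: segment_compact.
Qed.

Lemma continuous_bounded_box f r : continuous f -> exists M, forall x, box r x -> `|f x| <= M.
Proof.
move=> cf; have [r0|r0] := leP 0 r; last first.
  exists 0 => -[[a b] c] [[]] /=; rewrite !in_itv /=; lra.
have [| |c cin H] := @compact_EVT_max _ R (fun x => `|f x|) _ _ (@compact_box r).
- exists (0, 0, 0); do ?split; rewrite /= ?in_itv /=; lra.
- apply: continuous_subspaceT => x.
  by apply: continuous_comp; [exact: cf|exact: norm_continuous].
- by exists `|f c| => x Bx; apply: H; rewrite inE.
Qed.

Lemma integrable_bounded_supp d (X : measurableType d)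
    (mu : {measure set X -> \bar R}) (D : set X) (f : X -> R) M :
  measurable D -> (mu D < +oo)%E -> measurable_fun setT f ->
  (forall x, `|f x| <= M) -> (forall x, ~ D x -> f x = 0) ->
  mu.-integrable setT (EFin \o f).
Proof.
move=> mD Doo mf fM f0; suff : mu.-integrable D (EFin \o f).
  rewrite integrable_mkcond//.
  apply: eq_integrable => // x _; rewrite /patch; case: ifPn => // /negP xD.
  by rewrite /= f0// => Dx; apply: xD; rewrite inE.
apply: measurable_bounded_integrable => //; first exact: measurable_funS mf.
exists M; split; first exact: num_real.
by move=> N MN x _ /=; rewrite (le_trans (fM x))// ltW.
Qed.

Lemma integrable_box f r M : measurable_fun setT f -> (forall x, `|f x| <= M) ->
  (forall x, ~ box r x -> f x = 0) -> vol.-integrable setT (EFin \o f).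
Proof.
move=> mf fM f0; apply: (@integrable_bounded_supp _ _ vol (box r) f M) => //.
- exact: measurable_box.
- exact: vol_box_lty.
Qed.

Lemma integrable_continuous_box f r : continuous f ->
  (forall x, ~ box r x -> f x = 0) -> vol.-integrable setT (EFin \o f).
Proof.
move=> cf f0; have [M HM] := continuous_bounded_box r cf.
apply: (@integrable_box f r (Num.max M 0)) => //.
- exact: continuous_measurable_pt.
- move=> x; have [Bx|Bx] := pselect (box r x); rewrite le_max.
    by rewrite HM.
  by rewrite f0// normr0 lexx orbT.
Qed.

Lemma integral_derive1 (F f : R -> R) (r : R) : continuous f ->
  (forall t : R, is_derive t (1 : R) F (f t)) ->
  (forall t, ~ `[- r, r]%classic t -> F t = 0) ->
  (\int[leb]_t (f t)%:E = 0)%E.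
Proof.
move=> cf dF F0.
have cF : continuous F.
  move=> t; apply/differentiable_continuous/derivable1_diffP.
  by case: (dF t).
(* Strictly larger than [r], whatever its sign, so that [F] vanishes at both ends of [[- s, s]], and
   near every point outside it. *)
pose s := `|r| + 1.
have s0 : 0 < s by rewrite ltr_wpDl.
have rs : r < s by rewrite (le_lt_trans (ler_norm r))// ltrDl.
have f0 t : ~ `[- s, s]%classic t -> f t = 0.
  move=> st; have [_ <-] := dF t.
  have : \forall u \near t, F u = 0.
    have : (~` `[- s, s]%classic) t by [].
    move=> H; have : nbhs t (~` `[- s, s]%classic).
      by apply: open_nbhs_nbhs; split => //; exact/closed_openC/itv_closed.
    apply: filterS => u us; apply: F0 => ur; apply: us.
    by move: ur; rewrite /= !in_itv /=; lra.
  move=> nF; have -> : 'D_1 F t = 'D_1 (cst 0) t by exact: near_eq_derive.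
  exact: derive_cst.
rewrite (_ : (fun t => _) = (EFin \o f) \_ `[- s, s]%classic).
  rewrite -integral_mkcond (@continuous_FTC2 _ f F)//.
  - rewrite !F0 ?subee// /= in_itv /=; lra.
  - lra.
  - exact: continuous_subspaceT.
  - split.
    + by move=> t _; case: (dF t).
    + by apply: cvg_at_right_filter; exact: cF.
    + by apply: cvg_at_left_filter; exact: cF.
  - by move=> t _; rewrite derive1E; case: (dF t).
apply/funext => t; rewrite /patch; case: ifPn => // /negP xB.
by rewrite /= f0// => Bx; apply: xB; rewrite inE.
Qed.

Lemma continuous_line (x v : pt R) f : continuous f ->
  continuous (fun t : R => f (x + t *: v)).
Proof.
move=> cf t; apply: (@continuous_comp _ _ _ (fun t : R => x + t *: v) f).
  by apply: cvgD; [exact: cvg_cst|exact: cvgZr_tmp cvg_id].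
exact: cf.
Qed.

Lemma derive_supp_box f r v : (forall x, ~ box r x -> f x = 0) ->
  forall x, ~ box r x -> 'D_v f x = 0.
Proof.
move=> f0 x xr; have nf : \near x, f x = cst 0 x.
  have : nbhs x (~` box r).
    apply: open_nbhs_nbhs; split => //; apply: closed_openC.
    by apply: compact_closed; [exact: norm_hausdorff|exact: compact_box].
  by apply: filterS => y /f0.
have -> : 'D_v f x = 'D_v (cst 0) x by exact: near_eq_derive.
exact: derive_cst.
Qed.

(** Fubini makes the integration along [bas j] the innermost one, and on each line the fundamental
    theorem of calculus gives zero. *)
Lemma integral_partial f r (j : 'I_3) : continuous f ->
  (forall x, derivable f x (bas j)) -> continuous (fun x => 'D_(bas j) f x) ->
  (forall x, ~ box r x -> f x = 0) ->
  (\int[vol]_x ('D_(bas j) f x)%:E = 0)%E.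
Proof.
move=> cf df cdf f0.
have line0 x : (forall t : R, ~ `[- r, r]%classic t -> ~ box r (x + t *: bas j)) ->
    (\int[leb]_t ('D_(bas j) f (x + t *: bas j))%:E = 0)%E.
  move=> xr; apply: (@integral_derive1 (fun t => f (x + t *: bas j)) _ r).
  - exact: (@continuous_line x (bas j) (fun x => 'D_(bas j) f x)).
  - by move=> t; exact: is_derive_line.
  - by move=> t /xr/f0.
have df0 := derive_supp_box (bas j) f0.
have ig := integrable_continuous_box cdf df0.
have [M HM] := continuous_bounded_box r cdf.
have ig2 c : leb2.-integrable setT (fun ab => ('D_(bas j) f (ab, c))%:E).
  apply: (@integrable_bounded_supp _ _ leb2 (`[- r, r] `*` `[- r, r])
    (fun ab => 'D_(bas j) f (ab, c)) (Num.max M 0)).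
  - exact: measurableX.
  - by rewrite ltey_eq leb2_box_fin.
  - apply: (measurableT_comp (continuous_measurable_pt cdf)).
    exact: pair2_measurable.
  - move=> ab; have [Bx|Bx] := pselect (box r (ab, c)); rewrite le_max.
      by rewrite HM.
    by rewrite df0// normr0 lexx orbT.
  - by move=> ab abr; apply: df0 => -[].
(* [vol] is an iterated product, hence a different order of integration for each coordinate. *)
case: j => -[|[|[|//]]] j3 in df cdf line0 df0 ig HM ig2 *.
- refine (etrans (esym (@integral21_prod_meas1 _ _ _ _ R leb2 leb _ ig)) _).
  rewrite integral0_eq// => c _.
  refine (etrans (esym (@integral21_prod_meas1 _ _ _ _ R leb leb _ (ig2 c))) _).
  rewrite integral0_eq// => b _.
  have E t : ((0, b, c) : pt R) + t *: bas (Ordinal j3) = (t, b, c).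
    by rewrite /bas/=; congr ((_, _), _) => /=; rewrite /GRing.scale/=; lra.
  rewrite -[RHS](line0 (0, b, c)); first by apply: eq_integral => t _; rewrite E.
  by move=> t tr [[/= + _] _]; rewrite /GRing.scale/= add0r mulr1.
- refine (etrans (esym (@integral21_prod_meas1 _ _ _ _ R leb2 leb _ ig)) _).
  rewrite integral0_eq// => c _.
  refine (etrans (esym (@integral12_prod_meas1 _ _ _ _ R leb leb _ (ig2 c))) _).
  rewrite integral0_eq// => a _.
  have E t : ((a, 0, c) : pt R) + t *: bas (Ordinal j3) = (a, t, c).
    by rewrite /bas/=; congr ((_, _), _) => /=; rewrite /GRing.scale/=; lra.
  rewrite -[RHS](line0 (a, 0, c)); first by apply: eq_integral => t _; rewrite E.
  by move=> t tr [[/= _ +] _]; rewrite /GRing.scale/= add0r mulr1.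
- refine (etrans (esym (@integral12_prod_meas1 _ _ _ _ R leb2 leb _ ig)) _).
  rewrite integral0_eq// => -[a b] _.
  have E t : ((a, b, 0) : pt R) + t *: bas (Ordinal j3) = (a, b, t).
    by rewrite /bas/=; congr ((_, _), _) => /=; rewrite /GRing.scale/=; lra.
  rewrite -[RHS](line0 (a, b, 0)); first by apply: eq_integral => t _; rewrite E.
  by move=> t tr [/= _ +]; rewrite /GRing.scale/= add0r mulr1.
Qed.

End Measure.

(** * Vector algebra in dimension three *)

Section Vectors3.
Context {R : realType}.
Implicit Types (x v : pt R) (a b c : 'rV[R]_3).

Definition o0 : 'I_3 := Ordinal (isT : 0 < 3)%N.
Definition o1 : 'I_3 := Ordinal (isT : 1 < 3)%N.
Definition o2 : 'I_3 := Ordinal (isT : 2 < 3)%N.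

Lemma sum3 (V : nmodType) (F : 'I_3 -> V) : \sum_i F i = F o0 + F o1 + F o2.
Proof.
rewrite !big_ord_recr big_ord0 /= add0r.
by congr (F _ + F _ + F _); exact: val_inj.
Qed.

Lemma all3 (Pr : 'I_3 -> Prop) : Pr o0 -> Pr o1 -> Pr o2 -> forall i, Pr i.
Proof.
move=> p0 p1 p2 [[|[|[|//]]] i3].
- by rewrite (_ : Ordinal i3 = o0)//; exact: val_inj.
- by rewrite (_ : Ordinal i3 = o1)//; exact: val_inj.
- by rewrite (_ : Ordinal i3 = o2)//; exact: val_inj.
Qed.

Lemma o3D : (o0 + 1 = o1) * (o0 + 2 = o2) * (o1 + 1 = o2) * (o1 + 2 = o0) *
  (o2 + 1 = o0) * (o2 + 2 = o1).
Proof. by do !split; exact: val_inj. Qed.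

Lemma dot3 a b : dot a b = a 0 o0 * b 0 o0 + a 0 o1 * b 0 o1 + a 0 o2 * b 0 o2.
Proof. by rewrite /dot sum3. Qed.

Lemma cross3 a b : (cross a b 0 o0 = a 0 o1 * b 0 o2 - a 0 o2 * b 0 o1) *
  (cross a b 0 o1 = a 0 o2 * b 0 o0 - a 0 o0 * b 0 o2) *
  (cross a b 0 o2 = a 0 o0 * b 0 o1 - a 0 o1 * b 0 o0).
Proof. by rewrite !mxE !o3D. Qed.

Lemma curl_of3 (A : 'M[R]_3) : (curl_of A 0 o0 = A o2 o1 - A o1 o2) *
  (curl_of A 0 o1 = A o0 o2 - A o2 o0) * (curl_of A 0 o2 = A o1 o0 - A o0 o1).
Proof. by rewrite !mxE !o3D. Qed.

Lemma row3P a b : a 0 o0 = b 0 o0 -> a 0 o1 = b 0 o1 -> a 0 o2 = b 0 o2 -> a = b.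
Proof.
by move=> h0 h1 h2; apply/rowP; exact: all3.
Qed.

Lemma dotC a b : dot a b = dot b a.
Proof. by rewrite !dot3; ring. Qed.

Lemma dotDl a b c : dot (a + b) c = dot a c + dot b c.
Proof. by rewrite !dot3 !mxE; ring. Qed.

Lemma dotZl (t : R) a b : dot (t *: a) b = t * dot a b.
Proof. by rewrite !dot3 !mxE; ring. Qed.

Lemma dotNl a b : dot (- a) b = - dot a b.
Proof. by rewrite !dot3 !mxE; ring. Qed.

Lemma dot_ge0 a : 0 <= dot a a.
Proof. by rewrite dot3 -!expr2 !addr_ge0// sqr_ge0. Qed.

Lemma dot_eq0 a : dot a a = 0 -> a = 0.
Proof.
rewrite dot3 => /eqP; rewrite -!expr2 !paddr_eq0 ?addr_ge0 ?sqr_ge0// !sqrf_eq0.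
by move=> /andP[/andP[/eqP h0 /eqP h1] /eqP h2]; apply: row3P; rewrite mxE.
Qed.

Lemma dot_gt0 a : a != 0 -> 0 < dot a a.
Proof.
move=> a0; rewrite lt_neqAle dot_ge0 andbT eq_sym.
by apply: contra_neq a0; exact: dot_eq0.
Qed.

(** The half-space [0 < v . a] determines the direction of its normal [a]. *)
Lemma normalized_eq a b : a != 0 -> b != 0 ->
  (forall v : 'rV[R]_3, 0 < dot v a -> 0 <= dot v b) ->
  (Num.sqrt (dot a a))^-1 *: a = (Num.sqrt (dot b b))^-1 *: b.
Proof.
move=> a0 b0 ab; have da := dot_gt0 a0.
(* A vector orthogonal to [a] is a limit of vectors of the open half-space: were [dot v b] negative,
   adding a small positive multiple of [a] would keep it negative and contradict [ab]. *)
have ab1 (v : 'rV[R]_3) : dot v a = 0 -> 0 <= dot v b.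
  move=> va; rewrite leNgt; apply/negP => vb.
  have [ba|ba] := leP (dot a b) 0.
    have := ab (v + a); rewrite !dotDl va; lra.
  pose t := - dot v b / (2 * dot a b).
  have t0 : 0 < t by rewrite divr_gt0; lra.
  have := ab (v + t *: a); rewrite !dotDl !dotZl va add0r mulr_gt0// => /(_ isT).
  rewrite /t (_ : _ * dot a b = - dot v b / 2); first lra.
  by field; rewrite gt_eqF.
have ab0 (v : 'rV[R]_3) : dot v a = 0 -> dot v b = 0.
  move=> va; apply/eqP; rewrite eq_le ab1// andbT -oppr_ge0 -dotNl.
  by rewrite ab1// dotNl va oppr0.
(* Everything orthogonal to [a] is orthogonal to [b], so [b] is its own projection onto [a]. *)
pose l := dot a b / dot a a.
have bE : b = l *: a.
  apply/eqP; rewrite -subr_eq0 -scaleNr; apply/eqP/dot_eq0.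
  have va : dot (b + - l *: a) a = 0.
    by rewrite dotDl dotZl /l dotC; field; rewrite gt_eqF.
  rewrite dotC in va *; rewrite dotDl dotZl va mulr0 addr0.
  by rewrite dotC ab0// dotC.
have l0 : 0 < l.
  rewrite lt_neqAle eq_sym; apply/andP; split.
    by apply: contra_neq b0; rewrite bE => ->; rewrite scale0r.
  by rewrite divr_ge0 ?ab// ltW.
rewrite bE dotZl (dotC a (l *: a)) dotZl mulrA -expr2 sqrtrM ?sqr_ge0// sqrtr_sqr.
rewrite gtr0_norm// scalerA; congr (_ *: a); field.
by rewrite !gt_eqF// sqrtr_gt0.
Qed.

Lemma pos3 x : (pos x 0 o0 = x.1.1) * (pos x 0 o1 = x.1.2) * (pos x 0 o2 = x.2).
Proof. by rewrite !mxE. Qed.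

Lemma pos_bas (i j : 'I_3) : pos (bas j : pt R) 0 i = (i == j)%:R.
Proof. by move: i j; do 2 apply: all3; rewrite mxE. Qed.

Lemma posD x v : pos (x + v) = pos x + pos v.
Proof. by apply: row3P; rewrite !mxE. Qed.

Lemma posZ (t : R) v : pos (t *: v) = t *: pos v.
Proof. by apply: row3P; rewrite !mxE. Qed.

Lemma pos_sum v : v = pos v 0 o0 *: bas o0 + pos v 0 o1 *: bas o1 + pos v 0 o2 *: bas o2.
Proof.
case: v => [[v0 v1] v2]; rewrite !pos3 /bas/=.
by congr ((_, _), _) => /=; rewrite /GRing.scale/=; lra.
Qed.

Lemma derive_grad (f : pt R -> R) x v : Ck 1 setT f ->
  'D_v f x = dot (pos v) (grad f x).
Proof.
move=> cf; rewrite {1}(pos_sum v) !derive_linear// -[_ *: bas o0]add0r.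
by rewrite derive_linear// derive0 add0r dot3 !mxE.
Qed.

Lemma additive_is_derive (V : normedModType R) (f : V -> R) (x v : V) :
  (forall y z, f (y + z) = f y + f z) -> (forall (t : R) y, f (t *: y) = t * f y) ->
  is_derive x v f (f v).
Proof.
move=> fD fZ.
suff Q : (fun h : R => h^-1 *: ((f \o shift x) (h *: v) - f x)) h @[h --> 0^'] --> f v.
  by split; [apply/cvg_ex; exists (f v)|apply/cvg_lim].
apply: cvg_near_cst; near=> h.
have h0 : h != 0 by near: h; exact: nbhs_dnbhs_neq.
by rewrite /= fD fZ addrK -[_ *: _]/(h^-1 * _) mulKf.
Unshelve. all: by end_near.
Qed.

Lemma Ck_additive (V : normedModType R) (f : V -> R) k :
  (forall y z, f (y + z) = f y + f z) -> (forall (t : R) y, f (t *: y) = t * f y) ->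
  continuous f -> Ck k setT f.
Proof.
move=> fD fZ cf; case: k => [|k]; first by move=> x _; exact: cf.
split=> [x _|v]; first exact: cf.
split=> [x _|]; first by case: (additive_is_derive x v fD fZ).
have -> : (fun x : V => 'D_v f x) = fun _ => f v; last exact: Ck_cst.
by apply/funext => x; case: (additive_is_derive x v fD fZ).
Qed.

Lemma Ck_pos k (i : 'I_3) : Ck k setT (fun x : pt R => pos x 0 i).
Proof.
apply: Ck_additive => [y z|t y|]; rewrite ?posD ?posZ ?mxE//.
elim/all3: i.
- rewrite (_ : (fun _ => _) = fun x : pt R => x.1.1).
    by move=> x; apply: (@continuous_comp _ _ _ fst fst); exact: cvg_fst.
  by apply/funext => x; rewrite pos3.
- rewrite (_ : (fun _ => _) = fun x : pt R => x.1.2).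
    by move=> x; apply: (@continuous_comp _ _ _ fst snd); [exact: cvg_fst|exact: cvg_snd].
  by apply/funext => x; rewrite pos3.
- rewrite (_ : (fun _ => _) = fun x : pt R => x.2).
    by move=> x; exact: cvg_snd.
  by apply/funext => x; rewrite pos3.
Qed.

Lemma derive_pos x v (i : 'I_3) : 'D_v (fun y => pos y 0 i) x = pos v 0 i.
Proof.
have pD (y z : pt R) : pos (y + z) 0 i = pos y 0 i + pos z 0 i by rewrite posD mxE.
have pZ (t : R) (y : pt R) : pos (t *: y) 0 i = t * pos y 0 i by rewrite posZ mxE.
by case: (additive_is_derive x v pD pZ).
Qed.

Lemma Ck1_R k (f f' : R -> R) : (forall t : R, is_derive t (1 : R) f (f' t)) ->
  Ck k setT f' -> Ck k.+1 setT f.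
Proof.
move=> df cf'.
have dff t : differentiable f t by apply/derivable1_diffP; case: (df t).
split=> [t _|w]; first exact: differentiable_continuous.
split=> [t _|]; first exact: diff_derivable.
have -> : (fun t : R => 'D_w f t) = fun t => w * f' t; last first.
  by apply: CkM => //; exact: Ck_cst.
apply/funext => t; rewrite deriveE// diff1E//; case: (df t) => _ <-.
by rewrite derive1E.
Qed.

(** Regularity of the outer function is asked only at the values of [f]; this admits the square root
    of a positive function, which [Ck_comp] does not. *)
Lemma Ck_comp_at (g g' : R -> R) (f : pt R -> R) :
  (forall x, is_derive (f x) (1 : R) g (g' (f x))) ->
  (forall x, {for f x, continuous g'}) ->
  Ck 1 setT f -> Ck 1 setT (fun x => g (f x)).
Proof.
move=> dg cg' cf.
have dgf x : derivable g (f x) 1 by case: (dg x).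
have df x v : derivable f x v by exact: Ck_derivable cf I.
split=> [x _|v].
  apply: (continuous_comp (cf.1 x I)).
  by apply/differentiable_continuous/derivable1_diffP.
split=> [x _|]; first by case: (is_derive_comp1 (dgf x) (df x v)).
have -> : (fun x => 'D_v (fun y => g (f y)) x) = (fun x => g' (f x) * 'D_v f x).
  by apply/funext => x; rewrite derive_comp1//; congr (_ * _); case: (dg x).
move=> x _; apply: cvgM; last exact: (cf.2 v).2.
exact: (continuous_comp (cf.1 x I) (cg' x)).
Qed.

End Vectors3.

(** * Piecewise polynomial cutoffs *)

Section Bump.
Context {R : realType}.

Lemma is_derive_congr (V : normedModType R) (f g : V -> R) (x v : V) (a b : R) :
  is_derive x v f a -> f =1 g -> a = b -> is_derive x v g b.
Proof. by move=> df /funext <- <-. Qed.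

(** Truncated power, of class C^(n-1) for positive [n]. Only finitely many derivatives are ever
    taken, so polynomial splines suffice as cutoffs and their bounds stay elementary. *)
Definition pp (n : nat) (t : R) : R := Num.max t 0 ^+ n.

Lemma pp_gt0 n t : 0 < t -> pp n t = t ^+ n.
Proof. by move=> t0; rewrite /pp max_l// ltW. Qed.

Lemma pp_le0 n t : t <= 0 -> pp n.+1 t = 0.
Proof. by move=> t0; rewrite /pp max_r// expr0n. Qed.

Lemma pp_ge0 n t : 0 <= pp n t.
Proof. by rewrite exprn_ge0// le_max lexx orbT. Qed.

Lemma is_derive_pp n (t : R) :
  is_derive t (1 : R) (pp n.+2) (n.+2%:R * pp n.+1 t).
Proof.
have [t0|t0|->] := ltgtP t 0.
- have nE : \near t, cst 0 t = pp n.+2 t.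
    near=> s; rewrite /= pp_le0// ltW//; near: s; exact: lt_nbhsl.
  rewrite pp_le0 ?ltW// mulr0.
  exact: (near_eq_is_derive nE (is_derive_cst (0 : R) t (1 : R))).
- have nE : \near t, (fun s => s ^+ n.+2) t = pp n.+2 t.
    near=> s; rewrite /= pp_gt0//; near: s; exact: lt_nbhsr.
  apply: (near_eq_is_derive nE).
  have := DeriveDef (@exprn_derivable R n.+2 t 1) (exp_derive n.+2 t 1).
  by rewrite pp_gt0// /= scaler1 -[_ *: _]/(_ * _).
- rewrite pp_le0// mulr0.
  suff Q : (fun h : R => h^-1 *: ((pp n.+2 \o shift 0) (h *: 1) - pp n.+2 0)) h
      @[h --> 0^'] --> (0 : R).
    by split; [apply/cvg_ex; exists 0|apply/cvg_lim].
  apply/cvgrPdist_lt => e e0; near=> h.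
  have h0 : h != 0 by near: h; exact: nbhs_dnbhs_neq.
  have he : `|h| < Num.min e 1.
    by near: h; apply: dnbhs0_lt; rewrite lt_min e0 ltr01.
  rewrite /= [h%:A]mulr1 addr0 (pp_le0 n.+1 (lexx _)) subr0 sub0r normrN.
  rewrite -[_ *: _]/(_ * _) normrM normfV ltr_pdivrMl ?normr_gt0// mulrC.
  move: he; rewrite lt_min => /andP[he h1].
  have : `|pp n.+2 h| <= `|h| ^+ n.+2.
    rewrite ger0_norm ?pp_ge0// lerXn2r ?nnegrE ?le_max ?lexx ?orbT//.
    by rewrite ge_max ler_norm normr_ge0.
  move/le_lt_trans; apply; rewrite exprSr ltr_pM2r ?normr_gt0//.
  by rewrite (le_lt_trans _ he)// exprS ler_piMr// exprn_ile1// ltW.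
Unshelve. all: by end_near.
Qed.

Lemma derive_pp n (t : R) : 'D_1 (pp n.+2) t = n.+2%:R * pp n.+1 t.
Proof. by case: (is_derive_pp n t). Qed.

Lemma continuous_pp1 : continuous (pp 1).
Proof.
have -> : pp 1 = fun t => (t + `|t|) / 2.
  apply/funext => t; rewrite /pp expr1.
  by have [t0|t0] := leP t 0; [rewrite ler0_norm//|rewrite gtr0_norm//]; field.
move=> t; apply: cvgM; last exact: cvg_cst.
by apply: cvgD; [exact: cvg_id|exact: norm_continuous].
Qed.

Lemma Ck_pp n : Ck n setT (pp n.+1).
Proof.
elim: n => [|n IH]; first by move=> t _; exact: continuous_pp1.
apply: Ck1_R; first exact: is_derive_pp.
by apply: CkM => //; exact: Ck_cst.
Qed.

(** Quadratic spline equal to 0 up to 1 and to 1 from 2 on. Its derivative [dstep] is the hat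
    function on [[1, 2]] with peak 2 at [3 / 2]. *)
Definition step (s : R) : R :=
  2 * (pp 2 (s - 1) - 2 * pp 2 (s - 3 / 2) + pp 2 (s - 2)).
Definition dstep (s : R) : R :=
  4 * (pp 1 (s - 1) - 2 * pp 1 (s - 3 / 2) + pp 1 (s - 2)).

Lemma is_derive_step (s : R) : is_derive s (1 : R) step (dstep s).
Proof.
have d (a : R) : is_derive s (1 : R) (fun s => pp 2 (s - a)) (2 * pp 1 (s - a)).
  have e : is_derive s (1 : R) (fun s => s - a) 1.
    by apply: is_derive_eq; rewrite subr0.
  rewrite -[X in is_derive _ _ _ X]mulr1.
  exact: (@is_derive1_comp R (pp 2) (fun s => s - a) s _ _ (is_derive_pp 0 (s - a)) e).
apply: (is_derive_congr (is_deriveZ 2 (is_deriveD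
  (is_deriveB (d 1) (is_deriveZ 2 (d (3 / 2)))) (d 2)))) => //.
by rewrite /dstep /GRing.scale/=; ring.
Qed.

Lemma continuous_dstep : continuous dstep.
Proof.
have d (a : R) : continuous (fun s => pp 1 (s - a)).
  move=> s; apply: (@continuous_comp _ _ _ (fun s => s - a) (pp 1)).
    by apply: cvgB; [exact: cvg_id|exact: cvg_cst].
  exact: continuous_pp1.
move=> s; apply: cvgM; first exact: cvg_cst.
apply: cvgD; last exact: d.
by apply: cvgB; [exact: d|apply: cvgM; [exact: cvg_cst|exact: d]].
Qed.

Lemma Ck_step : Ck 1 setT step.
Proof.
apply: Ck1_R; first exact: is_derive_step.
by move=> s _; exact: continuous_dstep.
Qed.

Lemma pp_cases (n : nat) (t : R) : (0 < t /\ pp n.+1 t = t ^+ n.+1) \/ (t <= 0 /\ pp n.+1 t = 0).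
Proof.
by have [t0|t0] := leP t 0; [right; rewrite pp_le0|left; rewrite pp_gt0].
Qed.

Lemma step_le1 s : s <= 1 -> step s = 0.
Proof. by move=> s1; rewrite /step !pp_le0; lra. Qed.

Lemma step_ge2 s : 2 <= s -> step s = 1.
Proof.
rewrite /step le_eqVlt => /orP[/eqP <-|s2].
  by rewrite [pp 2 (2 - 2)]pp_le0 ?pp_gt0; lra.
by rewrite !pp_gt0; lra.
Qed.

Lemma dstep_ge0 s : 0 <= dstep s.
Proof.
rewrite /dstep.
case: (pp_cases 0 (s - 1)) => -[h1 ->]; case: (pp_cases 0 (s - 3 / 2)) => -[h2 ->];
  case: (pp_cases 0 (s - 2)) => -[h3 ->]; lra.
Qed.

Lemma dstep_le2 s : dstep s <= 2.
Proof.
rewrite /dstep.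
case: (pp_cases 0 (s - 1)) => -[h1 ->]; case: (pp_cases 0 (s - 3 / 2)) => -[h2 ->];
  case: (pp_cases 0 (s - 2)) => -[h3 ->]; lra.
Qed.

Lemma dstep_supp s : ~~ (1 <= s <= 2) -> dstep s = 0.
Proof.
move=> H; rewrite /dstep.
case: (pp_cases 0 (s - 1)) => -[h1 ->]; case: (pp_cases 0 (s - 3 / 2)) => -[h2 ->];
  case: (pp_cases 0 (s - 2)) => -[h3 ->]; move: H; lra.
Qed.

Lemma step_itv s : 0 <= step s <= 1.
Proof.
rewrite /step; case: (pp_cases 1 (s - 1)) => -[h1 ->];
  case: (pp_cases 1 (s - 3 / 2)) => -[h2 ->];
  case: (pp_cases 1 (s - 2)) => -[h3 ->]; apply/andP; split; nra.
Qed.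

(** Even bump supported in [[- r, r]], with derivative [dbmp]. The third power makes it C^2, so that
    the gradient of a function built from it is an admissible C^1 test field. *)
Definition bmp (r s : R) : R := pp 3 (r ^+ 2 - s ^+ 2).
Definition dbmp (r s : R) : R := - 6 * s * pp 2 (r ^+ 2 - s ^+ 2).

Lemma Ck_id k : Ck k setT (fun s : R => s).
Proof.
apply: Ck_additive => // s; exact: cvg_id.
Qed.

Lemma Ck_poly2 k (r : R) : Ck k setT (fun s : R => r ^+ 2 - s ^+ 2).
Proof.
apply: CkB; first exact: Ck_cst.
have -> : (fun s : R => s ^+ 2) = (fun s => s * s) by apply/funext => s; rewrite expr2.
by apply: CkM; exact: Ck_id.
Qed.

Lemma Ck_bmp r : Ck 2 setT (bmp r).
Proof. exact: (Ck_comp (Ck_pp 2) (Ck_poly2 2 r)). Qed.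

Lemma Ck_dbmp r : Ck 1 setT (dbmp r).
Proof.
apply: CkM; last exact: (Ck_comp (Ck_pp 1) (Ck_poly2 1 r)).
by apply: CkM; [exact: Ck_cst|exact: Ck_id].
Qed.

Lemma is_derive_bmp r (s : R) : is_derive s (1 : R) (bmp r) (dbmp r s).
Proof.
have e : is_derive s (1 : R) (fun s => r ^+ 2 - s ^+ 2) (- (2 * s)).
  apply: (is_derive_congr (is_deriveB (is_derive_cst (r ^+ 2) s (1 : R))
    (DeriveDef (@exprn_derivable R 2 s 1) (exp_derive 2 s 1)))) => //.
  by rewrite /GRing.scale/=; ring.
apply: (is_derive_congr (@is_derive1_comp R (pp 3) (fun s => r ^+ 2 - s ^+ 2) s _ _
  (is_derive_pp 1 (r ^+ 2 - s ^+ 2)) e)) => //.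
by rewrite /dbmp; ring.
Qed.

Lemma bmp_ge0 r s : 0 <= bmp r s. Proof. exact: pp_ge0. Qed.

Lemma bmp_out r s : 0 < r -> r <= `|s| -> bmp r s = 0 /\ dbmp r s = 0.
Proof.
move=> r0 rs; have H : r ^+ 2 - s ^+ 2 <= 0.
  rewrite subr_le0 -[s ^+ 2]real_normK ?num_real//.
  by rewrite lerXn2r ?nnegrE// ltW.
by rewrite /bmp /dbmp !pp_le0// mulr0.
Qed.

Lemma dbmp_le0 r s : 0 <= s -> dbmp r s <= 0.
Proof. by move=> s0; have := pp_ge0 2 (r ^+ 2 - s ^+ 2); rewrite /dbmp; nra. Qed.

Lemma dbmp_lt0 r s : 0 < s -> s < r -> dbmp r s < 0.
Proof.
move=> s0 sr; have : 0 < pp 2 (r ^+ 2 - s ^+ 2).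
  have H : 0 < r ^+ 2 - s ^+ 2 by nra.
  by rewrite pp_gt0// exprn_gt0.
by rewrite /dbmp; nra.
Qed.

End Bump.

(** * Real-valued integrals: domination, limits, change of domain *)

Section RealIntegrable.
Context d (X : measurableType d) {R : realType} (mu : {measure set X -> \bar R}).
Implicit Types (D : set X) (f g h : X -> R).

Lemma integrableD_EFin D f g : measurable D -> mu.-integrable D (EFin \o f) ->
  mu.-integrable D (EFin \o g) -> mu.-integrable D (EFin \o (fun x => f x + g x)).
Proof. by move=> mD mf mg; exact: (integrableD mD mf mg). Qed.

Lemma integrableB_EFin D f g : measurable D -> mu.-integrable D (EFin \o f) ->
  mu.-integrable D (EFin \o g) -> mu.-integrable D (EFin \o (fun x => f x - g x)).
Proof. by move=> mD mf mg; exact: (integrableB mD mf mg). Qed.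

Lemma integrableZ_EFin D f (r : R) : measurable D -> mu.-integrable D (EFin \o f) ->
  mu.-integrable D (EFin \o (fun x => r * f x)).
Proof. by move=> mD mf; exact: (integrableZl mD r mf). Qed.

Lemma integrableM_bounded D f h (M : R) : measurable D ->
  mu.-integrable D (EFin \o f) -> measurable_fun D h ->
  (forall x, D x -> `|h x| <= M) ->
  mu.-integrable D (EFin \o (fun x => h x * f x)).
Proof.
move=> mD imf mh hM; have := @integrableMr _ _ _ mu D mD h (EFin \o f) mh.
apply => //; exists M; split; first exact: num_real.
by move=> N MN x Dx; exact: le_trans (hM x Dx) (ltW MN).
Qed.

Lemma integrable_le_EFin D f g : measurable D -> measurable_fun D f ->
  mu.-integrable D (EFin \o g) -> (forall x, D x -> `|f x| <= g x) ->
  mu.-integrable D (EFin \o f).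
Proof.
move=> mD mf ig fg; apply: le_integrable ig => //; first exact/measurable_EFinP.
move=> x Dx /=; rewrite lee_fin (le_trans (fg x Dx))//.
exact: ler_norm.
Qed.

Lemma Rintegral_dominated_cvg D (f_ : nat -> X -> R) f g : measurable D ->
  (forall n, measurable_fun D (f_ n)) -> measurable_fun D f ->
  (forall x, D x -> f_ n x @[n --> \oo] --> f x) ->
  mu.-integrable D (EFin \o g) -> (forall n x, D x -> `|f_ n x| <= g x) ->
  \int[mu]_(x in D) f_ n x @[n --> \oo] --> \int[mu]_(x in D) f x.
Proof.
move=> mD mf_ mf cf ig fg.
have [||||iff _] := @dominated_convergence _ X R mu D mD (fun n => EFin \o f_ n)
    (EFin \o f) (EFin \o g) _ _ _ ig.
- by move=> n; exact/measurable_EFinP.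
- exact/measurable_EFinP.
- by apply: aeW => x Dx; apply: cvg_EFin; [exact: nearW|exact: cf].
- by apply: aeW => x n Dx; rewrite lee_fin; exact: fg.
move=> C; apply: fine_cvg; rewrite fineK//.
exact: integrable_fin_num.
Qed.


Lemma Rintegral_extend D (E : set X) f : measurable D -> D `<=` E ->
  (forall x, E x -> ~ D x -> f x = 0) ->
  \int[mu]_(x in D) f x = \int[mu]_(x in E) f x.
Proof.
move=> mD DE f0; rewrite Rintegral_mkcond [RHS]Rintegral_mkcond.
apply: eq_Rintegral => x _; rewrite /patch.
case: ifPn => [xD|xD]; first by rewrite mem_set//; apply: DE; rewrite inE in xD.
case: ifPn => // xE; rewrite f0//; first by rewrite inE in xE.
by move=> Dx; move: xD; rewrite mem_set.
Qed.

End RealIntegrable.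

(** * The defining function of a boundary chart *)

Section Chart.
Context {R : realType}.

Lemma pos_line (x v : pt R) (t : R) i :
  pos (x + t *: v) 0 i = pos x 0 i + t * pos v 0 i.
Proof. by rewrite posD posZ; move: (pos x) (pos v) => a b; rewrite !mxE. Qed.

Variables (k : 'I_3) (sg : R) (gam : pt R -> R).
Hypothesis sg2 : sg * sg = 1.
Hypothesis gamC : Ck 2 setT gam.
Hypothesis gamI : forall x (h : R), gam (x + h *: bas k) = gam x.
Implicit Types (x : pt R).

(** In a chart the domain is [{Phi > 0}]; [pr] projects onto [{Phi = 0}] along
  the [k]-th axis, and [inv e] says that [e] is constant along that axis. *)
Definition Phi x : R := sg * pos x 0 k - gam x.
Definition inv (e : pt R -> R) := forall x (h : R), e (x + h *: bas k) = e x.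
Definition pr x : pt R := x + (- (sg * Phi x)) *: bas k.

Lemma Phi_C2 : Ck 2 setT Phi.
Proof.
exact: (CkB (CkM (@Ck_cst _ _ 2 setT sg) (Ck_pos 2 k)) gamC).
Qed.

Lemma Phi_shift x h : Phi (x + h *: bas k) = Phi x + sg * h.
Proof.
by rewrite /Phi gamI pos_line pos_bas eqxx mulr1; ring.
Qed.

Lemma Phi_pr x : Phi (pr x) = 0.
Proof. by rewrite Phi_shift mulrN mulrA sg2 mul1r subrr. Qed.

Lemma pr_shift x h : pr (x + h *: bas k) = pr x.
Proof.
rewrite /pr Phi_shift -addrA -scalerDl; congr (x + _ *: _).
by rewrite mulrDr mulrA sg2; ring.
Qed.

Lemma inv_derive_k e x : inv e -> is_derive x (bas k) e 0.
Proof.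
move=> ie; apply: is_derive_of_line.
rewrite (_ : (fun s => _) = cst (e x)); first exact: is_derive_cst.
by apply/funext => s; rewrite ie.
Qed.

Lemma inv_derive e v : inv e -> inv (fun x => 'D_v e x).
Proof.
move=> ie x h; rewrite -(derive_translate e x v (h *: bas k)).
by congr ('D_v _ x); apply/funext => y; rewrite ie.
Qed.

(** A shift along the axis changes [Phi] by a constant only, since [gam] does not depend on that
    coordinate. *)
Lemma dPhi_inv v : inv (fun x => 'D_v Phi x).
Proof.
move=> x h; rewrite -(derive_translate Phi x v (h *: bas k)).
rewrite (_ : (fun y => _) = (fun y => Phi y + cst (sg * h) y)); last first.
  by apply/funext => y; rewrite Phi_shift.
rewrite deriveD//; last exact: (Ck_derivable Phi_C2 I).
by rewrite derive_cst addr0.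
Qed.

Lemma dPhi_k x : 'D_(bas k) Phi x = sg.
Proof.
have D : is_derive x (bas k) Phi sg.
  apply: is_derive_of_line.
  rewrite (_ : (fun s => _) = (fun s => Phi x + sg * s)); last first.
    by apply/funext => s; rewrite Phi_shift.
  apply: (is_derive_congr (is_deriveD (is_derive_cst (Phi x) (0 : R) (1 : R))
    (is_deriveZ sg (is_derive_id (0 : R) (1 : R))))) => //.
  by rewrite add0r /GRing.scale/= mulr1.
by case: D.
Qed.

(** Identifies the vector normalized in [outer_normal] with [- grad Phi]: [Phi] increases into the
    domain. *)
Lemma grad_gam x : grad gam x - sg *: delta_mx 0 k = - grad Phi x.
Proof.
apply/rowP => j; rewrite !mxE.
have cp : Ck 1 setT (fun x : pt R => sg * pos x 0 k).
  exact: (CkM (@Ck_cst _ _ 1 setT sg) (Ck_pos 1 k)).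
have -> : 'D_(bas j) Phi x = sg * (j == k)%:R - 'D_(bas j) gam x.
  rewrite /Phi (deriveB (Ck_derivable cp I) (Ck_derivable gamC I)).
  congr (_ - _); have dp := Ck_derivable (Ck_pos 1 k) (I : setT x).
  rewrite (@deriveZ _ _ _ (fun y => pos y 0 k) sg)//.
  by rewrite derive_pos pos_bas eq_sym.
by rewrite eqxx opprB.
Qed.

Lemma grad_Phi_neq0 x : grad Phi x != 0.
Proof.
apply/eqP => /rowP/(_ k); rewrite !mxE dPhi_k => sg0.
by move: sg2; rewrite sg0 mul0r => /esym/eqP; rewrite oner_eq0.
Qed.

Lemma derive_comp_Phi (q q' : R -> R) x v :
  (forall t : R, is_derive t (1 : R) q (q' t)) ->
  is_derive x v (fun y => q (Phi y)) (q' (Phi x) * 'D_v Phi x).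
Proof.
move=> dq; have [d1 d2] := dq (Phi x).
have := is_derive_comp1 d1 (Ck_derivable (v := v) Phi_C2 (I : setT x)).
by rewrite d2.
Qed.

Lemma Rintegral_partial f b (j : 'I_3) : continuous f ->
  (forall x, derivable f x (bas j)) -> continuous (fun x => 'D_(bas j) f x) ->
  (forall x, ~ box b x -> f x = 0) ->
  \int[vol]_x 'D_(bas j) f x = 0.
Proof. by move=> *; rewrite /Rintegral (@integral_partial _ f b). Qed.

Lemma continuous_Phi : continuous Phi.
Proof. by move=> x; exact: (Ck_continuous Phi_C2 I). Qed.

Lemma continuous_comp_Phi (q : R -> R) : continuous q -> continuous (fun x => q (Phi x)).
Proof.
move=> cq x; apply: (@continuous_comp _ _ _ Phi q); first exact: continuous_Phi.
exact: cq.
Qed.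

(** The coarea formula in the direction of [bas k], along which [Phi] has slope
  [sg], with the boundary values of [q] vanishing. *)
Lemma Rintegral_level (q q' : R -> R) (e : pt R -> R) b :
  (forall t : R, is_derive t (1 : R) q (q' t)) -> continuous q' ->
  continuous e -> inv e -> (forall x, ~ box b x -> q (Phi x) * e x = 0) ->
  \int[vol]_x (q' (Phi x) * e x) = 0.
Proof.
move=> dq cq' ce ie supp.
have cq : continuous q.
  move=> t; apply/differentiable_continuous/derivable1_diffP.
  by case: (dq t).
pose f x := q (Phi x) * e x.
have cf : continuous f.
  by move=> x; apply: cvgM; [exact: continuous_comp_Phi|exact: ce].
have df x : is_derive x (bas k) f (sg * (q' (Phi x) * e x)).
  have := is_deriveM (derive_comp_Phi x (bas k) dq) (inv_derive_k x ie).
  move/is_derive_congr; apply => //.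
  by rewrite dPhi_k /GRing.scale/= mulr0 add0r; ring.
have E x : 'D_(bas k) f x = sg * (q' (Phi x) * e x) by case: (df x).
have cE : continuous (fun x => 'D_(bas k) f x).
  under eq_fun do rewrite E.
  move=> x; apply: cvgM; first exact: cvg_cst.
  by apply: cvgM; [exact: continuous_comp_Phi|exact: ce].
have := Rintegral_partial cf (fun x => @ex_derive _ _ _ _ _ _ _ (df x)) cE supp.
move=> I0.
have -> : (fun x => q' (Phi x) * e x) = (fun x => sg * 'D_(bas k) f x).
  by apply/funext => x; rewrite E mulrA sg2 mul1r.
rewrite RintegralZl//; first by rewrite I0 mulr0.
apply: (@integrable_continuous_box _ _ b) => //.
exact: derive_supp_box.
Qed.

Lemma product_rule_sum (px mx a w0 w1 w2 m0 m1 m2 e0 e1 e2 b0 b1 b2 : R) :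
  a * mx * (w0 * b0 + w1 * b1 + w2 * b2) = 0 ->
  px * ((e0 + e1 + e2) * mx + (w0 * m0 + w1 * m1 + w2 * m2)) =
  a * mx * (w0 * b0) + px * (e0 * mx + w0 * m0) +
  (a * mx * (w1 * b1) + px * (e1 * mx + w1 * m1)) +
  (a * mx * (w2 * b2) + px * (e2 * mx + w2 * m2)).
Proof. by move=> T0; rewrite -[LHS]add0r -T0; ring. Qed.

(** The divergence theorem for the compactly supported field [p(Phi) * m * W]. Differentiating
    [p(Phi)] produces the factor [W . grad Phi], which [tan] removes, so no derivative of [p]
    survives. *)
Lemma Rintegral_div (p : R -> R) (W : 'I_3 -> pt R -> R) (m : pt R -> R) b :
  Ck 1 setT p -> (forall i, Ck 1 setT (W i)) -> Ck 1 setT m ->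
  (forall x, 'D_1 p (Phi x) * m x * (\sum_i W i x * 'D_(bas i) Phi x) = 0) ->
  (forall x, ~ box b x -> p (Phi x) * m x = 0) ->
  \int[vol]_x (p (Phi x) * ((\sum_i 'D_(bas i) (W i) x) * m x
     + \sum_i W i x * 'D_(bas i) m x)) = 0.
Proof.
move=> cp cW cm tan supp.
pose f i x := p (Phi x) * (W i x * m x).
have cf i : Ck 1 setT (f i).
  by apply: CkM; [exact: (Ck_comp cp (CkS Phi_C2))|exact: CkM].
have supf i x : ~ box b x -> f i x = 0.
  by move=> /supp; rewrite /f mulrCA => ->; rewrite mulr0.
have c0 i : continuous (f i) by move=> x; exact: (Ck_continuous (cf i) I).
have c1 i : continuous (fun x => 'D_(bas i) (f i) x).
  by move=> x; exact: ((cf i).2 (bas i)).2.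
have d1 i x : derivable (f i) x (bas i) by exact: (Ck_derivable (cf i) I).
have I0 i : \int[vol]_x 'D_(bas i) (f i) x = 0.
  exact: (Rintegral_partial (c0 i) (d1 i) (c1 i) (supf i)).
have ii i : vol.-integrable setT (EFin \o (fun x => 'D_(bas i) (f i) x)).
  apply: (@integrable_continuous_box _ _ b); first exact: c1.
  exact: derive_supp_box (bas i) (supf i).
have dfE i x : 'D_(bas i) (f i) x = 'D_1 p (Phi x) * m x * (W i x * 'D_(bas i) Phi x)
    + p (Phi x) * ('D_(bas i) (W i) x * m x + W i x * 'D_(bas i) m x).
  have dp : derivable p (Phi x) 1 by exact: (Ck_derivable cp I).
  have dPhi : derivable Phi x (bas i) by exact: (Ck_derivable Phi_C2 I).
  have dW : derivable (W i) x (bas i) by exact: (Ck_derivable (cW i) I).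
  have dm : derivable m x (bas i) by exact: (Ck_derivable cm I).
  have [D1 D2] := is_derive_comp1 dp dPhi.
  rewrite /f (deriveM D1 (derivableM dW dm)) D2 (deriveM dW dm) /GRing.scale/=.
  rewrite -[(W i * m) x]/(W i x * m x).
  move: ('D_1 p _) ('D_(bas i) Phi x) ('D_(bas i) m x) ('D_(bas i) (W i) x).
  by move: (p _) (m x) (W i x) => *; ring.
transitivity (\int[vol]_x ('D_(bas o0) (f o0) x + 'D_(bas o1) (f o1) x +
    'D_(bas o2) (f o2) x)); last first.
  by rewrite !RintegralD// ?I0 ?addr0//; exact: integrableD_EFin.
apply: eq_Rintegral => x _; rewrite !dfE; have := tan x; rewrite !sum3.
exact: product_rule_sum.
Qed.

End Chart.

(** * The weak curl as the curl of the weak Jacobian *)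

Section WeakCurl.
Context {R : realType}.
Implicit Types (Om A : set (pt R)) (f g : pt R -> R).

Lemma volD Om f g : measurable Om -> vol.-integrable Om (EFin \o f) ->
  vol.-integrable Om (EFin \o g) -> \int[vol]_(x in Om) (f x + g x) =
  \int[vol]_(x in Om) f x + \int[vol]_(x in Om) g x.
Proof. by move=> mO ? ?; exact: RintegralD. Qed.

Lemma volB Om f g : measurable Om -> vol.-integrable Om (EFin \o f) ->
  vol.-integrable Om (EFin \o g) -> \int[vol]_(x in Om) (f x - g x) =
  \int[vol]_(x in Om) f x - \int[vol]_(x in Om) g x.
Proof. by move=> mO ? ?; exact: RintegralB. Qed.

Lemma volZ Om f (r : R) : measurable Om -> vol.-integrable Om (EFin \o f) ->
  \int[vol]_(x in Om) (r * f x) = r * \int[vol]_(x in Om) f x.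
Proof. by move=> mO ?; exact: RintegralZl. Qed.

Lemma bounded_sub_box A : bounded_set A -> exists b, A `<=` box b.
Proof.
move=> [M [_ H]]; exists (`|M| + 1) => x Ax.
have /= := H (`|M| + 1) _ x Ax.
rewrite (le_lt_trans (ler_norm M)) ?ltrDl// => /(_ isT).
case: x {Ax} => [[a b] c]; rewrite !prod_normE /= !ge_max => /andP[/andP[ha hb] hc].
by do ?split; rewrite /= in_itv /= -ler_norml.
Qed.

Lemma bounded_supp_box f b : continuous f -> (forall x, ~ box b x -> f x = 0) ->
  exists M, forall x, `|f x| <= M.
Proof.
move=> cf f0; have [M HM] := continuous_bounded_box b cf.
exists (Num.max M 0) => x; have [Bx|Bx] := pselect (box b x); rewrite le_max.
  by rewrite HM.
by rewrite f0// normr0 lexx orbT.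
Qed.

Lemma C1c_bounded Om f : C1c Om f -> exists M, forall x, `|f x| <= M.
Proof.
move=> [cf [K [cK _ f0]]].
have [b Kb] := bounded_sub_box (compact_bounded cK).
apply: (@bounded_supp_box f b) => [x|x xb]; first exact: (Ck_continuous cf I).
by apply: f0 => /Kb.
Qed.

Lemma C1c_derive_bounded Om f v : C1c Om f -> exists M, forall x, `|'D_v f x| <= M.
Proof.
move=> [cf [K [cK _ f0]]].
have [b Kb] := bounded_sub_box (compact_bounded cK).
apply: (@bounded_supp_box (fun x => 'D_v f x) b) => [x|].
  exact: ((cf.2 v).2 x I).
by apply: derive_supp_box => x xb; apply: f0 => /Kb.
Qed.

Lemma measurable_continuous_on Om f : measurable Om -> continuous f ->
  measurable_fun Om f.
Proof.
by move=> mO cf; apply: measurable_funS (continuous_measurable_pt cf).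
Qed.

Lemma jacE (f : pt R -> 'rV[R]_3) x i j : jac f x i j = 'D_(bas j) (fun y => f y 0 i) x.
Proof. by rewrite mxE. Qed.

Let dot_curl_alg (b0 b1 b2 d01 d02 d10 d12 d20 d21 : R) :
  b0 * (d21 - d12) + b1 * (d02 - d20) + b2 * (d10 - d01) =
  d21 * b0 - d12 * b0 + (d02 * b1 - d20 * b1) + (d10 * b2 - d01 * b2).
Proof. ring. Qed.

Let curl_dot_alg (p0 p1 p2 d01 d02 d10 d12 d20 d21 : R) :
  p0 * d21 - p0 * d12 + (p1 * d02 - p1 * d20) + (p2 * d10 - p2 * d01) =
  (d21 - d12) * p0 + (d02 - d20) * p1 + (d10 - d01) * p2.
Proof. ring. Qed.

Let int_curl_alg (a b c d e f : R) :
  a - b + (c - d) + (e - f) = - f - - c + (- b - - e) + (- d - - a).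
Proof. ring. Qed.

Let vol_sum6 Om (f1 f2 f3 f4 f5 f6 : pt R -> R) : measurable Om ->
  vol.-integrable Om (EFin \o f1) -> vol.-integrable Om (EFin \o f2) ->
  vol.-integrable Om (EFin \o f3) -> vol.-integrable Om (EFin \o f4) ->
  vol.-integrable Om (EFin \o f5) -> vol.-integrable Om (EFin \o f6) ->
  \int[vol]_(x in Om) (f1 x - f2 x + (f3 x - f4 x) + (f5 x - f6 x)) =
  \int[vol]_(x in Om) f1 x - \int[vol]_(x in Om) f2 x +
  (\int[vol]_(x in Om) f3 x - \int[vol]_(x in Om) f4 x) +
  (\int[vol]_(x in Om) f5 x - \int[vol]_(x in Om) f6 x).
Proof.
move=> mO i1 i2 i3 i4 i5 i6.
have B f g := @integrableB_EFin _ _ _ vol Om f g mO.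
have D f g := @integrableD_EFin _ _ _ vol Om f g mO.
rewrite (volD mO (D _ _ (B _ _ i1 i2) (B _ _ i3 i4)) (B _ _ i5 i6)).
by rewrite (volD mO (B _ _ i1 i2) (B _ _ i3 i4)) !volB.
Qed.

(** Each of the six terms of the curl is integrated by parts on its own. Splitting the integral is
    legitimate because test functions and their derivatives are bounded while [B] and [DB] are
    integrable. *)
Lemma weak_curl_of_jac Om (B : pt R -> 'rV[R]_3) (DB : pt R -> 'M[R]_3) :
  measurable Om -> weak_jac Om B DB ->
  (forall i, vol.-integrable Om (EFin \o (fun x => B x 0 i))) ->
  (forall i j, vol.-integrable Om (EFin \o (fun x => DB x i j))) ->
  weak_curl Om B (fun x => curl_of (DB x)).
Proof.
move=> mO wj iB iD phi cphi.
(* [al i j l] is component [l] of the test field times the derivative of [B_i] in direction [j];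
   [be i j l] carries that derivative on the test field. Their integrals are opposite. *)
pose al i j l x := phi x 0 l * DB x i j.
pose be i j l x := 'D_(bas j) (fun y => phi y 0 l) x * B x 0 i.
have ia i j l : vol.-integrable Om (EFin \o al i j l).
  have [M HM] := C1c_bounded (cphi 0 l).
  apply: (@integrableM_bounded _ _ _ vol _ _ _ M) => //.
  apply: measurable_continuous_on => // x.
  by have [c _] := cphi 0 l; exact: (Ck_continuous c I).
have ib i j l : vol.-integrable Om (EFin \o be i j l).
  have [M HM] := C1c_derive_bounded (bas j) (cphi 0 l).
  apply: (@integrableM_bounded _ _ _ vol _ _ _ M) => //.
  apply: measurable_continuous_on => // x.
  by have [c _] := cphi 0 l; exact: ((c.2 (bas j)).2 x I).
have ab i j l : \int[vol]_(x in Om) al i j l x = - \int[vol]_(x in Om) be i j l x.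
  apply/(canRL opprK); rewrite [RHS](_ : _ =
      \int[vol]_(x in Om) (B x 0 i * grad (fun x => phi x 0 l) x 0 j)).
    rewrite (wj i (fun x => phi x 0 l) j (cphi 0 l)); congr (- _).
    by apply: eq_Rintegral => x _; rewrite /al mxE mulrC.
  by apply: eq_Rintegral => x _; rewrite /be mxE mulrC.
transitivity (\int[vol]_(x in Om) ((be o0 o1 o2 x - be o0 o2 o1 x) +
  (be o1 o2 o0 x - be o1 o0 o2 x) + (be o2 o0 o1 x - be o2 o1 o0 x))).
  apply: eq_Rintegral => x _; rewrite /be dot3 /curl !curl_of3 !jacE.
  exact: dot_curl_alg.
transitivity (\int[vol]_(x in Om) ((al o2 o1 o0 x - al o1 o2 o0 x) +
  (al o0 o2 o1 x - al o2 o0 o1 x) + (al o1 o0 o2 x - al o0 o1 o2 x))); last first.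
  apply: eq_Rintegral => x _; rewrite /al dot3 !curl_of3.
  exact: curl_dot_alg.
by rewrite !vol_sum6// !ab; exact: int_curl_alg.
Qed.

End WeakCurl.

Section IntegrableDot.
Context {R : realType}.

Lemma triple_product (a b c : 'rV[R]_3) :
  dot a (cross b c) = \sum_i cross a b 0 i * c 0 i.
Proof. by rewrite dot3 sum3 !cross3; ring. Qed.

Lemma integrable_dot (Om : set (pt R)) (a w : pt R -> 'rV[R]_3) : measurable Om ->
  (forall i, vol.-integrable Om (EFin \o (fun x => a x 0 i))) ->
  (forall i, continuous (fun x => w x 0 i)) ->
  (forall i, exists M, forall x, `|w x 0 i| <= M) ->
  vol.-integrable Om (EFin \o (fun x => dot (a x) (w x))).
Proof.
move=> mO ia cw bw.
have -> : (fun x => dot (a x) (w x)) = (fun x => w x 0 o0 * a x 0 o0 +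
    w x 0 o1 * a x 0 o1 + w x 0 o2 * a x 0 o2).
  by apply/funext => x; rewrite dotC dot3.
have i1 i : vol.-integrable Om (EFin \o (fun x => w x 0 i * a x 0 i)).
  have [M HM] := bw i; apply: (@integrableM_bounded _ _ _ vol _ _ _ M) => //.
  exact: measurable_continuous_on.
have D f g := @integrableD_EFin _ _ _ vol Om f g mO.
exact: D (D _ _ (i1 o0) (i1 o1)) (i1 o2).
Qed.

End IntegrableDot.

(** * The flux of a weak curl localized in one chart *)

Section Key.
Context {R : realType}.
Variables (k : 'I_3) (sg : R) (gam : pt R -> R).
Hypothesis sg2 : sg * sg = 1.
Hypothesis gamC : Ck 2 setT gam.
Hypothesis gamI : forall x (h : R), gam (x + h *: bas k) = gam x.
Local Notation Phi := (Phi k sg gam).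
Local Notation PhiC := (Phi_C2 k sg gamC).

Variables (Om O : set (pt R)) (x0 : pt R) (r b : R).
(** Unbounded along the chart axis, so as to support functions constant along it; [lens] cuts it
    down to height [r] on either side of the boundary and contains the support of [chi]. *)
Definition cyl : set (pt R) :=
  [set x | forall i, i != k -> `|pos x 0 i - pos x0 0 i| <= r].
Definition lens : set (pt R) := [set x | cyl x /\ `|Phi x| <= r].
Hypothesis oOm : open Om.
Hypothesis oO : open O.
Hypothesis r0 : 0 < r.
Hypothesis lens_box : lens `<=` box b.
Hypothesis lensO : lens `<=` O.
Hypothesis OOm : forall x, O x -> (Om x <-> 0 < Phi x).

Variable m : pt R -> R.
Hypothesis mC : Ck 2 setT m.
Hypothesis mI : inv k m.
Hypothesis m0 : forall x, ~ cyl x -> m x = 0 /\ forall v, 'D_v m x = 0.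

(** The product form separates the dependence on [Phi] from a factor constant along the axis: in
    cross products with [grad Phi] only [grad m] remains. *)
Definition chi x := bmp r (Phi x) * m x.

Lemma chi_C2 : Ck 2 setT chi.
Proof. exact: (CkM (Ck_comp (Ck_bmp r) PhiC) mC). Qed.

Lemma derive_chi x v : 'D_v chi x =
  dbmp r (Phi x) * 'D_v Phi x * m x + bmp r (Phi x) * 'D_v m x.
Proof.
have [d1 d2] := derive_comp_Phi k sg gamC x v (is_derive_bmp r).
rewrite /chi (deriveM d1 (Ck_derivable mC I)) d2.
by rewrite addrC /GRing.scale/= [m x * _]mulrC.
Qed.

Lemma lens_cases x : lens x \/ (~ lens x /\ (~ cyl x \/ r < `|Phi x|)).
Proof.
have [|cx] := pselect (cyl x); last by right; split => [[]|]//; left.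
move=> cx; have [|] := leP `|Phi x| r; first by left.
by move=> h; right; split => [[_]|]; [rewrite leNgt h|right].
Qed.

Lemma out_lens (q : R -> R) (e : pt R -> R) x :
  (forall s, r <= `|s| -> q s = 0) -> (forall y, ~ cyl y -> e y = 0) ->
  ~ lens x -> q (Phi x) * e x = 0.
Proof.
move=> q0 e0 lx; have [//|[_ [/e0->|/ltW/q0->]]] := lens_cases x.
  by rewrite mulr0.
by rewrite mul0r.
Qed.

Lemma derive_chi0 x v : ~ lens x -> 'D_v chi x = 0.
Proof.
move=> lx; rewrite derive_chi mulrAC (@out_lens (dbmp r) m x)//.
- rewrite mul0r add0r (@out_lens (bmp r) (fun x => 'D_v m x) x)//.
  + by move=> s rs; case: (bmp_out r0 rs).
  + by move=> y /m0[_].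
- by move=> s rs; case: (bmp_out r0 rs).
- by move=> y /m0[].
Qed.

Lemma closed_lens : closed lens.
Proof.
have cl (f : pt R -> R) : continuous f -> closed [set x | `|f x| <= r].
  move=> cf; apply: (@closed_comp _ _ (fun x => `|f x|) [set t | t <= r]).
    by move=> x _; apply: continuous_comp; [exact: cf|exact: norm_continuous].
  exact: closed_le.
have -> : lens = (\bigcap_(i in [set i | i != k])
    [set x | `|pos x 0 i - pos x0 0 i| <= r]) `&` [set x | `|Phi x| <= r] by [].
apply: closedI; last exact/cl/(continuous_Phi gamC).
apply: closed_bigI => i _; apply: cl => x; apply: cvgB; last exact: cvg_cst.
exact: (Ck_continuous (Ck_pos 0 i) I).
Qed.

Lemma lens_Phi_gt0 x : lens x -> 0 < Phi x -> Om x.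
Proof. by move=> /lensO/OOm[]. Qed.

(** The cutoffs [eta n] tend to the indicator of [Om] near [x0].  As [eta n] has
  compact support in [Om], the weak curl of [BB] may be tested against
  [phi n = eta n * grad chi]; the limit is computed in [curl_flux]. *)
Let nn (n : nat) : R := n.+1%:R.
Let eta n x : R := step (nn n * Phi x).

Let nn_gt0 n : 0 < nn n. Proof. by rewrite /nn. Qed.

Lemma is_derive_scale (f f' : R -> R) (c : R) :
  (forall t : R, is_derive t (1 : R) f (f' t)) ->
  forall t : R, is_derive t (1 : R) (fun t => f (c * t)) (c * f' (c * t)).
Proof.
move=> df t.
have e : is_derive t (1 : R) (fun t => c * t) c.
  apply: (is_derive_congr (is_deriveZ c (is_derive_id t (1 : R)))) => //.
  by rewrite /GRing.scale/= mulr1.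
apply: (is_derive_congr (@is_derive1_comp R f (fun t => c * t) t _ _ (df (c * t)) e)) => //.
by rewrite mulrC.
Qed.

Lemma derive_eta n x v :
  is_derive x v (eta n) (nn n * dstep (nn n * Phi x) * 'D_v Phi x).
Proof. exact: (derive_comp_Phi k sg gamC x v (is_derive_scale (nn n) is_derive_step)). Qed.

Lemma Ck_scale j (f : R -> R) (c : R) : Ck j setT f -> Ck j setT (fun t => f (c * t)).
Proof.
by move=> cf; exact: (Ck_comp cf (CkM (@Ck_cst _ _ j setT c) (@Ck_id _ j))).
Qed.

Lemma eta_C1 n : Ck 1 setT (eta n).
Proof. exact: (Ck_comp (Ck_scale (nn n) Ck_step) (CkS PhiC)). Qed.

Definition phi n x : 'rV[R]_3 := \row_i (eta n x * 'D_(bas i) chi x).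

Lemma phi_C1c n : entrywise (C1c Om) (phi n).
Proof.
move=> i j; rewrite /phi; under eq_fun do rewrite mxE; split.
  exact: (CkM (eta_C1 n) (Ck_derive _ chi_C2)).
(* On this set [Phi] is at least [1 / nn n], hence it stays inside [Om]; beyond it either [step] or
   [grad chi] vanishes. *)
exists (lens `&` [set x | 1 <= nn n * Phi x]); split.
- apply: (@subclosed_compact _ _ (box b)); last 2 first.
  + exact: compact_box.
  + by move=> x [/lens_box].
  apply: closedI; first exact: closed_lens.
  apply: (@closed_comp _ _ (fun x => nn n * Phi x) [set t | 1 <= t]).
    by move=> x _; apply: cvgM; [exact: cvg_cst|exact: (continuous_Phi gamC)].
  exact: closed_ge.
- move=> x [lx /= nx]; apply: (lens_Phi_gt0 lx).
  by rewrite -(pmulr_rgt0 _ (nn_gt0 n)); apply: lt_le_trans nx.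
- move=> x; have [lx|lx _] := pselect (lens x); last by rewrite derive_chi0 ?mulr0.
  move=> H; rewrite /eta step_le1 ?mul0r//.
  by rewrite leNgt; apply/negP => n1; apply: H; split => //; exact: ltW.
Qed.

(** As [curl grad chi = 0], only [grad eta x grad chi] is left. The gradient of [eta n] is parallel
    to [grad Phi], so the part of [grad chi] along [grad Phi] drops out as well. *)
Lemma curl_phi n x : curl (phi n) x =
  (nn n * dstep (nn n * Phi x) * bmp r (Phi x)) *: cross (grad Phi x) (grad m x).
Proof.
have D i j : 'D_(bas j) (fun y => phi n y 0 i) x =
    eta n x * 'D_(bas j) (fun y => 'D_(bas i) chi y) x +
    nn n * dstep (nn n * Phi x) * 'D_(bas j) Phi x * 'D_(bas i) chi x.
  rewrite /phi; under eq_fun do rewrite mxE.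
  have [d1 d2] := derive_eta n x (bas j).
  have dc : derivable (fun y => 'D_(bas i) chi y) x (bas j).
    exact: (Ck_derivable (Ck_derive (bas i) chi_C2) I).
  by rewrite (deriveM d1 dc) d2 /GRing.scale/= [_ * 'D_(bas i) chi x]mulrC.
have S i j := derive_swap x (bas i) (bas j) chi_C2.
have alg (e h g p q c a1 a2 s t f : R) : s = t ->
    e * s + h * p * (c * q * f + g * a2) - (e * t + h * q * (c * p * f + g * a1)) =
    h * g * (p * a2 - q * a1).
  by move=> ->; ring.
by apply: row3P; rewrite /curl curl_of3 !jacE !D !derive_chi [in RHS]mxE cross3 !mxE;
  apply: alg.
Qed.

Variables (BB : pt R -> 'rV[R]_3) (DBB : pt R -> 'M[R]_3) (W : 'I_3 -> pt R -> R).
Hypothesis BBc : forall i, {within closure Om, continuous (fun x => BB x 0 i)}.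
Hypothesis iBB : forall i, vol.-integrable Om (EFin \o (fun x => BB x 0 i)).
Hypothesis iDBB : forall i j, vol.-integrable Om (EFin \o (fun x => DBB x i j)).
Hypothesis wj : weak_jac Om BB DBB.
Hypothesis WC : forall i, Ck 1 setT (W i).
Hypothesis WI : forall i, inv k (W i).
Hypothesis tangent : forall x, lens x -> \sum_i W i x * 'D_(bas i) Phi x = 0.
Hypothesis BBW : forall x, O x -> Phi x = 0 ->
  forall i, cross (BB x) (grad Phi x) 0 i = W i x.

Let mOm : measurable Om := open_measurable_pt oOm.
(** The derivative of [eta n] as a function of [Phi]: a kernel of height of order [n] on the layer
    [1 <= nn n * Phi <= 2], playing the role of a surface measure. *)
Let hn n x : R := nn n * dstep (nn n * Phi x).
Let G x : R := \sum_i W i x * 'D_(bas i) m x.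
Let Mm x : R := \sum_i `|'D_(bas i) m x|.
Let divW x : R := \sum_i 'D_(bas i) (W i) x.

Let cdm v : continuous (fun x => 'D_v m x).
Proof. by move=> x; exact: (Ck_continuous (Ck_derive v mC) I). Qed.

Let cW i : continuous (W i).
Proof. by move=> x; exact: (Ck_continuous (WC i) I). Qed.

Let cPhi : continuous Phi.
Proof. exact: (continuous_Phi gamC). Qed.

Let ceta n : continuous (eta n).
Proof. by move=> x; exact: (Ck_continuous (eta_C1 n) I). Qed.

Let cdb : continuous (fun x => dbmp r (Phi x)).
Proof. by move=> x; exact: (Ck_continuous (Ck_comp (Ck_dbmp r) (CkS PhiC)) I). Qed.

Let cb : continuous (fun x => bmp r (Phi x)).
Proof. by move=> x; exact: (Ck_continuous (Ck_comp (Ck_bmp r) PhiC) I). Qed.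

Let chn n : continuous (hn n).
Proof.
move=> x; apply: cvgM; first exact: cvg_cst.
apply: (@continuous_comp _ _ _ (fun x => nn n * Phi x) dstep).
  by apply: cvgM; [exact: cvg_cst|exact: cPhi].
exact: continuous_dstep.
Qed.

Lemma continuous_sum3 (F : 'I_3 -> pt R -> R) : (forall i, continuous (F i)) ->
  continuous (fun x => \sum_i F i x).
Proof.
move=> cF; rewrite (_ : (fun x => _) = (fun x => F o0 x + F o1 x + F o2 x)).
  by move=> x; apply: cvgD; [apply: cvgD|]; exact: cF.
by apply/funext => x; rewrite sum3.
Qed.

Let cG : continuous G.
Proof.
by apply: continuous_sum3 => i x; apply: cvgM; [exact: cW|exact: cdm].
Qed.

Let cMm : continuous Mm.
Proof. by apply: continuous_sum3 => i x; apply: cvg_norm; exact: cdm. Qed.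

Let cdivW : continuous divW.
Proof. by apply: continuous_sum3 => i x; exact: ((WC i).2 (bas i)).2. Qed.

Let GI : inv k G.
Proof. by move=> x h; apply: eq_bigr => i _; rewrite WI (inv_derive _ mI). Qed.

Let MmI : inv k Mm.
Proof. by move=> x h; apply: eq_bigr => i _; rewrite (inv_derive _ mI). Qed.

Let G0 x : ~ cyl x -> G x = 0.
Proof. by move=> /m0[_ d0]; apply: big1 => i _; rewrite d0 mulr0. Qed.

Let Mm0 x : ~ cyl x -> Mm x = 0.
Proof. by move=> /m0[_ d0]; apply: big1 => i _; rewrite d0 normr0. Qed.

Let b0 s : r <= `|s| -> bmp r s = 0. Proof. by move=> rs; case: (bmp_out r0 rs). Qed.
Let db0 s : r <= `|s| -> dbmp r s = 0. Proof. by move=> rs; case: (bmp_out r0 rs). Qed.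

Let supp_lens (f : pt R -> R) : (forall x, ~ lens x -> f x = 0) ->
  forall x, ~ box b x -> f x = 0.
Proof. by move=> f0 x xb; apply: f0 => /lens_box. Qed.

Let hb0 n e x : (forall y, ~ cyl y -> e y = 0) -> ~ lens x ->
  hn n x * bmp r (Phi x) * e x = 0.
Proof. by move=> e0 lx; rewrite -mulrA (out_lens b0 e0 lx) mulr0. Qed.

Let edb0 n e x : (forall y, ~ cyl y -> e y = 0) -> ~ lens x ->
  eta n x * dbmp r (Phi x) * e x = 0.
Proof. by move=> e0 lx; rewrite -mulrA (out_lens db0 e0 lx) mulr0. Qed.

Let ihb n e : continuous e -> (forall y, ~ cyl y -> e y = 0) ->
  vol.-integrable setT (EFin \o (fun x => hn n x * bmp r (Phi x) * e x)).
Proof.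
move=> ce e0; apply: (@integrable_continuous_box _ _ b).
  move=> x; apply: cvgM; last exact: ce.
  by apply: cvgM; [exact: chn|exact: cb].
by apply: supp_lens => x; exact: hb0.
Qed.

Let iedb n e : continuous e -> (forall y, ~ cyl y -> e y = 0) ->
  vol.-integrable setT (EFin \o (fun x => eta n x * dbmp r (Phi x) * e x)).
Proof.
move=> ce e0; apply: (@integrable_continuous_box _ _ b).
  move=> x; apply: cvgM; last exact: ce.
  by apply: cvgM; [exact: ceta|exact: cdb].
by apply: supp_lens => x; exact: edb0.
Qed.

(** Integration by parts along the axis: the derivative of the cutoff, unbounded in [n], is traded
    for the derivative of [bmp]. It rests on [Rintegral_level] for the product of cutoff and
    bump. *)
Let level n e : continuous e -> inv k e -> (forall y, ~ cyl y -> e y = 0) ->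
  \int[vol]_x (hn n x * bmp r (Phi x) * e x) =
  - \int[vol]_x (eta n x * dbmp r (Phi x) * e x).
Proof.
move=> ce ie e0.
pose q (s : R) := step (nn n * s) * bmp r s.
pose q' (s : R) := step (nn n * s) * dbmp r s + bmp r s * (nn n * dstep (nn n * s)).
have dq (t : R) : is_derive t (1 : R) q (q' t).
  have := is_deriveM (is_derive_scale (nn n) is_derive_step t) (is_derive_bmp r t).
  by move/is_derive_congr; apply.
have cq' : continuous q'.
  move=> t; apply: cvgD; apply: cvgM.
  - exact: (Ck_continuous (Ck_scale (nn n) Ck_step) I).
  - exact: (Ck_continuous (Ck_dbmp r) I).
  - exact: (Ck_continuous (Ck_bmp r) I).
  - apply: cvgM; first exact: cvg_cst.
    apply: (@continuous_comp _ _ _ (fun s => nn n * s) dstep).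
      by apply: cvgM; [exact: cvg_cst|exact: cvg_id].
    exact: continuous_dstep.
have supp x : ~ box b x -> q (Phi x) * e x = 0.
  move=> xb; rewrite /q -mulrA (out_lens b0 e0) ?mulr0//.
  by move=> /lens_box.
have := Rintegral_level sg2 gamC gamI dq cq' ce ie supp.
have -> : (fun x => q' (Phi x) * e x) = (fun x => hn n x * bmp r (Phi x) * e x
    + eta n x * dbmp r (Phi x) * e x).
  by apply/funext => x; rewrite /q' /hn /eta; ring.
rewrite (volD measurableT (ihb n ce e0) (iedb n ce e0)) => /eqP.
by rewrite addr_eq0 => /eqP.
Qed.

(** Moves the derivative from [m] to [W]. The field is tangent to all level sets of [Phi] within the
    lens, so the factor depending on [Phi] is not differentiated. *)
Let divergence n :
  \int[vol]_x (eta n x * dbmp r (Phi x) * (divW x * m x)) =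
  - \int[vol]_x (eta n x * dbmp r (Phi x) * G x).
Proof.
pose p (s : R) := step (nn n * s) * dbmp r s.
have cp : Ck 1 setT p by exact: (CkM (Ck_scale (nn n) Ck_step) (Ck_dbmp r)).
have p0 s : r <= `|s| -> p s = 0 by move=> /db0; rewrite /p => ->; rewrite mulr0.
have T0 x : 'D_1 p (Phi x) * m x * (\sum_i W i x * 'D_(bas i) Phi x) = 0.
  have [/tangent->|[_ [/m0[-> _]|rP]]] := lens_cases x.
  - by rewrite mulr0.
  - by rewrite mulr0 mul0r.
  (* Tangency is known only in the lens; above and below it [p] vanishes in a neighbourhood of
     [Phi x], and so does its derivative. *)
  have nf : \forall s \near Phi x, p s = cst 0 s.
    have : nbhs (Phi x) [set s : R | r < `|s|].
      apply: open_nbhs_nbhs; split => //.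
      apply: (@open_comp _ _ (fun s : R => `|s|) [set t | r < t]); last exact: open_gt.
      by move=> s _; exact: norm_continuous.
    by apply: filterS => s /ltW/p0.
  have -> : 'D_1 p (Phi x) = 'D_1 (cst 0) (Phi x) by exact: near_eq_derive.
  by rewrite derive_cst !mul0r.
have supp x : ~ box b x -> p (Phi x) * m x = 0.
  move=> xb; apply: (out_lens p0); last by move=> /lens_box.
  by move=> y /m0[].
have c1 : continuous (fun x => divW x * m x).
  move=> x; apply: cvgM; first exact: cdivW.
  exact: (Ck_continuous mC I).
have c0 y : ~ cyl y -> divW y * m y = 0 by move=> /m0[-> _]; rewrite mulr0.
have := Rintegral_div gamC cp WC (CkS mC) T0 supp.
have -> : (fun x => p (Phi x) * ((\sum_i 'D_(bas i) (W i) x) * m x +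
    \sum_i W i x * 'D_(bas i) m x)) = (fun x =>
    eta n x * dbmp r (Phi x) * (divW x * m x) + eta n x * dbmp r (Phi x) * G x).
  by apply/funext => x; rewrite -mulrDr.
rewrite (volD measurableT (iedb n c1 c0) (iedb n cG G0)) => /eqP.
by rewrite addr_eq0 => /eqP.
Qed.

Let step_out n x : ~ Om x -> lens x -> eta n x = 0 /\ hn n x = 0.
Proof.
move=> xO lx; have P0 : nn n * Phi x <= 0.
  by rewrite pmulr_rle0// leNgt; apply/negP => /(lens_Phi_gt0 lx).
rewrite /eta /hn step_le1; last by rewrite (le_trans P0).
by rewrite dstep_supp ?mulr0//; apply/negP; lra.
Qed.

Let inOm (f : pt R -> R) n : (forall x, ~ lens x -> f x = 0) ->
  (forall x, eta n x = 0 -> hn n x = 0 -> f x = 0) ->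
  \int[vol]_(x in Om) f x = \int[vol]_x f x.
Proof.
move=> f0 f1; apply: Rintegral_extend => // x _ xO.
have [lx|] := pselect (lens x); last exact: f0.
by have [] := step_out n xO lx; exact: f1.
Qed.

Let curl_cont (f : pt R -> 'rV[R]_3) : entrywise (C1c Om) f ->
  (forall i, continuous (fun x => curl f x 0 i)) /\
  (forall i, exists M, forall x, `|curl f x 0 i| <= M).
Proof.
move=> cf.
have c i j : continuous (fun x => 'D_(bas j) (fun y => f y 0 i) x).
  by move=> x; have [ci _] := cf 0 i; exact: ((ci.2 (bas j)).2 x I).
have bd i j : exists M, forall x, `|'D_(bas j) (fun y => f y 0 i) x| <= M.
  exact: C1c_derive_bounded (cf 0 i).
have bB i j p q : exists M, forall x, `|'D_(bas j) (fun y => f y 0 i) x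
    - 'D_(bas q) (fun y => f y 0 p) x| <= M.
  have [M1 H1] := bd i j; have [M2 H2] := bd p q; exists (M1 + M2) => x.
  by rewrite (le_trans (ler_normB _ _))// lerD.
have E i x : curl f x 0 i = 'D_(bas (i + 1)) (fun y => f y 0 (i + 2)) x -
    'D_(bas (i + 2)) (fun y => f y 0 (i + 1)) x.
  by rewrite mxE !jacE.
split=> i; last by have [M H] := bB (i + 2) (i + 1) (i + 1) (i + 2); exists M => x; rewrite E.
rewrite (_ : (fun x => _) = fun x => 'D_(bas (i + 1)) (fun y => f y 0 (i + 2)) x -
    'D_(bas (i + 2)) (fun y => f y 0 (i + 1)) x); last exact/funext/E.
by move=> x; apply: cvgB; exact: c.
Qed.

Let Cc x : R := \sum_i cross (BB x) (grad Phi x) 0 i * 'D_(bas i) m x.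

Let triple n x : dot (BB x) (curl (phi n) x) = hn n x * bmp r (Phi x) * Cc x.
Proof.
rewrite curl_phi -/(hn n x) dotC dotZl; congr (_ * _).
rewrite dotC triple_product; apply: eq_bigr => i _; congr (_ * _).
by rewrite mxE.
Qed.

(** Obtained from [dot (BB x) (curl (phi n) x)], where an integrable field meets a bounded
    continuous one. *)
Let iCc n : vol.-integrable Om (EFin \o (fun x => hn n x * bmp r (Phi x) * Cc x)).
Proof.
have [c bd] := curl_cont (phi_C1c n).
have := integrable_dot mOm iBB c bd.
by congr (_.-integrable _ (_ \o _)); apply/funext => x; exact: triple.
Qed.

(** [In] pairs the weak curl with the cut-off gradient. By [InE] it is a layer integral containing
    [BB x grad Phi]; [Jn] is the same layer integral with [W] in its place. *)
Let In n := \int[vol]_(x in Om) dot (curl_of (DBB x)) (phi n x).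
Let Jn n := \int[vol]_x (hn n x * bmp r (Phi x) * G x).

Let InE n : In n = \int[vol]_(x in Om) (hn n x * bmp r (Phi x) * Cc x).
Proof.
rewrite /In -(weak_curl_of_jac mOm wj iBB iDBB (phi_C1c n)).
by apply: eq_Rintegral => x _; exact: triple.
Qed.

Let V i x : R := cross (BB x) (grad Phi x) 0 i - W i x.

Let lens_closure x : lens x -> closure Om x -> 0 <= Phi x.
Proof.
move=> /lensO Ox cx; rewrite leNgt; apply/negP => Px.
have [|y [Oy [Py Oy']]] := cx ([set y | Phi y < 0] `&` O).
  apply: open_nbhs_nbhs; split => //; apply: openI => //.
  apply: (@open_comp _ _ Phi [set t | t < 0]); last exact: open_lt.
  by move=> y _; exact: cPhi.
by have := (OOm Oy').1 Oy; rewrite ltNge (ltW Py).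
Qed.

Let cV i : {within closure Om, continuous (V i)}.
Proof.
have cdP j : {within closure Om, continuous (fun x => 'D_(bas j) Phi x)}.
  by apply: continuous_subspaceT => x; exact: (Ck_continuous (Ck_derive _ PhiC) I).
have cWi : {within closure Om, continuous (W i)}.
  by apply: continuous_subspaceT; exact: cW.
rewrite (_ : V i = fun x => BB x 0 (i + 1) * 'D_(bas (i + 2)) Phi x -
    BB x 0 (i + 2) * 'D_(bas (i + 1)) Phi x - W i x); last first.
  by apply/funext => x; rewrite /V !mxE.
move=> x; apply: cvgB; last exact: cWi.
by apply: cvgB; apply: cvgM; [exact: BBc|exact: cdP|exact: BBc|exact: cdP].
Qed.

(** Uniform smallness near the boundary by compactness: [V] is continuous up to the boundary and
    vanishes on it. *)
Let V_small1 i (e : R) : 0 < e -> exists2 rho, 0 < rho &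
  forall x, lens x -> Om x -> Phi x < rho -> `|V i x| <= e.
Proof.
move=> e0; pose K := lens `&` closure Om.
have [[c0 Kc0]|K0] := pselect (K !=set0); last first.
  by exists 1 => // x lx Ox; exfalso; apply: K0; exists x; split=> //; exact: subset_closure.
(* Positive on [K]: it equals [e] where [Phi = 0], since [V] vanishes there, and is at least [Phi]
   elsewhere. Where [|V| > e] it reduces to [Phi], so its minimum over [K] is the required [rho]. *)
pose E x : R := Phi x + Num.max (e - `|V i x|) 0.
have cK : compact K.
  apply: (@subclosed_compact _ _ (box b)); last 2 first.
  - exact: compact_box.
  - by move=> x [/lens_box].
  by apply: closedI; [exact: closed_lens|exact: closed_closure].
have cE : {within K, continuous E}.
  apply: (@continuous_subspaceW _ _ _ (closure Om)); first by move=> x [].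
  move=> x; apply: cvgD; first exact: (continuous_subspaceT cPhi).
  have c1 : {for x, continuous (fun x : subspace (closure Om) => e - `|V i x|)}.
    by apply: cvgB; [exact: cvg_cst|apply: cvg_norm; exact: cV].
  have c2 : {for x, continuous (fun _ : subspace (closure Om) => 0 : R)}.
    exact: cvg_cst.
  exact: (continuous_max c1 c2).
have [c cin H] := compact_EVT_min (ex_intro _ c0 Kc0) cK cE.
rewrite inE in cin; have [lc cc] := cin.
exists (E c).
  have := lens_closure lc cc; rewrite le_eqVlt => /orP[/eqP P0|P0].
    rewrite /E -P0 add0r /V BBW// ?subrr ?normr0 ?subr0 ?lt_max ?e0//.
    exact: lensO.
  by rewrite /E ltr_pwDl// le_max lexx orbT.
move=> x lx Ox xc; rewrite leNgt; apply/negP => Ve.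
have := H x; rewrite inE => /(_ (conj lx (subset_closure Ox))).
have -> : E x = Phi x by rewrite /E max_r ?addr0// subr_le0 ltW.
by rewrite leNgt xc.
Qed.

Let V_small (e : R) : 0 < e -> exists2 rho, 0 < rho &
  forall x, lens x -> Om x -> Phi x < rho -> forall i, `|V i x| <= e.
Proof.
move=> e0; have [r1 r10 H1] := V_small1 o0 e0.
have [r2 r20 H2] := V_small1 o1 e0; have [r3 r30 H3] := V_small1 o2 e0.
exists (Num.min r1 (Num.min r2 r3)); first by rewrite !lt_min r10 r20.
move=> x lx Ox; rewrite !lt_min => /andP[h1 /andP[h2 h3]].
by apply: all3; [exact: H1|exact: H2|exact: H3].
Qed.

Let C0 := \int[vol]_x `|dbmp r (Phi x) * Mm x|.

Let iC0 : vol.-integrable setT (EFin \o (fun x => dbmp r (Phi x) * Mm x)).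
Proof.
apply: (@integrable_continuous_box _ _ b).
  by move=> x; apply: cvgM; [exact: cdb|exact: cMm].
by apply: supp_lens => x; exact: (out_lens db0 Mm0).
Qed.

Let C0_ge0 : 0 <= C0. Proof. by apply: Rintegral_ge0 => x _. Qed.

(** The kernel [hn n] grows with [n] while its layer shrinks; [level] shows that the mass stays
    bounded, because the cutoff itself lies between 0 and 1. *)
Let slab_mass n : \int[vol]_x (hn n x * bmp r (Phi x) * Mm x) <= C0.
Proof.
rewrite (level n cMm MmI Mm0); apply: (le_trans (ler_norm _)); rewrite normrN.
apply: (le_trans (le_normr_Rintegral measurableT (iedb n cMm Mm0))).
apply: le_Rintegral => //.
- exact: (integrable_norm (iedb n cMm Mm0)).
- exact: (integrable_norm iC0).
- move=> x _; rewrite -mulrA normrM ler_piMl//.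
  by have /andP[e0 e1] := step_itv (nn n * Phi x); rewrite ger0_norm.
Qed.

Let Jn_Om n : Jn n = \int[vol]_(x in Om) (hn n x * bmp r (Phi x) * G x).
Proof.
apply/esym/(inOm (n := n)) => x; first exact: hb0.
by move=> _ ->; rewrite !mul0r.
Qed.

Let close (e : R) : 0 < e ->
  \forall n \near \oo, `|In n - Jn n| <= e * C0.
Proof.
move=> e0; have [rho rho0 Hrho] := V_small e0.
(* [hn n] lives where [Phi] is at most [2 / nn n]; the half brings this layer below [rho]. *)
have rho2 : 0 < rho / 2 by rewrite divr_gt0.
have := near_infty_natSinv_lt (PosNum rho2).
apply: filterS => n /= nr.
have iG : vol.-integrable Om (EFin \o (fun x => hn n x * bmp r (Phi x) * G x)).
  by apply: integrableS (ihb n cG G0).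
have iM : vol.-integrable Om (EFin \o (fun x => hn n x * bmp r (Phi x) * Mm x)).
  by apply: integrableS (ihb n cMm Mm0).
have iB := @integrableB_EFin _ _ _ vol Om _ _ mOm (iCc n) iG.
rewrite InE Jn_Om -(volB mOm (iCc n) iG).
apply: (le_trans (@le_normr_Rintegral _ _ _ vol Om _ mOm iB)).
apply: (@le_trans _ _ (\int[vol]_(x in Om) (e * (hn n x * bmp r (Phi x) * Mm x)))).
  apply: le_Rintegral => //.
  - exact: (integrable_norm iB).
  - exact: (@integrableZ_EFin _ _ _ vol Om _ e mOm iM).
  move=> x Ox; have h0 : 0 <= hn n x * bmp r (Phi x).
    by rewrite mulr_ge0 ?bmp_ge0// mulr_ge0 ?dstep_ge0// ltW.
  have alg (h c g M : R) : 0 <= h -> h = 0 \/ `|c - g| <= e * M ->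
      `|h * c - h * g| <= e * (h * M).
    move=> hh [->|cg]; first by rewrite !mul0r subr0 normr0 mulr0.
    by rewrite -mulrBr normrM (ger0_norm hh) mulrCA ler_wpM2l.
  apply: alg => //.
  have [lx|[_ [cx|/ltW/b0 b1]]] := lens_cases x; last by left; rewrite b1 mulr0.
    have [s1|/negP s1] := pselect (1 <= nn n * Phi x <= 2); last first.
      by left; rewrite /hn dstep_supp// mulr0 mul0r.
    have Pr : Phi x < rho.
      move: nr s1; rewrite -[n.+1%:R]/(nn n) => nr /andP[_].
      have : (nn n)^-1 * nn n < rho / 2 * nn n by rewrite ltr_pM2r.
      rewrite mulVf ?gt_eqF// => h1 h2.
      rewrite -(ltr_pM2l (nn_gt0 n)) (le_lt_trans h2)//; lra.
    right; rewrite /Cc /G -sumrB mulr_sumr (le_trans (ler_norm_sum _ _ _))//.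
    apply: ler_sum => i _; rewrite -mulrBl normrM ler_wpM2r//.
    exact: Hrho.
  right; rewrite (G0 cx) (Mm0 cx) /Cc big1 ?subr0 ?normr0 ?mulr0// => i _.
  by rewrite (m0 cx).2 mulr0.
rewrite (volZ _ mOm iM) ler_wpM2l//; first exact: ltW.
rewrite (inOm (n := n)); first exact: slab_mass.
  by move=> x; exact: hb0.
by move=> x _ ->; rewrite !mul0r.
Qed.

Let eta_cvg x : Om x -> lens x -> eta n x @[n --> \oo] --> (1 : R).
Proof.
move=> Ox lx; have P0 : 0 < Phi x by exact: (OOm (lensO lx)).1.
apply: cvg_near_cst.
have P2 : 0 < Phi x / 2 by rewrite divr_gt0.
have := near_infty_natSinv_lt (PosNum P2); apply: filterS => n /=.
rewrite -[n.+1%:R]/(nn n) => nr; rewrite /eta step_ge2//.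
have : (nn n)^-1 * nn n < Phi x / 2 * nn n by rewrite ltr_pM2r.
by rewrite mulVf ?gt_eqF//; lra.
Qed.

Let eta_dominated (f : pt R -> R) : vol.-integrable Om (EFin \o f) ->
  (forall x, ~ lens x -> f x = 0) ->
  \int[vol]_(x in Om) (eta n x * f x) @[n --> \oo] --> \int[vol]_(x in Om) f x.
Proof.
move=> fi f0; have mf : measurable_fun Om f.
  by apply/measurable_EFinP; exact: (measurable_int _ fi).
apply: (@Rintegral_dominated_cvg _ _ _ vol Om (fun n x => eta n x * f x) f
  (fun x => `|f x|)) => //.
- move=> n; apply: measurable_funM => //.
  have me : measurable_fun Om (eta n) := measurable_continuous_on mOm (@ceta n).
  exact: me.
- move=> x Ox; have [lx|/f0 ->] := pselect (lens x); last first.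
    by rewrite [X in X @ _](_ : _ = cst 0); [exact: cvg_cst|apply/funext => n; rewrite mulr0].
  by rewrite -[X in _ --> X]mul1r; apply: cvgM; [exact: eta_cvg|exact: cvg_cst].
- exact: integrable_norm.
- move=> n x Ox; rewrite normrM ler_piMl//.
  by have /andP[e0 e1] := step_itv (nn n * Phi x); rewrite ger0_norm.
Qed.

Lemma grad_chi_bounded : (forall i, continuous (fun x => grad chi x 0 i)) /\
  (forall i, exists M, forall x, `|grad chi x 0 i| <= M).
Proof.
have E i : (fun x => grad chi x 0 i) = (fun x => 'D_(bas i) chi x).
  by apply/funext => x; rewrite mxE.
have c i : continuous (fun x => grad chi x 0 i).
  by rewrite E => x; exact: (Ck_continuous (Ck_derive (bas i) chi_C2) I).
split=> // i; apply: (@bounded_supp_box _ _ b) => //.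
apply: supp_lens => x lx; rewrite -[LHS]/((fun x => grad chi x 0 i) x) E.
exact: derive_chi0.
Qed.

Let Dc x : R := dot (curl_of (DBB x)) (grad chi x).

Lemma integrable_curl_chi : vol.-integrable Om (EFin \o Dc).
Proof.
have [c bd] := grad_chi_bounded; apply: integrable_dot => // i.
rewrite (_ : (fun x => _) = fun x => DBB x (i + 2) (i + 1) - DBB x (i + 1) (i + 2)).
  exact: (@integrableB_EFin _ _ _ vol Om _ _ mOm (iDBB _ _) (iDBB _ _)).
by apply/funext => x; rewrite mxE.
Qed.

Let In_cvg : In n @[n --> \oo] --> \int[vol]_(x in Om) Dc x.
Proof.
have Dc0 x : ~ lens x -> Dc x = 0.
  move=> lx; rewrite /Dc (_ : grad chi x = 0); last first.
    by apply/rowP => i; rewrite !mxE derive_chi0.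
  by rewrite dot3 !mxE !mulr0 !addr0.
have := eta_dominated integrable_curl_chi Dc0.
rewrite [X in X @ _ --> _ -> _](_ : _ = In)//; apply/funext => n.
apply: eq_Rintegral => x _; rewrite /Dc dotC -dotZl dotC; congr dot.
by apply/rowP => i; rewrite !mxE.
Qed.

(** The left side is the limit of [In]. By [level] and [divergence], [Jn] is the integral of the
    right-hand integrand times [eta n], and converges to the right side. [close] identifies the two
    limits. *)
Lemma curl_flux : \int[vol]_(x in Om) Dc x =
  \int[vol]_(x in Om) (dbmp r (Phi x) * (divW x * m x)).
Proof.
pose f x := dbmp r (Phi x) * (divW x * m x).
have m00 x : ~ cyl x -> divW x * m x = 0 by move=> /m0[-> _]; rewrite mulr0.
have f0 x : ~ lens x -> f x = 0 by exact: (out_lens db0 m00).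
have ifT : vol.-integrable setT (EFin \o f).
  apply: (@integrable_continuous_box _ _ b); last exact: supp_lens.
  move=> x; apply: cvgM; first exact: cdb.
  by apply: cvgM; [exact: cdivW|exact: (Ck_continuous mC I)].
have fi : vol.-integrable Om (EFin \o f) by apply: integrableS ifT.
have Jcvg : Jn n @[n --> \oo] --> \int[vol]_(x in Om) f x.
  have := eta_dominated fi f0; rewrite [X in X @ _ --> _ -> _](_ : _ = Jn)//.
  apply/funext => n; rewrite (inOm (n := n)); last 2 first.
  - by move=> x /f0 ->; rewrite mulr0.
  - by move=> x -> _; rewrite mul0r.
  rewrite /Jn (level n cG GI G0) -divergence.
  by apply: eq_Rintegral => x _; rewrite /f mulrA.
have IJ : (In n - Jn n) @[n --> \oo] --> (\int[vol]_(x in Om) Dc x - \int[vol]_(x in Om) f x).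
  exact: cvgB.
apply/eqP; rewrite -subr_eq0 -normr_le0; apply/ler_addgt0Pr => e e0; rewrite add0r.
have C1 : 0 < C0 + 1 by rewrite ltr_wpDl.
have cN := cvg_norm IJ.
have nr : \forall n \near \oo, `|In n - Jn n| <= e.
  have := close (divr_gt0 e0 C1); apply: filterS => n /le_trans; apply.
  by rewrite -mulrA ler_piMr ?(ltW e0)// mulrC ler_pdivrMr// mul1r lerDl.
exact: (cvgr_to_le (cN _) nr).
Qed.

End Key.

(** * Strict positivity of integrals, projection onto the boundary, length of the gradient *)

Section Geometry.
Context {R : realType}.

Lemma ball_pos (x y : pt R) (e : R) :
  (forall i, `|pos y 0 i - pos x 0 i| < e) -> ball x e y.
Proof.
move=> H; have := H o0; have := H o1; have := H o2; rewrite !pos3 => h2 h1 h0.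
by split; [split|]; rewrite /ball/= distrC.
Qed.

Lemma leb_ball_gt0 (x e : R) : 0 < e -> (0 < leb (ball x e))%E.
Proof.
move=> e0; rewrite ball_itv /leb/= lebesgue_measure_itv/= lte_fin.
by rewrite ltrD2l gtrN// EFinN sube_gt0 lte_fin ltrD2l gtrN.
Qed.

Lemma leb2_ball_gt0 (x y e : R) : 0 < e -> (0 < leb2 (ball x e `*` ball y e))%E.
Proof.
move=> e0; rewrite /leb2/= product_measure1E//;
  try by rewrite ball_itv; exact: measurable_itv.
by rewrite mule_gt0// leb_ball_gt0.
Qed.

Lemma vol_open_gt0 (V : set (pt R)) : open V -> V !=set0 -> (0 < vol V)%E.
Proof.
move=> oV [x Vx]; have /nbhs_ballP[e /= e0 eV] : nbhs x V by exact: open_nbhs_nbhs.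
apply: (@lt_le_trans _ _ (vol (ball x e))); last first.
  apply: le_measure => //; rewrite inE.
  - exact: measurable_ball_pt.
  - exact: open_measurable_pt.
rewrite [ball x e](_ : _ = (ball x.1.1 e `*` ball x.1.2 e) `*` ball x.2 e)//.
rewrite /vol/= product_measure1E//; last 2 first.
- by apply: measurableX; rewrite ball_itv; exact: measurable_itv.
- by rewrite ball_itv; exact: measurable_itv.
by rewrite mule_gt0// ?leb2_ball_gt0// leb_ball_gt0.
Qed.

(** A nonnegative function with zero integral vanishes off a null set; here that null set would
    contain the nonempty open set [V], of positive volume. *)
Lemma Rintegral_gt0 (D V : set (pt R)) (f : pt R -> R) : measurable D ->
  open V -> V !=set0 -> V `<=` D -> vol.-integrable D (EFin \o f) ->
  (forall x, D x -> 0 <= f x) -> (forall x, V x -> 0 < f x) ->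
  0 < \int[vol]_(x in D) f x.
Proof.
move=> mD oV V0 VD fi f0 fV.
have I0 : 0 <= \int[vol]_(x in D) f x by exact: Rintegral_ge0.
rewrite lt_neqAle I0 andbT; apply/eqP => /esym IE.
have E0 : (\int[vol]_(x in D) (f x)%:E = 0)%E.
  by rewrite -(fineK (integrable_fin_num _ fi))//= -[fine _]/(\int[vol]_(x in D) f x) IE.
have mf : measurable_fun D (EFin \o f) by exact: (measurable_int _ fi).
have /(ae_eq_integral_abs vol mD mf) : (\int[vol]_(x in D) `|(EFin \o f) x| = 0)%E.
  rewrite -E0; apply: eq_integral => x; rewrite inE => Dx /=.
  by rewrite ger0_norm// f0.
case=> A [mA A0 HA].
have VA : V `<=` A.
  move=> x Vx; apply: HA => /= /(_ (VD x Vx)) /eqP.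
  by rewrite eqe gt_eqF// fV.
have := vol_open_gt0 oV V0; apply/negP; rewrite -leNgt -A0.
by apply: le_measure => //; rewrite inE //; exact: open_measurable_pt.
Qed.

Lemma dir_pos (f : pt R -> R) (x w : pt R) : derivable f x w -> f x = 0 ->
  0 < 'D_w f x -> \forall t \near (0 : R)^'+, 0 < f (x + t *: w).
Proof.
move=> df fx D0.
have C : (fun h : R => h^-1 *: ((f \o shift x) (h *: w) - f x)) h @[h --> 0^'] --> 'D_w f x.
  exact: df.
have C' : (fun h : R => h^-1 *: ((f \o shift x) (h *: w) - f x)) h @[h --> 0^'+] --> 'D_w f x.
  exact: cvg_dnbhs_at_right.
near=> t; have t0 : 0 < t by near: t; exact: nbhs_right_gt.
have : 0 < t^-1 *: ((f \o shift x) (t *: w) - f x).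
  by near: t; exact: (cvgr_gt _ C').
by rewrite /= fx subr0 -[_ *: _]/(_ * _) pmulr_rgt0 ?invr_gt0// addrC.
Unshelve. all: by end_near.
Qed.

Variables (k : 'I_3) (sg : R) (gam : pt R -> R).
Hypothesis sg2 : sg * sg = 1.
Hypothesis gamC : Ck 2 setT gam.
Hypothesis gamI : forall x (h : R), gam (x + h *: bas k) = gam x.
Local Notation Phi := (Phi k sg gam).
Local Notation pr := (pr k sg gam).
Let PhiC : Ck 2 setT Phi := Phi_C2 k sg gamC.

(** Presents [pr] along a line in the form of a path [x + s *: v + b s *: w], to which
    [is_derive_path] applies. *)
Lemma pr_line x v (t : R) :
  pr (x + t *: v) = pr x + t *: v + (- sg * (Phi (x + t *: v) - Phi x)) *: bas k.
Proof.
rewrite /pr.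
have -> : - (sg * Phi (x + t *: v)) =
    - (sg * Phi x) + - sg * (Phi (x + t *: v) - Phi x) by ring.
by rewrite scalerDl !addrA; congr (_ + _); rewrite addrAC.
Qed.

Lemma pr_id x : Phi x = 0 -> pr x = x.
Proof. by move=> P0; rewrite /pr P0 mulr0 oppr0 scale0r addr0. Qed.

Lemma continuous_pr : continuous pr.
Proof.
move=> x; apply: cvgD; first exact: cvg_id.
apply: cvgZr_tmp; apply: cvgN; apply: cvgM; first exact: cvg_cst.
exact: (continuous_Phi gamC).
Qed.

Lemma is_derive_pr (e : pt R -> R) x v : Ck 1 setT e ->
  is_derive x v (fun y => e (pr y))
    ('D_v e (pr x) + - sg * 'D_v Phi x * 'D_(bas k) e (pr x)).
Proof.
move=> ce; apply: is_derive_of_line.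
pose b (t : R) := - sg * (Phi (x + t *: v) - Phi x).
have b0 : b 0 = 0 by rewrite /b scale0r addr0 subrr mulr0.
have db : is_derive (0 : R) (1 : R) b (- sg * 'D_v Phi x).
  have L := @is_derive_line _ _ Phi x v 0.
  rewrite scale0r addr0 in L; have {}L := L (Ck_derivable PhiC I).
  have := is_deriveZ (- sg) (is_deriveB L (is_derive_cst (Phi x) (0 : R) (1 : R))).
  by move/is_derive_congr; apply => //; rewrite subr0.
have := is_derive_path (pr x) v (bas k) ce b0 db.
by move/is_derive_congr; apply => // t; rewrite -pr_line.
Qed.

Lemma Ck_pr (e : pt R -> R) : Ck 1 setT e -> Ck 1 setT (fun y => e (pr y)).
Proof.
move=> ce.
have cpr (f : pt R -> R) : continuous f -> continuous (fun y => f (pr y)).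
  by move=> cf x; apply: (@continuous_comp _ _ _ pr f); [exact: continuous_pr|exact: cf].
split=> [x _|v]; first by apply: cpr => y; exact: (ce.1 y I).
split=> [x _|]; first by case: (is_derive_pr x v ce).
have -> : (fun x => 'D_v (fun y => e (pr y)) x) = fun x =>
    'D_v e (pr x) + - sg * 'D_v Phi x * 'D_(bas k) e (pr x).
  by apply/funext => x; case: (is_derive_pr x v ce).
move=> x _; apply: cvgD; first exact: (cpr (fun y => 'D_v e y) (fun y => (ce.2 v).2 y I)).
apply: cvgM; last first.
  exact: (cpr (fun y => 'D_(bas k) e y) (fun y => (ce.2 (bas k)).2 y I)).
apply: cvgM; first exact: cvg_cst.
exact: (Ck_continuous (Ck_derive v PhiC) I).
Qed.

Let sq x := dot (grad Phi x) (grad Phi x).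
(** The Euclidean length of [grad Phi], by which the normal of the chart is normalized. *)
Definition slope x := Num.sqrt (sq x).

Let sq_gt0 x : 0 < sq x.
Proof. by apply: dot_gt0; exact: grad_Phi_neq0. Qed.

Lemma slope_gt0 x : 0 < slope x. Proof. by rewrite sqrtr_gt0. Qed.

Lemma slope_inv : inv k slope.
Proof.
move=> x h; rewrite /slope /sq.
have -> // : grad Phi (x + h *: bas k) = grad Phi x.
by apply/rowP => i; rewrite !mxE dPhi_inv.
Qed.

Let sqE : sq = fun x => \sum_i 'D_(bas i) Phi x * 'D_(bas i) Phi x.
Proof. by apply/funext => x; apply: eq_bigr => i _; rewrite !mxE. Qed.

Let sqC : Ck 1 setT sq.
Proof.
by rewrite sqE; apply: Ck_sum => i; exact: (CkM (Ck_derive _ PhiC) (Ck_derive _ PhiC)).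
Qed.

Lemma slope_C1 : Ck 1 setT slope.
Proof.
apply: (@Ck_comp_at _ Num.sqrt (fun t => (2 * Num.sqrt t)^-1) sq) => // [x|x].
  exact: is_derive1_sqrt.
apply: cvgV; first by rewrite mulf_neq0// gt_eqF// sqrtr_gt0.
by apply: cvgM; [exact: cvg_cst|exact: sqrt_continuous].
Qed.

Lemma derive_slope x v : 'D_v slope x =
  (slope x)^-1 * \sum_i 'D_(bas i) Phi x * 'D_v (fun y => 'D_(bas i) Phi y) x.
Proof.
have [d1 d2] : is_derive (sq x) (1 : R) Num.sqrt (2 * Num.sqrt (sq x))^-1.
  exact: is_derive1_sqrt.
have -> : 'D_v slope x = (2 * Num.sqrt (sq x))^-1 * 'D_v sq x.
  by rewrite -d2; exact: (@derive_comp1 R _ Num.sqrt sq x v d1 (Ck_derivable sqC I)).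
rewrite /slope.
pose e i y := 'D_(bas i) Phi y.
have dd i : derivable (e i) x v by exact: (Ck_derivable (Ck_derive (bas i) PhiC) I).
have q i : is_derive x v (fun y => e i y * e i y) (2 * (e i x * 'D_v (e i) x)).
  apply: (is_derive_congr (is_deriveM (derivableP (dd i)) (derivableP (dd i)))) => //.
  by rewrite /GRing.scale/=; move: (e i x) ('D_v (e i) x) => a c; ring.
have dsq : is_derive x v sq (2 * (e o0 x * 'D_v (e o0) x) + 2 * (e o1 x * 'D_v (e o1) x)
    + 2 * (e o2 x * 'D_v (e o2) x)).
  apply: (is_derive_congr (is_deriveD (is_deriveD (q o0) (q o1)) (q o2))) => // y.
  by rewrite sqE sum3.
have Dsq := @derive_val _ _ _ _ _ _ _ dsq.
have alg (s a c f : R) : 0 < s ->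
    (2 * s)^-1 * (2 * a + 2 * c + 2 * f) = s^-1 * (a + c + f).
  by move=> s0; field; rewrite gt_eqF.
refine (etrans (congr1 _ Dsq) _); rewrite sum3; apply: alg.
exact: slope_gt0.
Qed.

End Geometry.

(** * Boundary points and normals in overlapping charts *)

Section Normal.
Context {R : realType}.

Section OneChart.
Variables (k : 'I_3) (sg : R) (gam : pt R -> R) (Om : set (pt R)) (x0 : pt R) (r : R).
Hypothesis sg2 : sg * sg = 1.
Hypothesis gamC : Ck 2 setT gam.
Hypothesis gamI : forall x (h : R), gam (x + h *: bas k) = gam x.
Hypothesis oOm : open Om.
Local Notation Phi := (Phi k sg gam).
Let PhiC : Ck 2 setT Phi := Phi_C2 k sg gamC.
Hypothesis OmP : forall x, ball x0 r x -> (Om x <-> 0 < Phi x).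

Lemma near_line (x w : pt R) (A : set (pt R)) : open A -> A x ->
  \forall t \near (0 : R)^'+, A (x + t *: w).
Proof.
move=> oA Ax.
have c : (fun t : R => x + t *: w) t @[t --> (0 : R)] --> x + 0 *: w.
  by apply: cvgD; [exact: cvg_cst|apply: cvgZr_tmp; exact: cvg_id].
rewrite scale0r addr0 in c.
have c' : (fun t : R => x + t *: w) t @[t --> (0 : R)^'+] --> x.
  exact: cvg_at_right_filter.
by apply: c'; exact: open_nbhs_nbhs.
Qed.

(** Positive values of [Phi] belong to the open set [Om]; a negative value persists in a
    neighbourhood, which then misses [Om]. *)
Lemma bdry_Phi0 x : ball x0 r x -> bdry Om x -> Phi x = 0.
Proof.
move=> xb [cx ix]; have nx : ~ Om x.
  by move=> Ox; apply: ix; rewrite (interior_id Om).1.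
have P0 : Phi x <= 0 by rewrite leNgt; apply/negP => /(OmP xb).2.
apply/eqP; rewrite eq_le P0 /= leNgt; apply/negP => Px.
have [|y [Oy [Py yb]]] := cx ([set y | Phi y < 0] `&` ball x0 r).
  apply: open_nbhs_nbhs; split => //; apply: openI; last exact: ball_open.
  apply: (@open_comp _ _ Phi [set t | t < 0]); last exact: open_lt.
  by move=> y _; exact: (continuous_Phi gamC).
by have := (OmP yb).1 Oy; rewrite ltNge (ltW Py).
Qed.

(** A small step in direction [sg *: bas k] raises [Phi] above 0, so the point is a limit of points
    of [Om]. *)
Lemma Phi0_bdry x : ball x0 r x -> Phi x = 0 -> bdry Om x.
Proof.
move=> xb Px; split; last first.
  rewrite (interior_id Om).1// => /(OmP xb).1.
  by rewrite Px ltxx.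
move=> A nA; have [B [oB Bx] BA] : exists2 B, open_nbhs x B & B `<=` A.
  by move: nA; rewrite nbhsE.
have N : \forall t \near (0 : R)^'+, (B `&` ball x0 r) (x + t *: (sg *: bas k)).
  by apply: near_line; [exact: openI oB (ball_open _ _)|].
near (0 : R)^'+ => t.
have t0 : 0 < t by near: t; exact: nbhs_right_gt.
have [Bt xt] : (B `&` ball x0 r) (x + t *: (sg *: bas k)) by near: t.
exists (x + t *: (sg *: bas k)); split; last exact: BA.
by apply/(OmP xt); rewrite scalerA Phi_shift// Px add0r mulrCA sg2 mulr1.
Unshelve. all: by end_near.
Qed.

End OneChart.

(** The normal at each boundary point is given by a chart of its own, whereas the computation needs
    it in one fixed chart at all nearby points. A direction in which one defining function increases
    leads into [Om], so the other cannot decrease along it; [normalized_eq] concludes. *)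
Lemma chart_normal_unique (k k' : 'I_3) (sg sg' : R) (gam gam' : pt R -> R)
    (Om : set (pt R)) (x0 x1 y : pt R) (r r' : R) :
  sg * sg = 1 -> sg' * sg' = 1 -> Ck 2 setT gam -> Ck 2 setT gam' ->
  (forall x (h : R), gam (x + h *: bas k) = gam x) ->
  (forall x (h : R), gam' (x + h *: bas k') = gam' x) ->
  (forall x, ball x0 r x -> (Om x <-> 0 < Phi k sg gam x)) ->
  (forall x, ball x1 r' x -> (Om x <-> 0 < Phi k' sg' gam' x)) ->
  ball x0 r y -> ball x1 r' y -> Phi k sg gam y = 0 -> Phi k' sg' gam' y = 0 ->
  (slope k sg gam y)^-1 *: grad (Phi k sg gam) y =
  (slope k' sg' gam' y)^-1 *: grad (Phi k' sg' gam') y.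
Proof.
move=> s2 s2' gC gC' gI gI' H H' yb yb' P0 P0'.
apply: normalized_eq; [exact: grad_Phi_neq0|exact: grad_Phi_neq0|] => v vP.
pose w : pt R := (v 0 o0, v 0 o1, v 0 o2).
have pw : pos w = v by apply: row3P; rewrite pos3.
have C := Phi_C2 k sg gC; have C' := Phi_C2 k' sg' gC'.
have E : dot v (grad (Phi k sg gam) y) = 'D_w (Phi k sg gam) y.
  by rewrite -pw (derive_grad _ _ (CkS C)).
have E' : dot v (grad (Phi k' sg' gam') y) = 'D_w (Phi k' sg' gam') y.
  by rewrite -pw (derive_grad _ _ (CkS C')).
rewrite E in vP; rewrite E'.
rewrite leNgt; apply/negP => vN.
have N1 := dir_pos (Ck_derivable C I) P0 vP.
have dN : derivable (fun x => - Phi k' sg' gam' x) y w.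
  exact: derivableN (Ck_derivable C' I).
have N2 : \forall t \near (0 : R)^'+, 0 < - Phi k' sg' gam' (y + t *: w).
  apply: (@dir_pos _ (fun x => - Phi k' sg' gam' x)) => //; first by rewrite P0' oppr0.
  by rewrite (deriveN (Ck_derivable C' I)) oppr_gt0.
have N3 := near_line w (ball_open x0 r) yb.
have N4 := near_line w (ball_open x1 r') yb'.
near (0 : R)^'+ => t.
have Q1 : 0 < Phi k sg gam (y + t *: w) by near: t.
have Q2 : 0 < - Phi k' sg' gam' (y + t *: w) by near: t.
have Q3 : ball x0 r (y + t *: w) by near: t.
have Q4 : ball x1 r' (y + t *: w) by near: t.
have := (H' _ Q4).1 ((H _ Q3).2 Q1); lra.
Unshelve. all: by end_near.
Qed.

(** The cylinder does not control the coordinate along the axis. It is recovered from [Phi]: up to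
    sign, its increment is [Phi x] plus the increment of [gam], which is small when the other
    coordinates move little. *)
Lemma lens_small (k : 'I_3) (sg : R) (gam : pt R -> R) (x0 : pt R) (e : R) :
  sg * sg = 1 -> continuous gam ->
  (forall x (h : R), gam (x + h *: bas k) = gam x) ->
  Phi k sg gam x0 = 0 -> 0 < e ->
  exists2 r : R, 0 < r & lens k sg gam x0 r `<=` ball x0 e.
Proof.
move=> s2 cg gI P0 e0.
have e2 : 0 < e / 2 by rewrite divr_gt0.
have [rho rho0 Hrho] := continuous_normP (cg x0) e2.
pose r := Num.min rho e / 4.
have m0 : 0 < Num.min rho e by rewrite lt_min rho0.
have r0 : 0 < r by rewrite divr_gt0.
have re : r < e / 2.
  by have : Num.min rho e <= e by [rewrite ge_min lexx orbT]; rewrite /r; lra.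
have rr : r < rho.
  by have : Num.min rho e <= rho by [rewrite ge_min lexx]; rewrite /r; lra.
exists r => // x [cx Px].
pose c := pos x0 0 k - pos x 0 k.
(* [x] moved along the axis to the height of [x0]: [gam] takes the same value at [x] and at [y], and
   [y] is close to [x0]. *)
pose y := x + c *: bas k.
have yi i : `|pos y 0 i - pos x0 0 i| <= r.
  rewrite pos_line pos_bas; have [->|ik] := eqVneq i k.
    by rewrite mulr1 /c addrCA subrr addr0 subrr normr0 ltW.
  by rewrite mulr0 addr0; exact: cx.
have yx : `|y - x0| < rho.
  have : ball x0 rho y by apply: ball_pos => i; exact: le_lt_trans rr.
  by rewrite -ball_normE /= distrC.
have := Hrho _ yx; rewrite (addrC x0) subrK /y gI => gx.
apply: ball_pos => i; have [->|ik] := eqVneq i k; last first.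
  by rewrite (le_lt_trans (cx i ik))// (lt_trans re)//; lra.
have E : pos x 0 k - pos x0 0 k = sg * (Phi k sg gam x + (gam x - gam x0)).
  have : sg * pos x0 0 k = gam x0 by move: P0; rewrite /Phi => /eqP; rewrite subr_eq0 => /eqP.
  rewrite /Phi => <-; rewrite -[LHS]mul1r -s2; ring.
have sg1 : `|sg| = 1.
  have /eqP := s2; rewrite -expr2 sqrf_eq1 => /orP[] /eqP ->.
    by rewrite normr1.
  by rewrite normrN1.
rewrite E normrM sg1 mul1r (le_lt_trans (ler_normD _ _))//.
by rewrite [e]splitr ltrD// (le_lt_trans Px).
Qed.

(** [p], [h] stand for the first and second derivatives of the defining
  function, [t], [b], [c] for the field, its Jacobian and its vertical
  derivative; the hypotheses say that the field is tangent to the boundary. *)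
Lemma surface_divergence_alg (N s p0 p1 p2 h00 h01 h02 h11 h12 h22 t0 t1 t2
    b00 b01 b02 b10 b11 b12 b20 b21 b22 c0 c1 c2 : R) :
  N != 0 -> N ^+ 2 = p0 * p0 + p1 * p1 + p2 * p2 ->
  (b00 + - s * p0 * c0) * p0 + t0 * h00 + ((b10 + - s * p0 * c1) * p1 + t1 * h01)
    + ((b20 + - s * p0 * c2) * p2 + t2 * h02) = 0 ->
  (b01 + - s * p1 * c0) * p0 + t0 * h01 + ((b11 + - s * p1 * c1) * p1 + t1 * h11)
    + ((b21 + - s * p1 * c2) * p2 + t2 * h12) = 0 ->
  (b02 + - s * p2 * c0) * p0 + t0 * h02 + ((b12 + - s * p2 * c1) * p1 + t1 * h12)
    + ((b22 + - s * p2 * c2) * p2 + t2 * h22) = 0 ->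
  - (N^-1 * (p0 * h00 + p1 * h01 + p2 * h02)) * t0 - N * (b00 + - s * p0 * c0)
  + (- (N^-1 * (p0 * h01 + p1 * h11 + p2 * h12)) * t1 - N * (b11 + - s * p1 * c1))
  + (- (N^-1 * (p0 * h02 + p1 * h12 + p2 * h22)) * t2 - N * (b22 + - s * p2 * c2)) =
  - N * (b00 + b11 + b22 -
    N^-1 * N^-1 * ((p0 * b00 + p1 * b10 + p2 * b20) * p0
      + (p0 * b01 + p1 * b11 + p2 * b21) * p1 + (p0 * b02 + p1 * b12 + p2 * b22) * p2)).
Proof.
move=> N0 N2 T0 T1 T2; apply: (mulfI N0); apply/eqP; rewrite -subr_eq0; apply/eqP.
(* After multiplication by [N] the difference of the two sides is a combination of the hypotheses:
   the j-th tangency relation enters with weight [- p_j], and [N ^+ 2 = |p|^2] removes the vertical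
   derivatives [c]. *)
transitivity ((N ^+ 2 - (p0 * p0 + p1 * p1 + p2 * p2)) * (s * (p0 * c0 + p1 * c1 + p2 * c2))
  - (p0 * ((b00 + - s * p0 * c0) * p0 + t0 * h00 + ((b10 + - s * p0 * c1) * p1 + t1 * h01)
    + ((b20 + - s * p0 * c2) * p2 + t2 * h02))
  + p1 * ((b01 + - s * p1 * c0) * p0 + t0 * h01 + ((b11 + - s * p1 * c1) * p1 + t1 * h11)
    + ((b21 + - s * p1 * c2) * p2 + t2 * h12))
  + p2 * ((b02 + - s * p2 * c0) * p0 + t0 * h02 + ((b12 + - s * p2 * c1) * p1 + t1 * h12)
    + ((b22 + - s * p2 * c2) * p2 + t2 * h22)))).
  by field.
by rewrite T0 T1 T2 N2 subrr !mulr0 mul0r !addr0 subr0.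
Qed.

End Normal.

(** * A test function with nonzero flux *)

Section Flux.
Context {R : realType}.

Lemma Lp1_integrable (Om : set (pt R)) (f : pt R -> R) : measurable Om ->
  Lp Om 1 f -> vol.-integrable Om (EFin \o f).
Proof.
move=> mO [mf fi]; apply: le_integrable fi => //; first exact/measurable_EFinP.
by move=> x Ox /=; rewrite lee_fin powRr1// normr_id.
Qed.

Lemma quad_form3 (u : 'rV[R]_3) (J : 'M[R]_3) : (u *m J *m u^T) 0 0 =
  (u 0 o0 * J o0 o0 + u 0 o1 * J o1 o0 + u 0 o2 * J o2 o0) * u 0 o0 +
  (u 0 o0 * J o0 o1 + u 0 o1 * J o1 o1 + u 0 o2 * J o2 o1) * u 0 o1 +
  (u 0 o0 * J o0 o2 + u 0 o1 * J o1 o2 + u 0 o2 * J o2 o2) * u 0 o2.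
Proof. by rewrite mxE sum3 !mxE !sum3. Qed.

(** Third truncated power of [r ^+ 2] minus the squared distance to the axis through [x0]; the
    factor [(i != k)%:R] discards the coordinate along the axis. *)
Lemma cyl_bump (k : 'I_3) (x0 : pt R) (r : R) : 0 < r ->
  exists m : pt R -> R, [/\ Ck 2 setT m, inv k m,
    forall x, ~ cyl k x0 r x -> m x = 0 /\ forall v, 'D_v m x = 0,
    forall x, 0 <= m x & 0 < m x0].
Proof.
move=> r0.
pose q i (x : pt R) := (i != k)%:R * ((pos x 0 i - pos x0 0 i) * (pos x 0 i - pos x0 0 i)).
pose Q x := r ^+ 2 - \sum_i q i x.
have qC i : Ck 2 setT (q i).
  have c : Ck 2 setT (fun x => pos x 0 i - pos x0 0 i).
    exact: (CkB (Ck_pos 2 i) (@Ck_cst _ _ 2 setT (pos x0 0 i))).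
  exact: (CkM (@Ck_cst _ _ 2 setT ((i != k)%:R)) (CkM c c)).
have QC : Ck 2 setT Q.
  exact: (CkB (@Ck_cst _ _ 2 setT (r ^+ 2)) (Ck_sum _ qC)).
have q0 i x : 0 <= q i x by rewrite mulr_ge0// -expr2 sqr_ge0.
have Qle x : ~ cyl k x0 r x -> Q x <= 0.
  move=> cx; have [i ik] : exists2 i, i != k & r < `|pos x 0 i - pos x0 0 i|.
    apply: contrapT => H; apply: cx => i ik; rewrite leNgt; apply/negP => ri.
    by apply: H; exists i.
  move=> ri; rewrite /Q subr_le0 (bigD1 i)//= -[X in X <= _]addr0.
  apply: lerD; last by apply: sumr_ge0.
  rewrite /q ik mul1r -expr2 -[X in _ <= X]real_normK ?num_real//.
  by rewrite lerXn2r ?nnegrE// ltW.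
exists (fun x => pp 3 (Q x)); split.
- exact: (Ck_comp (Ck_pp 2) QC).
- move=> x h; rewrite /Q; congr (pp 3 (_ - _)); apply: eq_bigr => i _.
  rewrite /q pos_line pos_bas; have [//|ik] := eqVneq i k; first by rewrite !mul0r.
  by rewrite mulr0 addr0.
- move=> x /Qle Qx; split; first by rewrite pp_le0.
  move=> v; have d1 : derivable (pp 3) (Q x) 1 by case: (is_derive_pp 1 (Q x)).
  have dQ : derivable Q x v := Ck_derivable QC I.
  by rewrite (derive_comp1 d1 dQ) derive_pp pp_le0// mulr0 mul0r.
- by move=> x; exact: pp_ge0.
- have Q0 : 0 < Q x0.
    by rewrite /Q big1 ?subr0 ?exprn_gt0// => i _; rewrite /q subrr !mulr0.
  by rewrite pp_gt0// exprn_gt0.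
Qed.

(** [grad chi] is to be a test field for the tangential trace on [GBD], hence C^1 and zero on [GBN].
    The flux is stated for [DBB], independent of time and of the solution. *)
Lemma exists_flux_test (nu : R) (d : mhd R) BB DBB :
  domain_assumptions d nu -> magnetic_extension d BB DBB ->
  (forall x, GBD d x -> dot (btau d x) (nrm d x) = 0) ->
  (exists x delta, [/\ GBD d x,
     surface_divergence (GBD d) (nrm d) (btau d) x delta & delta <> 0]) ->
  exists chi : pt R -> R, [/\ Ck 2 setT chi,
    forall x, GBN d x -> grad chi x = 0,
    (forall i, continuous (fun x => grad chi x 0 i)) /\
      (forall i, exists M, forall x, `|grad chi x 0 i| <= M),
    vol.-integrable (Omega d) (EFin \o (fun x => dot (curl_of (DBB x)) (grad chi x))) &
    \int[vol]_(x in Omega d) dot (curl_of (DBB x)) (grad chi x) != 0].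
Proof.
move=> [_ [_ oOm _ bOm _] onrm [_ _ [bsplit _ cGN DN0]]].
move=> [BBc BBLp [wj _] BBD _] btn [x0 [delta [Dx0 [bt [[btC btE] dE]] d0]]].
set Om := Omega d in oOm bOm onrm bsplit BBc BBLp wj *.
have mOm := open_measurable_pt oOm.
(* Charts in terms of [Phi]: the orientation becomes a number of square one, and the outer normal is
   [- grad Phi] over its length. *)
have chartP x : bdry Om x -> exists k sg gam r, [/\ sg * sg = 1 :> R, 0 < r,
    Ck 2 setT gam, (forall y (h : R), gam (y + h *: bas k) = gam y) &
    (forall y, ball x r y -> (Om y <-> 0 < Phi k sg gam y)) /\
    nrm d x = - ((slope k sg gam x)^-1 *: grad (Phi k sg gam) x)].
  move=> /onrm[k [s [gam [[[gC _] gI [r r0 H]] nE]]]].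
  exists k, ((-1) ^+ s), gam, r; split => //.
  - by rewrite -expr2 sqrr_sign.
  split.
    by move=> y /H; rewrite /Phi subr_gt0.
  by rewrite nE grad_gam// dotNl dotC dotNl opprK scalerN.
have bdGD x : GBD d x -> bdry Om x by rewrite bsplit; left.
have [k [sg [gam [r1 [s2 r10 gC gI [OmP nE0]]]]]] := chartP x0 (bdGD _ Dx0).
have cgam : continuous gam by move=> x; exact: (Ck_continuous gC I).
have PC := Phi_C2 k sg gC.
set Ph := Phi k sg gam in OmP nE0 PC.
have Px0 : Ph x0 = 0.
  by apply: (bdry_Phi0 gC oOm OmP); [exact: ballxx|exact: bdGD].
pose W i x : R := - slope k sg gam x * bt (pr k sg gam x) 0 i.
have btC1 i : Ck 1 setT (fun x => bt x 0 i) := CkS (btC 0 i).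
have slC := slope_C1 s2 gC gI.
have WC i : Ck 1 setT (W i).
  exact: (CkM (CkN slC) (Ck_pr k sg gC (btC1 i))).
have WI i : inv k (W i).
  by move=> x h; rewrite /W slope_inv// pr_shift.
pose divW x : R := \sum_i 'D_(bas i) (W i) x.
have [r2 r20 HN] : exists2 r2 : R, 0 < r2 & forall x, ball x0 r2 x -> ~ GBN d x.
  have : nbhs x0 (~` GBN d).
    apply: open_nbhs_nbhs; split.
      apply: closed_openC; apply: compact_closed => //; exact: norm_hausdorff.
    by move=> Nx0; have : (GBD d `&` GBN d) x0 by []; rewrite DN0.
  by move=> /nbhs_ballP[e /= e0 H]; exists e.
(* Off [GBN] the zero set of [Ph] belongs to [GBD]; the normal there comes from another chart and is
   translated to the fixed one. *)
have nrmE x : ball x0 r1 x -> ball x0 r2 x -> Ph x = 0 -> GBD d x /\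
    nrm d x = - ((slope k sg gam x)^-1 *: grad Ph x).
  move=> x1 x2 P0; have bx := Phi0_bdry s2 gI oOm OmP x1 P0.
  split; first by move: (bx); rewrite bsplit => -[//|/(HN x x2)].
  have [k' [sg' [gam' [r' [s2' r'0 gC' gI' [OmP' ->]]]]]] := chartP x bx.
  have x' : ball x r' x by exact: ballxx.
  have P0' := bdry_Phi0 gC' oOm OmP' x' bx.
  exact: esym (congr1 -%R (chart_normal_unique s2 s2' gC gC' gI gI' OmP OmP' x1 x' P0 P0')).
have tan0 x : ball x0 r1 x -> ball x0 r2 x -> Ph x = 0 -> dot (bt x) (grad Ph x) = 0.
  move=> x1 x2 P0; have [Gx nE] := nrmE x x1 x2 P0.
  have := btn x Gx; rewrite btE// nE dotC dotNl dotZl dotC => /eqP.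
  rewrite oppr_eq0 mulf_eq0 invr_eq0 gt_eqF ?slope_gt0//=.
  by move=> /eqP.
have BBW x : ball x0 r1 x -> ball x0 r2 x -> Ph x = 0 ->
    forall i, cross (BB x) (grad Ph x) 0 i = W i x.
  move=> x1 x2 P0 i; have [Gx nE] := nrmE x x1 x2 P0.
  rewrite /W pr_id// btE// -BBD// nE.
  have sl := slope_gt0 s2 gI x.
  rewrite !mxE; field; by rewrite gt_eqF.
have gpr x : grad Ph (pr k sg gam x) = grad Ph x.
  by apply/rowP => i; rewrite !mxE; apply: (dPhi_inv sg gC gI).
(* The surface divergence contains [(Db)n . n], a divergence of [W] does not; differentiating the
   tangency relation and the length of the gradient at [x0] reconciles the two. *)
have divW0 : divW x0 = - slope k sg gam x0 * delta.
  have pr0 : pr k sg gam x0 = x0 by exact: pr_id.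
  pose N := slope k sg gam x0.
  pose p i := 'D_(bas i) Ph x0.
  pose h i j := 'D_(bas j) (fun y => 'D_(bas i) Ph y) x0.
  pose t i := bt x0 0 i.
  pose b i j := 'D_(bas j) (fun y => bt y 0 i) x0.
  have hs i j : h i j = h j i by exact: derive_swap.
  have dbt i j : is_derive x0 (bas j) (fun y => bt (pr k sg gam y) 0 i)
      (b i j + - sg * p j * b i k).
    by have := is_derive_pr k sg gC x0 (bas j) (btC1 i); rewrite pr0.
  have dP i j : is_derive x0 (bas j) (fun y => 'D_(bas i) Ph y) (h i j).
    by apply: derivableP; exact: (Ck_derivable (Ck_derive (bas i) PC) I).
  have dsl j : 'D_(bas j) (slope k sg gam) x0 =
      N^-1 * (p o0 * h o0 j + p o1 * h o1 j + p o2 * h o2 j).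
    by rewrite (derive_slope s2 gC gI) sum3.
  have dW i j : 'D_(bas j) (W i) x0 =
      - (N^-1 * (p o0 * h o0 j + p o1 * h o1 j + p o2 * h o2 j)) * t i
      - N * (b i j + - sg * p j * b i k).
    have ds := is_deriveN (derivableP (Ck_derivable (v := bas j) slC (I : setT x0))).
    have := is_deriveM ds (dbt i j); rewrite dsl pr0 => D.
    have E := @derive_val _ _ _ _ _ _ _ D.
    refine (etrans E _); rewrite /GRing.scale/= -/(t i) -/N.
    have alg (A B C M : R) : - M * B + C * - A = - A * C - M * B by ring.
    exact: alg.
  (* Derivative at [x0] of [bt(pr y) . grad Ph y], which vanishes for all [y] near [x0] and not only
     on the boundary: [pr y] lies on the boundary and has the same gradient. *)
  have T0 j : (b o0 j + - sg * p j * b o0 k) * p o0 + t o0 * h o0 j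
      + ((b o1 j + - sg * p j * b o1 k) * p o1 + t o1 * h o1 j)
      + ((b o2 j + - sg * p j * b o2 k) * p o2 + t o2 * h o2 j) = 0.
    have dM i : is_derive x0 (bas j) (fun y => bt (pr k sg gam y) 0 i * 'D_(bas i) Ph y)
        ((b i j + - sg * p j * b i k) * p i + t i * h i j).
      have := is_deriveM (dbt i j) (dP i j); rewrite pr0.
      move/is_derive_congr; apply => //; rewrite /GRing.scale/= -/(t i) -/(p i).
      have alg (A B C M : R) : B * M + C * A = A * C + B * M by ring.
      exact: alg.
    have D := is_deriveD (is_deriveD (dM o0) (dM o1)) (dM o2).
    have nT : \forall y \near x0, bt (pr k sg gam y) 0 o0 * 'D_(bas o0) Ph y +
        bt (pr k sg gam y) 0 o1 * 'D_(bas o1) Ph y +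
        bt (pr k sg gam y) 0 o2 * 'D_(bas o2) Ph y = cst 0 y.
      have : nbhs x0 (pr k sg gam @^-1` (ball x0 r1 `&` ball x0 r2)).
        apply: open_nbhs_nbhs; split; last by rewrite /preimage /= pr0; split; exact: ballxx.
        apply: (@open_comp _ _ (pr k sg gam) (ball x0 r1 `&` ball x0 r2)).
          by move=> x _; exact: (@continuous_pr R k sg gam gC x).
        by apply: openI; exact: ball_open.
      apply: filterS => y [y1 y2].
      have := tan0 _ y1 y2 (Phi_pr s2 gI y).
      by rewrite gpr dot3 ![grad _ _ _ _]mxE.
    have E := @derive_val _ _ _ _ _ _ _ D.
    rewrite -E; refine (etrans (near_eq_derive _ nT) _); exact: derive_cst.
  have N0 : N != 0 by rewrite gt_eqF// slope_gt0.
  have N2 : N ^+ 2 = p o0 * p o0 + p o1 * p o1 + p o2 * p o2.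
    by rewrite sqr_sqrtr ?dot_ge0// dot3 ![grad _ _ _ _]mxE.
  have := T0 o0; have := T0 o1; have := T0 o2.
  rewrite (hs o2 o1) (hs o2 o0) (hs o1 o0) => T2 T1 T00.
  rewrite /divW sum3 !dW (hs o2 o1) (hs o2 o0) (hs o1 o0).
  rewrite (surface_divergence_alg N0 N2 T00 T1 T2) -/N dE; congr (- _ * _).
  have ni i : nrm d x0 0 i = - (N^-1 * p i) by rewrite nE0 !mxE.
  rewrite /div quad_form3 !ni.
  rewrite /mxtrace sum3 !jacE -/N -!/(b _ _) -!/(p _).
  have alg (n p0 p1 p2 b00 b01 b02 b10 b11 b12 b20 b21 b22 : R) :
      b00 + b11 + b22 - n * n * ((p0 * b00 + p1 * b10 + p2 * b20) * p0 +
        (p0 * b01 + p1 * b11 + p2 * b21) * p1 + (p0 * b02 + p1 * b12 + p2 * b22) * p2) =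
      b00 + b11 + b22 -
      ((- (n * p0) * b00 + - (n * p1) * b10 + - (n * p2) * b20) * - (n * p0) +
       (- (n * p0) * b01 + - (n * p1) * b11 + - (n * p2) * b21) * - (n * p1) +
       (- (n * p0) * b02 + - (n * p1) * b12 + - (n * p2) * b22) * - (n * p2)) by ring.
  exact: alg.
have nz : divW x0 != 0.
  rewrite divW0 mulf_neq0 ?oppr_eq0 ?(gt_eqF (slope_gt0 s2 gI x0))//.
  exact/eqP.
have cdivW : continuous divW.
  by apply: continuous_sum3 => i x; exact: ((WC i).2 (bas i)).2.
have [r3 r30 Hpos] : exists2 r3 : R, 0 < r3 &
    forall x, ball x0 r3 x -> 0 < divW x0 * divW x.
  have : nbhs x0 [set x | 0 < divW x0 * divW x].
    apply: open_nbhs_nbhs; split; last by rewrite /= -expr2 exprn_even_gt0.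
    apply: (@open_comp _ _ (fun x => divW x0 * divW x) [set t | 0 < t]); last exact: open_gt.
    by move=> x _; apply: cvgM; [exact: cvg_cst|exact: cdivW].
  by move=> /nbhs_ballP[e /= e0 H]; exists e.
(* Within [r0] the chart describes [Om], [GBN] is absent, and [divW] keeps the sign it has at
   [x0]. *)
pose r0 := Num.min r1 (Num.min r2 r3).
have r00 : 0 < r0 by rewrite !lt_min r10 r20.
have B1 x : ball x0 r0 x -> ball x0 r1 x.
  by apply: le_ball; rewrite ge_min lexx.
have B2 x : ball x0 r0 x -> ball x0 r2 x.
  by apply: le_ball; rewrite !ge_min lexx orbT.
have B3 x : ball x0 r0 x -> ball x0 r3 x.
  by apply: le_ball; rewrite !ge_min lexx !orbT.
have [r rr0 lensB] := lens_small s2 cgam gI Px0 r00.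
have [b ballb] : exists b, ball x0 r0 `<=` box b.
  apply: bounded_sub_box; exists (`|x0| + r0); split; first exact: num_real.
  move=> M HM x; rewrite -ball_normE /= => xr; rewrite (le_trans _ (ltW HM))//.
  by rewrite -[x](subKr x0) (le_trans (ler_normB _ _))// lerD2l ltW.
have lensb : lens k sg gam x0 r `<=` box b by move=> x /lensB/ballb.
have [m [mC mI m0 mge mgt]] := cyl_bump k x0 rr0.
have OmP' x : ball x0 r0 x -> (Om x <-> 0 < Ph x) by move=> /B1; exact: OmP.
have tangent x : lens k sg gam x0 r x -> \sum_i W i x * 'D_(bas i) Ph x = 0.
  move=> [cx Px]; have lp : lens k sg gam x0 r (pr k sg gam x).
    split; last by rewrite Phi_pr// normr0 ltW.
    by move=> i ik; rewrite pos_line pos_bas (negbTE ik) mulr0 addr0; exact: cx.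
  have Bp := lensB _ lp.
  have := tan0 _ (B1 _ Bp) (B2 _ Bp) (Phi_pr s2 gI x); rewrite gpr => T0.
  transitivity (- slope k sg gam x * dot (bt (pr k sg gam x)) (grad Ph x)).
    rewrite /dot mulr_sumr; apply: eq_bigr => i _.
    by rewrite /W mulrA mxE.
  by rewrite T0 mulr0.
have iDBB i j : vol.-integrable Om (EFin \o (fun x => DBB x i j)).
  by apply: Lp1_integrable => //; exact: (BBLp 1 (lexx _)).2.
have iBB i : vol.-integrable Om (EFin \o (fun x => BB x 0 i)).
  by apply: Lp1_integrable => //; exact: (BBLp 1 (lexx _)).1.
exists (chi k sg gam r m); split.
- exact: chi_C2.
- move=> x Nx; apply/rowP => i; rewrite !mxE.
  apply: (derive_chi0 gC rr0 mC m0) => lx.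
  by apply: HN Nx; apply: B2; exact: lensB.
- exact: (grad_chi_bounded gC rr0 lensb mC m0).
- exact: (integrable_curl_chi gC oOm rr0 lensb mC m0 iDBB).
rewrite (curl_flux s2 gC gI oOm (ball_open x0 r0) rr0 lensb lensB OmP' mC mI m0
  (fun i => BBc 0 i) iBB iDBB wj WC WI tangent); last first.
  by move=> x xb; apply: BBW; [exact: B1|exact: B2].
pose f x := dbmp r (Ph x) * (divW x * m x).
have f0 x : ~ lens k sg gam x0 r x -> f x = 0.
  apply: (out_lens (q := dbmp r) (e := fun x => divW x * m x)).
    by move=> t rt; case: (bmp_out rr0 rt).
  by move=> y /m0[-> _]; rewrite mulr0.
have fi : vol.-integrable Om (EFin \o f).
  suff fT : vol.-integrable setT (EFin \o f) by apply: integrableS fT.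
  apply: (@integrable_continuous_box _ _ b); last by move=> x xb; apply: f0 => /lensb.
  move=> x; apply: cvgM.
    exact: (Ck_continuous (Ck_comp (Ck_dbmp r) (CkS PC)) I).
  by apply: cvgM; [exact: cdivW|exact: (Ck_continuous mC I)].
have sgn (w0 e w m' : R) : - w0 * (e * (w * m')) = w0 * w * - e * m' by ring.
(* Inside the domain [dbmp] is at most 0, [m] is at least 0, and [divW x0 * divW x] is positive on
   the lens; the factor [- divW x0] makes the integrand nonnegative, strictly positive on [V]. *)
have Ipos : 0 < \int[vol]_(x in Om) (- divW x0 * f x).
  pose V := [set x | 0 < Ph x] `&` ([set x | Ph x < r] `&` [set x | 0 < m x]).
  have cPh : continuous Ph by exact: (continuous_Phi gC).
  have cm : continuous m by move=> x; exact: (Ck_continuous mC I).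
  have Vlens x : V x -> lens k sg gam x0 r x.
    move=> [/= Px [/= Pr mx]]; split; last by rewrite gtr0_norm// ltW.
    by apply: contrapT => /m0[mx0 _]; rewrite mx0 ltxx in mx.
  apply: (@Rintegral_gt0 _ Om V) => //.
  - apply: openI; [|apply: openI].
    + by apply: (@open_comp _ _ Ph [set t | 0 < t]) => [x _|]; [exact: cPh|exact: open_gt].
    + by apply: (@open_comp _ _ Ph [set t | t < r]) => [x _|]; [exact: cPh|exact: open_lt].
    + by apply: (@open_comp _ _ m [set t | 0 < t]) => [x _|]; [exact: cm|exact: open_gt].
  (* The point of [Phi]-height [r / 2] above [x0], where [m] still has its value at [x0]. *)
  - exists (x0 + (sg * (r / 2)) *: bas k).
    have E : Ph (x0 + (sg * (r / 2)) *: bas k) = r / 2.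
      by rewrite /Ph Phi_shift// -/Ph Px0 add0r mulrA s2 mul1r.
    by rewrite /V /= !E mI; split; [|split] => //; lra.
  - by move=> x Vx; apply/(OmP' _ (lensB _ (Vlens _ Vx))); case: Vx.
  - exact: (@integrableZ_EFin _ _ _ vol Om _ _ mOm fi).
  - move=> x Ox; have [lx|/f0 ->] := pselect (lens k sg gam x0 r x); last by rewrite mulr0.
    have lB := lensB _ lx; have Px := (OmP' _ lB).1 Ox.
    have D := dbmp_le0 r (ltW Px); have P := Hpos _ (B3 _ lB).
    by rewrite /f sgn mulr_ge0// mulr_ge0 ?oppr_ge0// ltW.
  - move=> x Vx; have lx := Vlens _ Vx; case: Vx => /= Px [/= Pr mx].
    have lB := lensB _ lx.
    have D := dbmp_lt0 Px Pr; have P := Hpos _ (B3 _ lB).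
    by rewrite /f sgn mulr_gt0// mulr_gt0 ?oppr_gt0.
rewrite (volZ _ mOm fi) in Ipos.
by apply/eqP => I0; move: Ipos; rewrite /f I0 mulr0 ltxx.
Qed.

End Flux.

(** * Pointwise bounds from the constitutive laws *)

Section Pointwise.
Context {R : realType}.

(** The viscous form is a sum of squares: off-diagonal symmetric sums, differences of diagonal
    entries, and the trace. *)
Lemma stress_ge0 (d : mhd R) (th : R) (A : 'M[R]_3) :
  0 <= mu d th -> 0 <= eta d th -> 0 <= ddot (stress d th A) A.
Proof.
move=> mu0 eta0.
have E : ddot (stress d th A) A = mu d th * (
    (A o0 o1 + A o1 o0) ^+ 2 + (A o0 o2 + A o2 o0) ^+ 2 + (A o1 o2 + A o2 o1) ^+ 2
    + 2 / 3 * ((A o0 o0 - A o1 o1) ^+ 2 + (A o0 o0 - A o2 o2) ^+ 2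
      + (A o1 o1 - A o2 o2) ^+ 2))
    + eta d th * (A o0 o0 + A o1 o1 + A o2 o2) ^+ 2.
  rewrite /ddot /stress /mxtrace !sum3 !mxE /=.
  move: (mu d th) (eta d th) => m e.
  by rewrite !mulr1n !mulr0n; field.
rewrite E; apply: addr_ge0; apply: mulr_ge0 => //; last exact: sqr_ge0.
by rewrite !addr_ge0 ?sqr_ge0// mulr_ge0// !addr_ge0// sqr_ge0.
Qed.

(** Viscous and conductive parts are nonnegative. Since [zeta] grows at least like [z * th], the
    factor [th^-1] is absorbed and the bound on the Joule part does not depend on the
    temperature. *)
Lemma dissipation_lb (d : mhd R) (th z : R) (A : 'M[R]_3) (g c : 'rV[R]_3) :
  0 < th -> 0 <= mu d th -> 0 <= eta d th -> 0 <= kappa d th -> 0 <= z ->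
  z * (1 + th) <= zeta d th ->
  z * dot c c <= (th)^-1 * dissipation d th A g c.
Proof.
move=> th0 mu0 eta0 ka0 z0 zeta0.
rewrite [leRHS]mulrC ler_pdivlMr// /dissipation /heat_flux dotZl.
have S0 := stress_ge0 A mu0 eta0; have G0 := dot_ge0 g; have C0 := dot_ge0 c.
have K0 : 0 <= kappa d th * dot g g / th by rewrite divr_ge0 ?mulr_ge0// ltW.
rewrite mulNr mulNr opprK.
have : z * dot c c * th <= zeta d th * dot c c.
  rewrite mulrAC ler_wpM2r//; apply: le_trans zeta0.
  by rewrite ler_wpM2l// lerDr.
by move: K0 S0; lra.
Qed.

(** Expansion of [0 <= |c - l *: w|^2]; the bound is linear in [c], so its integral involves [c]
    only through the flux. *)
Lemma dot_young (c w : 'rV[R]_3) (l : R) :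
  2 * l * dot c w - l ^+ 2 * dot w w <= dot c c.
Proof.
have := dot_ge0 (c + (- l) *: w).
rewrite dotDl dotZl dotC dotDl dotZl [dot w (c + _)]dotC dotDl dotZl (dotC w c).
by move: (dot c c) (dot c w) (dot w w) => a b e; lra.
Qed.

(** At an interior point of the half-line the restricted limit is an ordinary one, because small
    increments stay in the half-line. *)
Lemma halfline_derive (f df : R -> R) (x : R) : C1_halfline f df -> 0 < x ->
  is_derive x (1 : R) f (df x).
Proof.
move=> [H _] x0.
suff Q : (fun h : R => h^-1 *: ((f \o shift x) (h *: 1) - f x)) h @[h --> 0^'] --> df x.
  by split; [apply/cvg_ex; exists (df x)|apply/cvg_lim].
apply/cvgrPdist_lt => e e0.
have /cvgrPdist_lt/(_ e e0) := H x (ltW x0).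
rewrite near_withinE /dnbhs !near_withinE => /nbhs_ballP[r /= r0 Hr].
near=> h => h0.
have hr : `|h| < Num.min r x.
  near: h; apply/nbhs_ballP; exists (Num.min r x); first by rewrite /= lt_min r0.
  by move=> y; rewrite /ball/= sub0r normrN.
move: hr; rewrite lt_min => /andP[hr hx].
have xb : ball x r (h + x) by rewrite /ball/= opprD addrCA subrr addr0 normrN.
have xn : h + x != x by rewrite -subr_eq0 addrK.
have xi : `[0, +oo[%classic (h + x).
  by rewrite /= in_itv/= andbT; move: hx; rewrite ltr_norml; lra.
have := Hr _ xb xn xi; rewrite /= addrK [h%:A]mulr1 mulrC.
by [].
Unshelve. all: by end_near.
Qed.

Lemma derive_ge0_le (f df : R -> R) (a b : R) : a <= b ->
  (forall x, a <= x -> x <= b -> is_derive x (1 : R) f (df x)) ->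
  (forall x, a <= x -> x <= b -> 0 <= df x) -> f a <= f b.
Proof.
rewrite le_eqVlt => /orP[/eqP -> //|ab] dF d0.
have [||c cab E] := @MVT R f df a b ab.
- by move=> x; rewrite in_itv/= => /andP[ax xb]; apply: dF; exact: ltW.
- apply: derivable_within_continuous => x; rewrite in_itv/= => /andP[ax xb].
  by case: (dF x ax xb).
- move: cab; rewrite in_itv/= => /andP[ac cb].
  by rewrite -subr_ge0 E mulr_ge0 ?d0 ?ltW// subr_gt0.
Qed.

Section EOS.
Variable d : mhd R.
Hypothesis eos : eos_assumptions d.

Lemma P_mono (a b : R) : 0 < a -> a <= b -> P d a <= P d b.
Proof.
case: eos => -[_ C1] [_ P'0] _ _ _ a0 ab.
apply: (@derive_ge0_le (P d) (P' d)) => // x ax xb.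
  by apply: halfline_derive => //; exact: lt_le_trans ax.
by rewrite ltW// P'0// (le_trans _ ax)// ltW.
Qed.

(** The right derivative at 0 is positive and [P] starts at 0, so [P] is positive at some small [y];
    monotonicity on the positive axis carries this to [Z]. *)
Lemma P_ge0 (Z : R) : 0 <= Z -> 0 <= P d Z.
Proof.
case: eos => -[_ C1] [P0 P'0] _ _ _.
rewrite le_eqVlt => /orP[/eqP <-|Z0]; first by rewrite P0.
have /cvgrPdist_lt/(_ _ (P'0 0 (lexx _))) := C1.1 0 (lexx _).
rewrite near_withinE /dnbhs near_withinE => /nbhs_ballP[r /= r0 Hr].
pose y := Num.min r Z / 2.
have m0 : 0 < Num.min r Z by rewrite lt_min r0.
have y0 : 0 < y by rewrite divr_gt0.
have yr : y < r by have : Num.min r Z <= r by [rewrite ge_min lexx]; rewrite /y; lra.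
have yZ : y <= Z by have : Num.min r Z <= Z by [rewrite ge_min lexx orbT]; rewrite /y; lra.
have := Hr y; rewrite /ball/= sub0r normrN gtr0_norm// gt_eqF// in_itv/= andbT.
move=> /(_ yr isT (ltW y0)); rewrite P0 !subr0 ltr_norml => /andP[_].
rewrite ltrBlDl -[X in X < _]addr0 => h.
have : 0 < P d y / y by move: h; lra.
rewrite pmulr_lgt0 ?invr_gt0// => Py.
by rewrite (le_trans (ltW Py))// P_mono.
Qed.

(** [entS] is decreasing, which settles [1 <= Z]. Below 1 its slope is at least
    [- 5 / 2 * P d 1 / Z ^+ 2], and integration up to 1 gives the [1 / Z] bound. Multiplied by the
    density, [1 / Z] becomes [th ^ (3/2)], with no density left. *)
Lemma entS_le (Z : R) : 0 < Z -> entS d Z <= `|entS d 1| + 5 / 2 * P d 1 / Z.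
Proof.
move=> Z0; have [_ [_ P'0] [gap _] _ [dS _]] := eos.
have C0 : 0 <= 5 / 2 * P d 1 by rewrite mulr_ge0// P_ge0.
have CZ : 0 <= 5 / 2 * P d 1 / Z by rewrite divr_ge0// ltW.
have S1 := ler_norm (entS d 1).
have [Z1|Z1] := leP 1 Z.
  have : - entS d 1 <= - entS d Z.
    pose ds x := 3 / 2 * ((5 / 3 * P d x - P' d x * x) / x ^+ 2).
    apply: (@derive_ge0_le (fun x => - entS d x) ds) => // x x1 _.
      have x0 : 0 < x by exact: lt_le_trans x1.
      apply: (is_derive_congr (is_deriveN (dS x x0))) => //.
      by rewrite /ds mulNr opprK.
    have x0 : 0 < x by exact: lt_le_trans x1.
    rewrite /ds mulr_ge0// expr2 invfM mulrA divr_ge0 ?(ltW x0)//.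
    exact/ltW/gap.
  by move: CZ S1; lra.
pose C := 5 / 2 * P d 1.
(* Nondecreasing on []0, 1]], the constant [5 / 2] being [3 / 2 * 5 / 3]. *)
pose g x := entS d x - C * x^-1.
pose dg x := - (3 / 2) * ((5 / 3 * P d x - P' d x * x) / x ^+ 2) - C * (- x ^- 2).
have : g Z <= g 1.
  apply: (@derive_ge0_le g dg); first exact: ltW.
    move=> x Zx x1; have x0 : 0 < x by exact: lt_le_trans Zx.
    have dV : is_derive x (1 : R) (fun y : R => y^-1) (- x ^- 2).
      have xn0 : (fun y : R => y) x != 0 by rewrite gt_eqF.
      have di : derivable (fun y : R => y) x 1 by exact: derivable_id.
      apply: (is_derive_congr (DeriveDef (derivableV xn0 di) (deriveV xn0 di))) => //.
      by rewrite derive_id /GRing.scale/= mulr1.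
    exact: (is_derive_congr (is_deriveB (dS x x0) (is_deriveZ C dV))).
  move=> x Zx x1; have x0 : 0 < x by exact: lt_le_trans Zx.
  have -> : dg x = (C - 3 / 2 * (5 / 3 * P d x - P' d x * x)) / x ^+ 2.
    by rewrite /dg; field; rewrite gt_eqF.
  rewrite divr_ge0 ?sqr_ge0// /C.
  have := P_mono x0 x1; have : 0 <= P' d x * x.
    by rewrite mulr_ge0 ?(ltW x0)// ltW// P'0// ltW.
  lra.
rewrite /g invr1 mulr1 -/C => gZ.
by move: gZ C0 S1; rewrite -/C; lra.
Qed.

Lemma powR32_le (th : R) : 0 < th -> th `^ (3 / 2) <= 1 + th ^+ 4.
Proof.
move=> t0; have t4 : 0 <= th ^+ 4 by rewrite exprn_ge0// ltW.
have [t1|t1] := leP th 1.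
  have h0 : 0 <= 3 / 2 :> R by lra.
  have := ge0_ler_powR h0 (x := th) (y := 1); rewrite powR1 !nnegrE ltW//.
  by move=> /(_ isT ler01 t1); lra.
have : th `^ (3 / 2) <= th `^ 4 by apply: ler_powR; [exact: ltW|lra].
rewrite (powR_mulrn 4 (ltW t0)); lra.
Qed.

Lemma energy_ge (r th : R) (u b : 'rV[R]_3) : 0 <= r -> 0 < th ->
  arad d * th ^+ 4 <= energy d r th u b.
Proof.
move=> r0 t0; rewrite /energy /rho_e.
have U := dot_ge0 u; have B := dot_ge0 b.
have : 0 <= 3 / 2 * th `^ (5 / 2) * P d (zz r th).
  rewrite mulr_ge0 ?P_ge0// /zz ?mulr_ge0// ?powR_ge0//.
have : 0 <= 1 / 2 * r * dot u u by rewrite !mulr_ge0.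
lra.
Qed.

(** The gas entropy costs [|entS 1| * r] and a multiple of [th ^ (3/2)], the radiation entropy a
    multiple of [th ^+ 3]. Both powers are below [1 + th ^+ 4], and [arad * th ^+ 4] is the
    radiation part of the energy. *)
Lemma rho_s_le : exists2 C : R, 0 < C & forall (r th : R) (u b : 'rV[R]_3),
  0 <= r -> 0 < th -> rho_s d r th <= C * (r + 1 + energy d r th u b).
Proof.
have [[a0 _] _ _ _ _] := eos.
pose C1 := 5 / 2 * P d 1.
have C10 : 0 <= C1 by rewrite mulr_ge0// P_ge0.
have aa : 0 <= 2 * arad d by rewrite mulr_ge0// ltW.
have C30 : 0 <= (C1 + 2 * arad d) / arad d.
  by apply: divr_ge0; [exact: addr_ge0|exact: ltW].
exists (`|entS d 1| + (C1 + 2 * arad d) + (C1 + 2 * arad d) / arad d).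
  have := normr_ge0 (entS d 1); lra.
move=> r th u b r0 t0.
have t4 : 0 <= th ^+ 4 by rewrite exprn_ge0// ltW.
have E := energy_ge u b r0 t0.
have t3 : th ^+ 3 <= 1 + th ^+ 4.
  have : 0 <= (th - 1) ^+ 2 * (th ^+ 2 + th + 1) by rewrite mulr_ge0 ?sqr_ge0// !addr_ge0 ?sqr_ge0// ltW.
  have -> : (th - 1) ^+ 2 * (th ^+ 2 + th + 1) = th ^+ 4 - th ^+ 3 - th + 1 by ring.
  lra.
have S : r * entS d (zz r th) <= `|entS d 1| * r + C1 * th `^ (3 / 2).
  (* Vacuum is separate, since there [zz] vanishes and [entS_le] does not apply; the factor [r]
     annihilates the term. *)
  move: r0; rewrite le_eqVlt => /orP[/eqP <-|r0].
    by rewrite mul0r mulr0 add0r mulr_ge0// powR_ge0.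
  have p0 : 0 < th `^ (- (3 / 2)) by exact: powR_gt0.
  have z0 : 0 < zz r th by rewrite mulr_gt0.
  have := ler_wpM2l (ltW r0) (entS_le z0); rewrite mulrDr -/C1.
  have -> : r * (C1 / zz r th) = C1 * th `^ (3 / 2).
    rewrite /zz powRN; field.
    by rewrite !gt_eqF ?powR_gt0 ?invr_gt0.
  by rewrite (mulrC r `|_|).
have T := ler_wpM2l C10 (powR32_le t0).
have A : (C1 + 2 * arad d) * (1 + th ^+ 4) <= (C1 + 2 * arad d) +
    (C1 + 2 * arad d) / arad d * energy d r th u b.
  have := ler_wpM2l C30 E; rewrite mulrA divfK ?gt_eqF//; lra.
have B : 4 * arad d / 3 * th ^+ 3 <= 2 * arad d * (1 + th ^+ 4).
  have := ler_wpM2l (ltW a0) t3; have := mulr_ge0 (ltW a0) t4; lra.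
have N0 := normr_ge0 (entS d 1).
have E0 : 0 <= energy d r th u b by apply: le_trans E; rewrite mulr_ge0// ltW.
have M1 : 0 <= `|entS d 1| * energy d r th u b by rewrite mulr_ge0.
have M2 : 0 <= (C1 + 2 * arad d) * energy d r th u b.
  by rewrite mulr_ge0// addr_ge0.
have M3 : 0 <= (C1 + 2 * arad d) * r by rewrite mulr_ge0// addr_ge0.
have M4 : 0 <= (C1 + 2 * arad d) / arad d * r by rewrite mulr_ge0.
rewrite /rho_s (le_trans (lerD S B))// (le_trans (lerD (lerD (lexx _) T) (lexx _)))//.
have -> : `|entS d 1| * r + C1 * (1 + th ^+ 4) + 2 * arad d * (1 + th ^+ 4) =
  `|entS d 1| * r + (C1 + 2 * arad d) * (1 + th ^+ 4) by ring.
apply: (le_trans (lerD (lexx _) A)).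
move: M1 M2 M3 M4 N0 (addr_ge0 C10 aa) C30.
move: (C1 + _) => K; move: (K / _) (`|_|) (energy d r th u b) => L N e; lra.
Qed.

End EOS.
End Pointwise.

Lemma ae_le_Rintegral dd (X : measurableType dd) (R : realType)
    (mu : {measure set X -> \bar R}) (D : set X) (f g : X -> R) : measurable D ->
  mu.-integrable D (EFin \o f) -> mu.-integrable D (EFin \o g) ->
  {ae mu, forall x, D x -> f x <= g x} ->
  \int[mu]_(x in D) f x <= \int[mu]_(x in D) g x.
Proof.
move=> mD fi gi [N [mN N0 HN]].
rewrite /Rintegral (negligible_integral mN mD fi N0) (negligible_integral mN mD gi N0).
have mDN : measurable (D `\` N) by exact: measurableD.
have s : D `\` N `<=` D by exact: subDsetl.
apply: (@le_Rintegral _ _ _ mu (D `\` N) f g mDN).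
- exact: integrableS fi.
- exact: integrableS gi.
- move=> x [Dx nx]; apply: contrapT => fg; apply: nx; apply: HN => /= H.
  exact/fg/H.
Qed.

(** * Fubini on rectangles of time and space *)

Section Slices.
Context d1 d2 (T1 : measurableType d1) (T2 : measurableType d2) (R : realType).
Variable m1 : {sigma_finite_measure set T1 -> \bar R}.
Variable m2 : {sigma_finite_measure set T2 -> \bar R}.
Implicit Types (J : set T1) (D : set T2).

Lemma ae_slice (Pr : T1 * T2 -> Prop) : {ae (m1 \x m2)%E, forall z, Pr z} ->
  {ae m1, forall t, {ae m2, forall x, Pr (t, x)}}.
Proof.
move=> [A [mA A0 HA]].
have mx := measurable_fun_xsection m2 mA.
have : (\int[m1]_x `|(m2 \o xsection A) x| = 0)%E.
  by rewrite -[RHS]A0; apply: eq_integral => x _; rewrite gee0_abs.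
move=> /(ae_eq_integral_abs _ measurableT mx).1; apply: filterS => t /(_ I) /= tA.
exists (xsection A t); split => //; first exact: measurable_xsection.
by move=> x /= nP; rewrite /xsection/= inE; apply: HA.
Qed.

Lemma measurable_slice J D (h : T1 * T2 -> R) t : measurable J -> measurable D ->
  measurable_fun (J `*` D) h -> J t -> measurable_fun D (fun x => h (t, x)).
Proof.
move=> mJ mD mh Jt _ B mB.
have -> : D `&` (fun x => h (t, x)) @^-1` B =
    xsection ((J `*` D) `&` h @^-1` B) t.
  by apply/seteqP; split => x; rewrite /xsection /= inE /=; [move=> [? ?]|move=> [[? ?] ?]].
by apply: measurable_xsection; apply: mh => //; exact: measurableX.
Qed.

(** Fubini is applied to the extension [G] of [h] by zero, whose slices are extensions of those of
    [h] for times in [J] and zero otherwise. *)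
Lemma slice_integrable J D (h : T1 * T2 -> R) : measurable J -> measurable D ->
  (m1 \x m2)%E.-integrable (J `*` D) (EFin \o h) ->
  [/\ {ae m1, forall t, J t -> m2.-integrable D (EFin \o (fun x => h (t, x)))},
    m1.-integrable J (EFin \o (fun t => \int[m2]_(x in D) h (t, x))) &
    \int[(m1 \x m2)%E]_(z in J `*` D) h z =
    \int[m1]_(t in J) \int[m2]_(x in D) h (t, x)].
Proof.
move=> mJ mD hi; have mJD : measurable (J `*` D) by exact: measurableX.
pose G := (EFin \o h) \_ (J `*` D).
have Gi : (m1 \x m2)%E.-integrable setT G by exact/(integrable_mkcond _ mJD).1.
have GE t : J t -> (fun x => G (t, x)) = (EFin \o (fun x => h (t, x))) \_ D.
  move=> Jt; apply/funext => x; rewrite /G /patch.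
  have [xD|xD] := pselect (D x); first by rewrite !mem_set.
  by rewrite !memNset// => -[].
have G0 t : ~ J t -> (fun x => G (t, x)) = cst 0%E.
  by move=> Jt; apply/funext => x; rewrite /G /patch memNset// => -[].
have FE t : J t -> fubini_F m2 G t = (\int[m2]_(x in D) (h (t, x))%:E)%E.
  by move=> Jt; rewrite /fubini_F GE// -integral_mkcond.
have Fi := integrable_fubini_F Gi.
have FiJ : m1.-integrable J (fubini_F m2 G) by exact: integrableS Fi.
have Fei : m1.-integrable J (EFin \o (fun t => fine (fubini_F m2 G t))).
  apply: (le_integrable mJ _ _ FiJ).
    apply/measurable_EFinP; apply: measurable_funS (measurableT_comp _ (measurable_fubini_F Gi)) => //.
  by move=> t _ /=; case: (fubini_F m2 G t) => [r| |] /=; rewrite ?lexx ?leey.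
split.
- have := ae_integrable1 Gi; apply: filterS => t + Jt.
  by rewrite GE// => H; apply/(integrable_mkcond _ mD).2.
- apply: eq_integrable Fei => // t; rewrite inE => Jt.
  by rewrite /= FE.
- rewrite /Rintegral; congr fine.
  rewrite integral_mkcond -/G -(integral12_prod_meas1 Gi).
  have -> : (\int[m1]_x fubini_F m2 G x = \int[m1]_(x in J) fubini_F m2 G x)%E.
    rewrite [RHS]integral_mkcond; apply: eq_integral => t _.
    rewrite /patch; case: ifPn => //; rewrite notin_setE => Jt.
    by rewrite /fubini_F G0// integral0.
  have mF := measurable_int _ FiJ; have mFe := measurable_int _ Fei.
  rewrite (@ae_eq_integral _ _ _ _ _ _ _ mJ mF mFe); last first.
    by have := integrable_ae mJ FiJ; apply: filterS => t H Jt /=; rewrite fineK// H.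
  by apply: eq_integral => t; rewrite inE => Jt /=; rewrite FE.
Qed.

End Slices.

(** * Test functions of time *)

Section TimeFunctions.
Context {R : realType}.
Implicit Types (psi : R -> R) (T : R).

Lemma Ck_time psi : Ck 1 setT psi -> Ck 1 setT (fun y : spt R => psi y.1).
Proof.
move=> cpsi; apply: (Ck_comp cpsi); apply: Ck_additive => // y.
exact: cvg_fst.
Qed.

Lemma gradx_time psi (y : spt R) : gradx (fun y => psi y.1) y = 0.
Proof. by apply/rowP => j; rewrite !mxE /=; exact: derive_cst. Qed.

Lemma dt_time psi (y : spt R) : dt (fun y => psi y.1) y = derive1 psi y.1.
Proof. by []. Qed.

Lemma test_fun_time T psi : test_time T psi -> test_fun T (fun y => psi y.1).
Proof.
move=> [cpsi [t1 [t2 [T1 p0]]]]; split; first exact: Ck_time.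
by exists t1, t2; split => // t x; exact: p0.
Qed.

Lemma continuous_derive1 psi : Ck 1 setT psi -> continuous (derive1 psi).
Proof.
move=> cpsi x.
have <- : (fun y => 'D_1 psi y) = derive1 psi by apply/funext => y; rewrite derive1E.
exact: ((cpsi.2 (1 : R)).2 x I).
Qed.

Lemma Ck_affine k (a b : R) : Ck k setT (fun s : R => b * (s - a)).
Proof. exact: (CkM (@Ck_cst _ _ k setT b) (CkB (Ck_id k) (@Ck_cst _ _ k setT a))). Qed.

Lemma is_derive_affine (a b s : R) : is_derive s (1 : R) (fun s => b * (s - a)) b.
Proof.
apply: (is_derive_congr (is_deriveZ b (is_deriveB (is_derive_id s (1 : R))
  (is_derive_cst a s (1 : R))))) => //.
by rewrite subr0; exact: mulr1.
Qed.

Definition cutoff (a b : R) (s : R) : R := step (b * (s - a)).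

Lemma Ck_cutoff (a b : R) : Ck 1 setT (cutoff a b).
Proof. exact: (Ck_comp Ck_step (Ck_affine 1 a b)). Qed.

Lemma is_derive_cutoff (a b s : R) :
  is_derive s (1 : R) (cutoff a b) (b * dstep (b * (s - a))).
Proof.
have [d1 e1] := is_derive_step (b * (s - a)); have [d2 e2] := is_derive_affine a b s.
have D := @is_derive_comp1 R R^o step (fun s : R => b * (s - a)) s 1 d1 d2; rewrite e1 e2 mulrC in D.
exact: D.
Qed.

(** A nonnegative test function of slope 1 on a window, namely [s - T] times a cutoff. The rise
    takes place on [[T + 1, T + 2]], so the slope is exactly 1 around every point from [T + 3]
    on. *)
Lemma exists_window T (b : R) : T + 3 <= b -> exists psi, [/\ test_time T psi,
  forall s, 0 <= psi s & forall s, T + 3 <= s <= b -> derive1 psi s = 1].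
Proof.
move=> Tb; pose psi s := 1 * (s - T) * (cutoff T 1 s * (1 - cutoff b 1 s)).
have c01 (a s : R) : 0 <= cutoff a 1 s <= 1 by exact: step_itv.
have c0 (a s : R) : s <= a + 1 -> cutoff a 1 s = 0.
  by move=> sa; apply: step_le1; lra.
have c1 (a s : R) : a + 2 <= s -> cutoff a 1 s = 1.
  by move=> sa; apply: step_ge2; lra.
exists psi; split.
- split.
    apply: (CkM (Ck_affine 1 T 1) (CkM (Ck_cutoff T 1) _)).
    exact: (CkB (@Ck_cst _ _ 1 setT 1) (Ck_cutoff b 1)).
  exists (T + 1), (b + 2); split; first by lra.
  move=> t; rewrite negb_and -!ltNge /psi => /orP[tT|tb].
    by rewrite c0 ?(ltW tT)// mul0r mulr0.
  by rewrite (c1 b) ?(ltW tb)// subrr !mulr0.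
- move=> s; rewrite /psi mul1r; have /andP[h1 _] := c01 T s.
  have /andP[_ h2] := c01 b s; have [sT|sT] := leP s (T + 1).
    by rewrite (c0 T)// mul0r mulr0.
  apply: mulr_ge0; first by lra.
  by apply: mulr_ge0 => //; rewrite subr_ge0.
- move=> s /andP[Ts sb]; rewrite derive1E.
  have [_ E] := is_derive_affine T 1 s; rewrite -[RHS]E; apply: near_eq_derive.
  have H : `]T + 2, (b + 1)[%classic s by rewrite /= in_itv/=; lra.
  have : nbhs s `]T + 2, (b + 1)[%classic.
    by apply: open_nbhs_nbhs; split => //; exact: interval_open.
  apply: filterS => t; rewrite /= in_itv/= => /andP[t1 t2].
  rewrite /psi (c1 T) ?(c0 b) ?(ltW t1) ?(ltW t2)//.
  by rewrite subr0 !mulr1.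
Qed.

(** Rises on [[a + 1, a + 2]] and falls on [[t + e, t + 2 * e]]. The falling edge can be made
    arbitrarily steep while the rising one stays fixed. *)
Lemma exists_plateau T (a t e : R) : T <= a -> a + 2 <= t -> 0 < e ->
  exists psi, [/\ test_time T psi, forall s, 0 <= psi s,
    forall s, a + 2 <= s <= t -> psi s = 1 &
    forall s, derive1 psi s = dstep (s - a) - e^-1 * dstep (e^-1 * (s - t))].
Proof.
move=> Ta at2 e0; have ei : 0 < e^-1 by rewrite invr_gt0.
pose psi s := cutoff a 1 s - cutoff t e^-1 s.
have ca s : cutoff a 1 s = step (s - a) by rewrite /cutoff mul1r.
have t0 s : s <= t + e -> cutoff t e^-1 s = 0.
  by move=> st; apply: step_le1; rewrite mulrC ler_pdivrMr//; lra.
have dpsi s : is_derive s (1 : R) psi (dstep (s - a) - e^-1 * dstep (e^-1 * (s - t))).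
  have D := is_deriveB (is_derive_cutoff a 1 s) (is_derive_cutoff t e^-1 s).
  by rewrite !mul1r in D.
exists psi; split.
- split; first exact: (CkB (Ck_cutoff a 1) (Ck_cutoff t e^-1)).
  exists (a + 1), (t + 2 * e); split; first by lra.
  move=> s; rewrite negb_and -!ltNge /psi => /orP[sa|st].
    by rewrite ca step_le1 ?t0 ?subrr//; lra.
  rewrite ca step_ge2; last by lra.
  by rewrite /cutoff step_ge2 ?subrr// mulrC ler_pdivlMr//; lra.
- move=> s; rewrite /psi; have [st|st] := leP s (t + e).
    by rewrite t0// subr0 ca; have /andP[] := step_itv (s - a).
  rewrite ca step_ge2; last by lra.
  by rewrite subr_ge0; have /andP[] := step_itv (e^-1 * (s - t)).
- by move=> s /andP[sa st]; rewrite /psi ca step_ge2 ?t0 ?subr0//; lra.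
- by move=> s; rewrite derive1E; case: (dpsi s).
Qed.

End TimeFunctions.

(** * Square-integrable functions *)

Section SquareIntegrable.
Context dd (X : measurableType dd) (R : realType) (mu : {measure set X -> \bar R}).
Implicit Types (D : set X) (f g : X -> R).

Lemma integrable_cst D (a : R) : measurable D -> (mu D < +oo)%E ->
  mu.-integrable D (EFin \o (fun _ => a)).
Proof.
move=> mD Doo; apply/integrableP; split; first exact/measurable_EFinP.
by rewrite /= integral_cst// lte_mul_pinfty// lee_fin.
Qed.

Lemma L2_integrable D f : measurable D -> (mu D < +oo)%E ->
  measurable_fun D f -> mu.-integrable D (EFin \o (fun x => `|f x| `^ 2)) ->
  mu.-integrable D (EFin \o f).
Proof.
move=> mD Doo mf f2.
have := integrableD_EFin mD (integrable_cst 1 mD Doo) f2.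
move=> /(integrable_le_EFin mD mf); apply => x _.
rewrite (powR_mulrn 2 (normr_ge0 _)).
by have := normr_ge0 (f x); move: `|f x| => a a0; nra.
Qed.

Lemma L2_integrableM D f g : measurable D ->
  measurable_fun D f -> mu.-integrable D (EFin \o (fun x => `|f x| `^ 2)) ->
  measurable_fun D g -> mu.-integrable D (EFin \o (fun x => `|g x| `^ 2)) ->
  mu.-integrable D (EFin \o (fun x => f x * g x)).
Proof.
move=> mD mf f2 mg g2; have := integrableD_EFin mD f2 g2.
have mfg : measurable_fun D (fun x => f x * g x) by exact: measurable_funM.
move=> /(integrable_le_EFin mD mfg); apply => x _.
rewrite !(powR_mulrn 2 (normr_ge0 _)) normrM.
have := normr_ge0 (f x); have := normr_ge0 (g x).
by move: `|f x| `|g x| => a b a0 b0; nra.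
Qed.

End SquareIntegrable.

(** * The current flux at a fixed time *)

Section FluxIdentity.
Context {R : realType}.
Variables (Om GD GN : set (pt R)) (chi : pt R -> R).
Hypotheses (oOm : open Om) (bOm : bounded_set Om).
Hypothesis chiC : Ck 2 setT chi.

Lemma vol_bounded_lty : (vol Om < +oo)%E.
Proof.
have [b Ob] := bounded_sub_box bOm.
apply: le_lt_trans (vol_box_lty b).
by apply: le_measure => //; rewrite inE; [exact: open_measurable_pt|exact: measurable_box].
Qed.

Lemma curl_grad x : curl (grad chi) x = 0.
Proof.
have jE i j : jac (grad chi) x i j = 'D_(bas j) (fun y => 'D_(bas i) chi y) x.
  by rewrite jacE; have -> : (fun y => grad chi y 0 i) = (fun y => 'D_(bas i) chi y);
    [apply/funext => y; rewrite mxE|].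
have s i j : jac (grad chi) x i j = jac (grad chi) x j i.
  by rewrite !jE; exact: derive_swap.
by apply: row3P; rewrite /curl curl_of3 [RHS]mxE s subrr.
Qed.

Lemma flux_identity (b c0 c : pt R -> 'rV[R]_3) :
  (forall i, continuous (fun x => grad chi x 0 i)) ->
  (forall i, exists M, forall x, `|grad chi x 0 i| <= M) ->
  (forall x, (bdry Om `\` GD) x -> grad chi x = 0) ->
  vol.-integrable Om (EFin \o (fun x => dot (c0 x) (grad chi x))) ->
  H0sigma Om GD GN b (fun x => c x - c0 x) ->
  \int[vol]_(x in Om) dot (c x) (grad chi x) =
  \int[vol]_(x in Om) dot (c0 x) (grad chi x).
Proof.
move=> cw bw w0 ic0 [[_ cLp] _ _ tan _]; have mOm := open_measurable_pt oOm.
have ic : vol.-integrable Om (EFin \o (fun x => dot (c x - c0 x) (grad chi x))).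
  apply: integrable_dot => // i; have [mc c2] := cLp 0 i.
  exact: (@L2_integrable _ _ R vol Om _ mOm vol_bounded_lty mc c2).
have wC : entrywise (Ck 1 setT) (grad chi).
  move=> i j; rewrite (_ : (fun _ => _) = (fun y => 'D_(bas j) chi y)).
    exact: Ck_derive.
  by apply/funext => y; rewrite mxE.
have Z : \int[vol]_(x in Om) (-1 * dot (c x - c0 x) (grad chi x)) = 0.
  rewrite -[RHS](tan _ wC w0); apply: eq_Rintegral => x _.
  rewrite curl_grad mulN1r -[LHS]add0r; congr (_ - _).
  by rewrite dot3 !mxE !mulr0 !addr0.
rewrite volZ// in Z.
have {}Z : \int[vol]_(x in Om) dot (c x - c0 x) (grad chi x) = 0.
  by apply/eqP; rewrite -oppr_eq0 -mulN1r Z.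
rewrite -[RHS]add0r -Z -volD//; apply: eq_Rintegral => x _.
by rewrite -dotDl subrK.
Qed.

End FluxIdentity.

Lemma ae_imp2 dd (X : measurableType dd) (R : realType)
    (mu : {measure set X -> \bar R}) (A B C : X -> Prop) :
  {ae mu, forall x, A x} -> {ae mu, forall x, B x} ->
  (forall x, A x -> B x -> C x) -> {ae mu, forall x, C x}.
Proof. by move=> aA aB H; apply: filterS2 aA aB. Qed.

(** * Lower bound for the entropy production *)

Section Production.
Context {R : realType}.
Variables (d : mhd R) (T : R).
Notation Om := (Omega d).
Notation Q := (Qcyl T Om).
Hypotheses (oOm : open Om) (bOm : bounded_set Om).

Lemma transport_dissipation_lb : transport_assumptions d -> exists2 z : R, 0 < z &
  forall (th : R) (A : 'M[R]_3) (g c : 'rV[R]_3), 0 < th ->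
    z * dot c c <= th^-1 * dissipation d th A g c.
Proof.
move=> [_ _ [mu1 [mu2 [eta2 [kap1 [kap2 [zet1 [zet2 [c0 [beta []]]]]]]]]]].
move=> [m1 _ _] [k1 _ _] [z1 _ _] H; exists zet1 => // th A g c t0.
have [[/andP[hm _] _] /andP[he _] /andP[hk _] [/andP[hz _] _]] := H th (ltW t0).
apply: dissipation_lb => //; last exact: ltW.
- by apply: le_trans hm; rewrite mulr_ge0 ?addr_ge0 ?(ltW t0)// ltW.
- by apply: le_trans hk; rewrite mulr_ge0 ?addr_ge0 ?powR_ge0// ltW.
Qed.

Lemma measurable_space (f : pt R -> R) : continuous f ->
  measurable_fun setT (fun y : spt R => f y.2).
Proof.
by move=> cf; apply: (measurableT_comp (continuous_measurable_pt cf)); exact: measurable_snd.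
Qed.

Lemma stvol_slab_lty (a b : R) : (stvol (`[a, b]%classic `*` Om) < +oo)%E.
Proof.
have mOm := open_measurable_pt oOm.
rewrite /stvol/= product_measure1E//.
apply: lte_mul_pinfty => //.
  by rewrite ge0_fin_numE// /= lebesgue_measure_itv; case: ifP => //= _; rewrite -EFinB ltry.
exact: vol_bounded_lty.
Qed.

Lemma slab_sub (a b : R) : T < a -> `[a, b]%classic `*` Om `<=` Q.
Proof.
move=> Ta [t x] [/= + Ox]; rewrite in_itv/= => /andP[at_ _]; split => //=.
by rewrite in_itv/= andbT (lt_le_trans Ta).
Qed.

(** The constant is chosen before [psi], as plateaus of arbitrary length and steepness will be
    inserted. The bound uses only times where [psi] is 1; elsewhere the integrand is nonnegative. *)
Lemma entropy_production (chi : pt R -> R) (c0 : R) (th : spt R -> R)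
    (Du : spt R -> 'M[R]_3) (Dth cB : spt R -> 'rV[R]_3) :
  transport_assumptions d ->
  (forall i, continuous (fun x => grad chi x 0 i)) ->
  (forall i, exists M, forall x, `|grad chi x 0 i| <= M) ->
  c0 != 0 ->
  {ae leb, forall t, T < t -> \int[vol]_(x in Om) dot (cB (t, x)) (grad chi x) = c0} ->
  entrywise (Lploc T Om 2) cB ->
  {ae stvol, forall y, Q y -> 0 < th y} ->
  exists2 c : R, 0 < c & forall (psi : R -> R) (a b : R),
    (forall s, 0 <= psi s) -> T < a -> a <= b ->
    (forall s, a <= s <= b -> psi s = 1) ->
    let g y := psi y.1 / th y * dissipation d (th y) (Du y) (Dth y) (cB y) in
    stvol.-integrable Q (EFin \o g) -> c * (b - a) <= \int[stvol]_(y in Q) g y.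
Proof.
move=> tr cw bw c00 flux cLp th0; have mOm := open_measurable_pt oOm.
have [z z0 Hz] := transport_dissipation_lb tr.
set w := grad chi in cw bw flux.
pose W := \int[vol]_(x in Om) dot (w x) (w x).
have W0 : 0 <= W by apply: Rintegral_ge0 => x _; exact: dot_ge0.
have W1 : 0 < W + 1 by lra.
(* Parameter of the Young inequality. It yields [l ^+ 2 * (W + 2)], which is positive; [W + 1] keeps
   the quotient meaningful whatever [W >= 0] is. *)
pose l := c0 / (W + 1).
have lE : 0 < 2 * l * c0 - l ^+ 2 * W.
  have -> : 2 * l * c0 - l ^+ 2 * W = l ^+ 2 * (W + 2) by rewrite /l; field; lra.
  have l0 : l != 0 by rewrite mulf_neq0// invr_eq0 gt_eqF.
  by rewrite mulr_gt0 ?exprn_even_gt0//; lra.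
exists (z * (2 * l * c0 - l ^+ 2 * W)); first exact: mulr_gt0.
move=> psi a b psi0 Ta ab psi1 g gi.
pose J := `[a, b]%classic : set R.
pose l0 (y : spt R) := z * (2 * l * dot (cB y) (w y.2) - l ^+ 2 * dot (w y.2) (w y.2)).
have mJ : measurable J by exact: measurable_itv.
have mJO : measurable (J `*` Om) by exact: measurableX.
have mQ : measurable Q by apply: measurableX => //; exact: measurable_itv.
have sJQ : J `*` Om `<=` Q by exact: slab_sub.
have fin := stvol_slab_lty a b.
have mw i : measurable_fun (J `*` Om) (fun y : spt R => w y.2 0 i).
  by apply: measurable_funS (@measurable_space (fun x => w x 0 i) (cw i)).
have iw (v : spt R -> 'rV[R]_3) :
    (forall i, stvol.-integrable (J `*` Om) (EFin \o (fun y => v y 0 i))) ->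
    stvol.-integrable (J `*` Om) (EFin \o (fun y => dot (v y) (w y.2))).
  move=> iv; have H i : stvol.-integrable (J `*` Om) (EFin \o (fun y => w y.2 0 i * v y 0 i)).
    have [M HM] := bw i.
    apply: (@integrableM_bounded _ _ _ stvol _ (fun y => v y 0 i) (fun y => w y.2 0 i) M) => //.
    exact: (mw i).
  have -> : (fun y => dot (v y) (w y.2)) = (fun y => w y.2 0 o0 * v y 0 o0 +
      w y.2 0 o1 * v y 0 o1 + w y.2 0 o2 * v y 0 o2).
    by apply/funext => y; rewrite dot3; ring.
  exact: (@integrableD_EFin _ _ _ stvol _ _ _ mJO (@integrableD_EFin _ _ _ stvol _ _ _ mJO (H o0) (H o1)) (H o2)).
have icB : stvol.-integrable (J `*` Om) (EFin \o (fun y => dot (cB y) (w y.2))).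
  apply: iw => i; have [mc c2] := cLp 0 i.
  have [ltab|ltba] := ltP a b.
    apply: (@L2_integrable _ _ R stvol _ _ mJO fin _ (c2 a b Ta ltab)).
    exact: measurable_funS mc.
  (* [Lploc] speaks of nondegenerate intervals, so for [a = b] the slab is embedded in a longer
     one. *)
  have Tb1 : a < a + 1 by rewrite ltrDl.
  apply: (@L2_integrable _ _ R stvol _ _ mJO fin).
    exact: measurable_funS mc.
  apply: (@integrableS _ _ _ stvol _ _ _ _ mJO _ (c2 a (a + 1) Ta Tb1)).
    by apply: measurableX => //; exact: measurable_itv.
  by move=> [s x] [+ Ox]; rewrite /J /= in_itv/= => sJ; split => //=; rewrite in_itv/=; lra.
have iww : stvol.-integrable (J `*` Om) (EFin \o (fun y : spt R => dot (w y.2) (w y.2))).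
  apply: (iw (fun y => w y.2)) => i; have [M HM] := bw i.
  apply: (@integrable_le_EFin _ _ _ stvol _ _ (fun _ => M)) => //.
    exact: mw.
  exact: (@integrable_cst _ _ R stvol _ M mJO fin).
have il0 : stvol.-integrable (J `*` Om) (EFin \o l0).
  apply: integrableZ_EFin => //; apply: integrableB_EFin => //;
  exact: integrableZ_EFin.
have [ae1 int1 E1] := @slice_integrable _ _ _ _ R leb vol _ _ _ mJ mOm il0.
have wwi : vol.-integrable Om (EFin \o (fun x => dot (w x) (w x))).
  apply: integrable_dot => // i; have [M HM] := bw i.
  apply: (@integrable_le_EFin _ _ _ vol _ _ (fun _ => M)) => //.
    exact: measurable_continuous_on.
  by apply: integrable_cst => //; exact: vol_bounded_lty.
have [ae2 _ _] := @slice_integrable _ _ _ _ R leb vol _ _ _ mJ mOm icB.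
(* Integration in space comes before integration in time: at almost every time the linear term is
   the prescribed flux [c0]. *)
have {}E1 : \int[stvol]_(y in J `*` Om) l0 y = z * (2 * l * c0 - l ^+ 2 * W) * (b - a).
  rewrite E1; transitivity (\int[leb]_(t in J) (z * (2 * l * c0 - l ^+ 2 * W))).
    rewrite /Rintegral; congr fine; apply: ae_eq_integral => //.
      exact: measurable_int int1.
    apply: (ae_imp2 flux ae2) => t fl it Jt.
    have Tt : T < t by move: Jt; rewrite /J /= in_itv/= => /andP[+ _]; apply: lt_le_trans.
    congr EFin; have it' := it Jt.
    transitivity (\int[vol]_(x in Om) (z * (2 * l * dot (cB (t, x)) (w x)
      - l ^+ 2 * dot (w x) (w x)))) => //.
    rewrite volZ//; last by apply: integrableB_EFin => //; exact: integrableZ_EFin.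
    rewrite volB//; [|exact: integrableZ_EFin|exact: integrableZ_EFin].
    by rewrite !volZ// (fl Tt).
  rewrite Rintegral_cst//; congr (_ * _).
  rewrite (_ : fine _ = fine (lebesgue_measure J))// /J lebesgue_measure_itv/= lte_fin.
  by move: ab; rewrite le_eqVlt => /orP[/eqP ->|ab]; rewrite ?ltxx ?subrr ?ab.
rewrite -E1 (Rintegral_mkcond stvol (J `*` Om) l0).
have il1 : stvol.-integrable Q (EFin \o (l0 \_ (J `*` Om))).
  apply: (@integrableS _ _ _ stvol setT) => //.
  rewrite -restrict_EFin; exact: (@integrable_mkcond _ _ _ stvol _ _ mJO).1 il0.
have -> : \int[stvol]_y (l0 \_ (J `*` Om)) y = \int[stvol]_(y in Q) (l0 \_ (J `*` Om)) y.
  symmetry; apply: Rintegral_extend => // y _ nQ.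
  by rewrite /patch memNset// => /sJQ.
apply: (@ae_le_Rintegral _ _ _ stvol) => //.
apply: (ae_imp2 th0 th0) => y + _ Qy => /(_ Qy) ty.
have H := Hz (th y) (Du y) (Dth y) (cB y) ty; have C0 := dot_ge0 (cB y).
have gE : g y = psi y.1 * ((th y)^-1 * dissipation d (th y) (Du y) (Dth y) (cB y)).
  by rewrite /g mulrA.
rewrite gE /patch; case: ifPn => [|_].
  rewrite inE => -[+ _]; rewrite /J /= in_itv/= => yJ; rewrite psi1// mul1r.
  apply: le_trans H; rewrite /l0 ler_wpM2l ?(ltW z0)//; exact: dot_young.
apply: mulr_ge0 => //; apply: le_trans H; apply: mulr_ge0 => //; exact: ltW.
Qed.

End Production.

(** * From a distributional inequality to almost every time *)

Section Growth.
Context {R : realType}.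
Implicit Types F : R -> R.

Lemma measurable_continuous_R (D : set R) (f : R -> R) : measurable D ->
  continuous f -> measurable_fun D f.
Proof. by move=> mD cf; apply: measurable_funS (continuous_measurable_fun cf). Qed.

Lemma continuous_kernel (t e : R) : continuous (fun s : R => e * dstep (e * (s - t))).
Proof.
move=> s; apply: cvgM; first exact: cvg_cst.
apply: (@continuous_comp _ _ _ (fun s : R => e * (s - t)) dstep).
  exact: (Ck_continuous (Ck_affine 0 t e) I).
exact: continuous_dstep.
Qed.

Lemma integral_kernel (t e : R) : 0 < e ->
  \int[leb]_(s in `[t, t + 2 * e]) (e^-1 * dstep (e^-1 * (s - t))) = 1.
Proof.
move=> e0; have te : t < t + 2 * e by rewrite ltrDl mulr_gt0.
have cc s : {for s, continuous (cutoff t e^-1)}.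
  exact: (Ck_continuous (Ck_cutoff t e^-1) I).
rewrite /Rintegral (@continuous_FTC2 R _ (cutoff t e^-1) t (t + 2 * e) te).
- have -> : cutoff t e^-1 t = 0 by rewrite /cutoff subrr mulr0 step_le1.
  have -> : cutoff t e^-1 (t + 2 * e) = 1; last by rewrite /= subr0.
  by apply: step_ge2; rewrite [t + _]addrC addrK mulrCA mulVf ?mulr1// gt_eqF.
- exact/continuous_subspaceT/continuous_kernel.
- split; first by move=> s _; case: (is_derive_cutoff t e^-1 s).
    exact: cvg_at_right_filter (cc _).
  exact: cvg_at_left_filter (cc _).
- by move=> s _; rewrite derive1E; case: (is_derive_cutoff t e^-1 s).
Qed.

(** The ball has length [2 * r], so an average below [dl / 2] means an integral of at most
    [dl * r]. *)
Lemma lebesgue_pt_small F (t dl : R) : 0 < dl -> lebesgue_pt F t ->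
  \forall r \near 0^'+, (\int[leb]_(s in ball t r) `|(F s - F t)%:E| <= (dl * r)%:E)%E.
Proof.
move=> dl0 H; have d2 : 0 < dl / 2 by rewrite divr_gt0.
have Hn : \forall r \near 0^'+, (davg F t r < (dl / 2)%:E)%E.
  apply: (H [set x | (x < (dl / 2)%:E)%E]); apply: open_nbhs_nbhs.
  by split; [exact: open_ereal_lt_ereal|rewrite /= lte_fin].
near=> r; have r0 : 0 < r by near: r; exact: nbhs_right_gt.
have : (davg F t r < (dl / 2)%:E)%E by near: r.
rewrite /davg /iavg lebesgue_measure_ball ?(ltW r0)// inver.
have r2 : 0 < r *+ 2 by rewrite mulrn_wgt0.
rewrite gt_eqF// => /ltW; rewrite muleC lee_pdivrMr//.
by rewrite -EFinM (_ : dl / 2 * (r *+ 2) = dl * r)// -mulr_natl; field.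
Unshelve. all: by end_near. Qed.

(** The hypothesis is the distributional inequality [F' >= c], tested against a
  plateau whose descending edge shrinks to the Lebesgue point [t]. *)
Lemma growth_of_distributional F (a c : R) :
  (forall b, a <= b -> leb.-integrable `[a, b] (EFin \o F)) ->
  (forall t e, a + 2 <= t -> 0 < e ->
    \int[leb]_(s in `[a, t + 2 * e])
      ((dstep (s - a) - e^-1 * dstep (e^-1 * (s - t))) * F s) <= - (c * (t - (a + 2)))) ->
  exists A : R, {ae leb, forall t, a + 2 < t -> A + c * (t - (a + 2)) <= F t}.
Proof.
(* [F] is integrable on bounded intervals starting at [a] only; its truncations are locally
   integrable on the whole line, so that Lebesgue differentiation applies to all of them at once. *)
move=> Fi Hd; pose f n := F \_ `[a, a + n%:R].
have an n : a <= a + n%:R by rewrite lerDl.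
have aeL : {ae leb, forall t, forall n, lebesgue_pt (f n) t}.
  apply: ae_foralln => n; apply: lebesgue_differentiation.
  exact: integrable_locally_restrict (Fi _ (an n)).
(* The contribution of the rising edge, a weighted mean of [F] over [[a + 1, a + 2]] that does not
   depend on [t]. *)
exists (\int[leb]_(s in `[a, a + 2]) (dstep (s - a) * F s)).
set A := Rintegral _ _ _.
apply: (ae_imp2 aeL aeL) => t Lt _ at2.
(* Large enough for the truncation to agree with [F] on [[t, t + 1]], which contains the falling
   edge. *)
pose n := (Num.truncn (t + 1 - a)).+1.
have tn : t + 1 < a + n%:R.
  have := truncnS_gt (t + 1 - a); rewrite -/n; lra.
apply/ler_addgt0Pr => dl dl0.
(* The kernel is at most [2 / e] with [e = r / 3], that is [6 / r], and
   [6 / r * (dl / 6 * r) = dl]. *)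
have d6 : 0 < dl / 6 by rewrite divr_gt0.
have := lebesgue_pt_small d6 (Lt n).
move=> small.
have : \forall r \near (0 : R)^'+, A + c * (t - (a + 2)) <= F t + dl; last first.
  by move=> /(@filter_ex _ _ _)[].
near=> r.
have r0 : 0 < r by near: r; exact: nbhs_right_gt.
have r1 : r < 1 by near: r; exact: nbhs_right_lt.
have Hr : (\int[leb]_(s in ball t r) `|(f n s - f n t)%:E| <= (dl / 6 * r)%:E)%E by near: r.
(* A third, so that [[t, t + 2 * e]] lies in the open ball of radius [r]. *)
pose e := r / 3; have e0 : 0 < e by rewrite divr_gt0.
pose k s := e^-1 * dstep (e^-1 * (s - t)).
have ck : continuous k by exact: continuous_kernel.
have cd : continuous (fun s => dstep (s - a)).
  have -> : (fun s => dstep (s - a)) = (fun s => 1 * dstep (1 * (s - a))).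
    by apply/funext => s; rewrite !mul1r.
  exact: continuous_kernel.
have kM s : `|k s| <= e^-1 * 2.
  have ei : 0 <= e^-1 by rewrite invr_ge0 ltW.
  rewrite ger0_norm; last by apply: mulr_ge0 => //; exact: dstep_ge0.
  by apply: ler_wpM2l => //; exact: dstep_le2.
have dM s : `|dstep (s - a)| <= 2 by rewrite ger0_norm ?dstep_ge0// dstep_le2.
pose b := t + 2 * e.
have ab : a <= b by rewrite /b; lra.
have Fib := Fi b ab.
have mab : measurable (`[a, b]%classic : set R) by exact: measurable_itv.
have ikF : leb.-integrable `[a, b] (EFin \o (fun s => k s * F s)).
  apply: (@integrableM_bounded _ _ R leb _ F k (e^-1 * 2)) => //.
  exact: measurable_continuous_R.
have idF : leb.-integrable `[a, b] (EFin \o (fun s => dstep (s - a) * F s)).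
  apply: (@integrableM_bounded _ _ R leb _ F (fun s => dstep (s - a)) 2) => //.
  exact: measurable_continuous_R.
have AE : \int[leb]_(s in `[a, b]) (dstep (s - a) * F s) = A.
  symmetry; apply: Rintegral_extend => // s.
    by rewrite /= !in_itv/= /b; lra.
  rewrite /= !in_itv/= => sab nab; rewrite dstep_supp ?mul0r//; lra.
have kE : \int[leb]_(s in `[a, b]) (k s * F s) = \int[leb]_(s in `[t, b]) (k s * F s).
  symmetry; apply: Rintegral_extend => // s.
    by rewrite /= !in_itv/=; lra.
  rewrite /= !in_itv/= => sab nab; rewrite /k dstep_supp ?mulr0 ?mul0r//.
  apply/negP => /andP[+ _]; apply/negP; rewrite -ltNge.
  apply: le_lt_trans ltr01; rewrite pmulr_rle0 ?invr_gt0//; lra.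
have := Hd t e (ltW at2) e0; rewrite -/b.
have -> : \int[leb]_(s in `[a, b]) ((dstep (s - a) - e^-1 * dstep (e^-1 * (s - t))) * F s)
    = A - \int[leb]_(s in `[t, b]) (k s * F s).
  rewrite -AE -kE -(@RintegralB _ _ R leb)//.
  by apply: eq_Rintegral => s _; rewrite mulrBl.
move=> H; apply: (@le_trans _ _ (\int[leb]_(s in `[t, b]) (k s * F s))); first by lra.
have mtb : measurable (`[t, b]%classic : set R) by exact: measurable_itv.
have stb : `[t, b]%classic `<=` (`[a, b]%classic : set R).
  by move=> s; rewrite /= !in_itv/=; lra.
have fF s : `[t, b]%classic s -> f n s = F s.
  rewrite /f /patch /= in_itv/= => sb; rewrite mem_set// /= in_itv/=.
  by move: sb; rewrite /b /e; lra.
have ft : f n t = F t by apply: fF; rewrite /= in_itv/= lexx/= /b; lra.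
have Fit := @integrableS _ _ _ leb _ _ _ mab mtb stb Fib.
have leb_tb : (leb `[t, b]%classic < +oo)%E.
  by rewrite /= lebesgue_measure_itv; case: ifP => //= _; rewrite -EFinB ltry.
have icF : leb.-integrable `[t, b] (EFin \o (fun s => F s - F t)).
  by apply: integrableB_EFin => //; exact: (@integrable_cst _ _ R leb).
have ikc : leb.-integrable `[t, b] (EFin \o (fun s => k s * (F s - F t))).
  apply: (@integrableM_bounded _ _ R leb _ (fun s => F s - F t) k (e^-1 * 2)) => //.
  exact: measurable_continuous_R.
have ik : leb.-integrable `[t, b] (EFin \o k).
  apply: (@integrable_le_EFin _ _ R leb _ _ (fun _ => e^-1 * 2)) => //.
    exact: measurable_continuous_R.
  exact: (@integrable_cst _ _ R leb).
(* The kernel has mass one, so only the deviation from [F t] has to be estimated. *)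
have -> : \int[leb]_(s in `[t, b]) (k s * F s) =
    \int[leb]_(s in `[t, b]) (k s * (F s - F t)) + F t.
  rewrite -[X in _ + X]mulr1 -(integral_kernel t e0) -/b -(@RintegralZl _ _ R leb)//.
  rewrite -(@RintegralD _ _ R leb)//; last exact: integrableZ_EFin.
  by apply: eq_Rintegral => s _; rewrite -/(k s); ring.
rewrite addrC lerD2l.
have iN : leb.-integrable `[t, b] (EFin \o (fun s => `|F s - F t|)).
  exact: (@integrable_norm _ _ R leb _ _ icF).
apply: (@le_trans _ _ (\int[leb]_(s in `[t, b]) (e^-1 * 2 * `|F s - F t|))).
  apply: (@le_Rintegral _ _ R leb) => //.
    exact: integrableZ_EFin.
  move=> s _; apply: le_trans (ler_norm _) _; rewrite normrM.
  by rewrite ler_wpM2r.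
rewrite (@RintegralZl _ _ R leb)//.
have L : \int[leb]_(s in `[t, b]) `|F s - F t| <= dl / 6 * r.
  rewrite -lee_fin /Rintegral fineK; last exact: (@integrable_fin_num _ _ R leb _ mtb _ iN).
  apply: le_trans Hr.
  have -> : (\int[leb]_(x in `[t, b]) (`|F x - F t|)%:E)%E =
      (\int[leb]_(s in `[t, b]) `|(f n s - f n t)%:E|)%E.
    by apply: eq_integral => s; rewrite inE => sb; rewrite fF// ft.
  apply: ge0_subset_integral => //.
  - exact: measurable_ball.
  - apply: measurableT_comp => //; apply/measurable_EFinP; apply: measurable_funB => //.
    apply: measurable_funS (_ : measurable_fun setT (f n)) => //.
    by case: (integrable_locally_restrict (measurable_itv _) (Fi _ (an n))).
  - move=> s; rewrite /= in_itv/= ball_itv/= in_itv/= /b /e; lra.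
apply: le_trans (ler_wpM2l _ L) _; first by rewrite mulr_ge0// invr_ge0 ltW.
have -> : e^-1 * 2 * (dl / 6 * r) = dl by rewrite /e; field; rewrite gt_eqF.
exact: lexx.
Unshelve. all: by end_near. Qed.

End Growth.

(** * Time slabs and their spatial slices *)

Section Slabs.
Context {R : realType}.
Variables (d : mhd R) (T : R).
Notation Om := (Omega d).
Notation Q := (Qcyl T Om).
Hypothesis oOm : open Om.
Implicit Types h : spt R -> R.

Let mOm : measurable Om := open_measurable_pt oOm.
Let mI (a b : R) : measurable (`[a, b]%classic : set R) := @measurable_itv R _.

Lemma measurable_slab (a b : R) : measurable (`[a, b]%classic `*` Om : set (spt R)).
Proof. by apply: measurableX => //; exact: mI. Qed.

(** The weak formulation provides integrability of products with [derive1 psi]; a test function of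
    slope 1 on the slab releases the factor [h]. *)
Lemma window_integrable h :
  (forall psi, test_time T psi -> (forall s, 0 <= psi s) ->
    stvol.-integrable Q (EFin \o (fun y => derive1 psi y.1 * h y))) ->
  forall b, T + 3 <= b -> stvol.-integrable (`[T + 3, b] `*` Om) (EFin \o h).
Proof.
move=> H b Tb; have [psi [tpsi psi0 psi1]] := exists_window Tb.
have mQ : measurable Q by apply: measurableX => //; exact: measurable_itv.
have T3 : T < T + 3 by rewrite ltrDl.
have := @integrableS _ _ _ stvol _ _ _ mQ (measurable_slab _ _)
  (@slab_sub _ d T (T + 3) b T3) (H psi tpsi psi0).
apply: eq_integrable; first exact: measurable_slab.
move=> y; rewrite inE => -[+ _]; rewrite /= in_itv/= => yb.
by rewrite psi1// mul1r.
Qed.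

Lemma ae_slab_integrable h (a : R) :
  (forall b, a <= b -> stvol.-integrable (`[a, b] `*` Om) (EFin \o h)) ->
  {ae leb, forall t, a < t -> vol.-integrable Om (EFin \o (fun x => h (t, x)))}.
Proof.
move=> hi; have H n : {ae leb, forall t, `[a, a + n%:R]%classic t ->
    vol.-integrable Om (EFin \o (fun x => h (t, x)))}.
  have an : a <= a + n%:R by rewrite lerDl.
  by have [] := @slice_integrable _ _ _ _ R leb vol _ _ _ (mI _ _) mOm (hi _ an).
apply: (ae_imp2 (ae_foralln H) (ae_foralln H)) => t Ht _ at_.
apply: (Ht (Num.truncn (t - a)).+1); rewrite /= in_itv/= (ltW at_)/=.
have := truncnS_gt (t - a); lra.
Qed.

Lemma slab_pairing h (k : R -> R) (a b M : R) : continuous k ->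
  (forall s, `|k s| <= M) -> stvol.-integrable (`[a, b] `*` Om) (EFin \o h) ->
  \int[stvol]_(y in `[a, b] `*` Om) (k y.1 * h y) =
  \int[leb]_(s in `[a, b]) (k s * \int[vol]_(x in Om) h (s, x)).
Proof.
move=> ck kM hi; have mab := mI a b.
have mk : measurable_fun setT (fun y : spt R => k y.1).
  apply: (measurableT_comp (continuous_measurable_fun ck)); exact: measurable_fst.
have khi : stvol.-integrable (`[a, b] `*` Om) (EFin \o (fun y => k y.1 * h y)).
  apply: (@integrableM_bounded _ _ R stvol _ h (fun y => k y.1) M) => //.
  - exact: measurable_slab.
  - exact: measurable_funS mk.
have [ae1 int1 _] := @slice_integrable _ _ _ _ R leb vol _ _ _ mab mOm hi.
have [_ int2 ->] := @slice_integrable _ _ _ _ R leb vol _ _ _ mab mOm khi.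
rewrite /Rintegral; congr fine; apply: ae_eq_integral => //.
- exact: measurable_int int2.
- apply: (@measurable_int _ _ _ leb).
  apply: (@integrableM_bounded _ _ R leb _ _ k M) => //.
  exact: measurable_continuous_R.
- apply: (ae_imp2 ae1 ae1) => s is_ _ sab; congr EFin.
  by apply: (volZ (k s) mOm); exact: is_.
Qed.

End Slabs.

Lemma plateau_support (R : realType) (a t e s : R) : a + 2 <= t -> 0 < e ->
  ~~ (a <= s <= t + 2 * e) -> dstep (s - a) = 0 /\ dstep (e^-1 * (s - t)) = 0.
Proof.
move=> at2 e0 sab; have ei : 0 < e^-1 by rewrite invr_gt0.
split; apply: dstep_supp; first by move: sab; lra.
apply/negP => /andP[h1 h2]; move/negP: sab; apply.
have h3 : 0 < s - t by have := lt_le_trans ltr01 h1; rewrite pmulr_rgt0.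
have h4 : s - t <= 2 * e by move: h2; rewrite mulrC ler_pdivrMr.
by apply/andP; split; lra.
Qed.

(** * Growth of the entropy, integrability of the energy *)

Section EnergyGrowth.
Context {R : realType}.
Variables (nu : R) (d : mhd R).
Variables (BB : pt R -> 'rV[R]_3) (DBB : pt R -> 'M[R]_3) (T : R).
Variables (rho th : spt R -> R) (u B : spt R -> 'rV[R]_3).
Notation Om := (Omega d).
Notation Q := (Qcyl T Om).
Hypotheses (oOm : open Om) (bOm : bounded_set Om).
Hypothesis GtD0 : GtD d = set0.

Let mOm : measurable Om := open_measurable_pt oOm.
Let ent (y : spt R) := rho_s d (rho y) (th y).
Let en (y : spt R) := energy d (rho y) (th y) (u y) (B y).

(** A test function without spatial gradient removes the convective and the heat flux terms, leaving
    the total entropy and its production. *)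
Lemma entropy_time Du Dth Dlog cB psi :
  entropy_weak d T rho th u Du Dth Dlog cB -> test_time T psi ->
  (forall s, 0 <= psi s) ->
  let g y := psi y.1 / th y * dissipation d (th y) (Du y) (Dth y) (cB y) in
  [/\ stvol.-integrable Q (EFin \o (fun y => derive1 psi y.1 * ent y)),
    stvol.-integrable Q (EFin \o g) &
    \int[stvol]_(y in Q) (derive1 psi y.1 * ent y) <= - \int[stvol]_(y in Q) g y].
Proof.
move=> [_ _ _ _ H] tpsi psi0 g.
have [||] := H _ (test_fun_time tpsi).
- by move=> t x _; exact: psi0.
- by move=> t x; rewrite GtD0.
set f := (fun y => _) => fi gi fg.
have fE : f = (fun y => derive1 psi y.1 * ent y).
  apply/funext => y; rewrite /f dt_time gradx_time.
  have d0 v : dot v 0 = 0 :> R by rewrite dot3 !mxE !mulr0 !addr0.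
  by rewrite !d0 mulr0 !addr0 mulrC.
by rewrite fE in fi fg.
Qed.

Lemma entropy_grows Du Dth Dlog cB (c : R) :
  entropy_weak d T rho th u Du Dth Dlog cB ->
  (forall (psi : R -> R) (a b : R),
    (forall s, 0 <= psi s) -> T < a -> a <= b ->
    (forall s, a <= s <= b -> psi s = 1) ->
    let g y := psi y.1 / th y * dissipation d (th y) (Du y) (Dth y) (cB y) in
    stvol.-integrable Q (EFin \o g) -> c * (b - a) <= \int[stvol]_(y in Q) g y) ->
  exists A : R, {ae leb, forall t, T + 5 < t ->
    A + c * (t - (T + 5)) <= \int[vol]_(x in Om) ent (t, x)}.
Proof.
move=> ew prod; have T3 : T < T + 3 by rewrite ltrDl.
have enti b : T + 3 <= b -> stvol.-integrable (`[T + 3, b] `*` Om) (EFin \o ent).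
  apply: window_integrable => // psi tpsi psi0.
  by have [] := entropy_time ew tpsi psi0.
(* Slabs of integrability start at [a = T + 3], and the plateau is reached at [a + 2]: production is
   counted from [T + 5]. *)
rewrite (_ : T + 5 = T + 3 + 2); last by ring.
apply: growth_of_distributional.
  move=> b ab; have [_ H _] := @slice_integrable _ _ _ _ R leb vol _ _ _
    (@measurable_itv R `[T + 3, b]) mOm (enti b ab).
  exact: H.
move=> t e at2 e0.
have [psi [tpsi psi0 psi1 dpsi]] := exists_plateau (ltW T3) at2 e0.
have [fi gi fg] := entropy_time ew tpsi psi0.
have Ta2 : T < T + 3 + 2 by lra.
have := prod psi _ _ psi0 Ta2 at2 psi1 gi => pr.
have kc := continuous_derive1 tpsi.1.
have kM s : `|derive1 psi s| <= 2 + e^-1 * 2.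
  rewrite dpsi; apply: le_trans (ler_normB _ _) _; apply: lerD.
    by rewrite ger0_norm ?dstep_ge0// dstep_le2.
  have ei : 0 <= e^-1 by rewrite invr_ge0 ltW.
  rewrite ger0_norm; last by apply: mulr_ge0 => //; exact: dstep_ge0.
  by apply: ler_wpM2l => //; exact: dstep_le2.
set b := t + 2 * e.
have ab : T + 3 <= b by rewrite /b; lra.
rewrite (_ : Rintegral _ _ _ = \int[stvol]_(y in Q) (derive1 psi y.1 * ent y)).
  by apply: le_trans fg _; rewrite lerN2.
transitivity (\int[leb]_(s in `[T + 3, b]) (derive1 psi s * \int[vol]_(x in Om) ent (s, x))).
  by apply: eq_Rintegral => s _; rewrite dpsi.
rewrite -(slab_pairing oOm kc kM (enti b ab)).
apply: Rintegral_extend; first exact: measurable_slab.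
  exact: slab_sub.
move=> [s x] [/= _ Ox] ns; rewrite dpsi.
have sab : ~~ (T + 3 <= s <= b).
  by apply/negP => sb; apply: ns; split => //=; rewrite in_itv.
have [-> ->] := plateau_support at2 e0 sab.
by rewrite mulr0 subrr mul0r.
Qed.

(** Finiteness of the energy at almost every time. The ballistic energy is integrable on slabs; its
    entropy part is so by the entropy inequality, and [BB . B] is a product of two square-integrable
    fields on each slice. *)
Lemma energy_slice Du Dth cB :
  ballistic_energy d BB DBB T rho th u B Du Dth cB ->
  (forall p : R, 1 <= p -> entrywise (Lp Om p) BB) ->
  (forall t, T < t -> entrywise (Lp Om 2) (fun x => B (t, x))) ->
  (forall b, T + 3 <= b -> stvol.-integrable (`[T + 3, b] `*` Om) (EFin \o ent)) ->
  {ae leb, forall t, T + 3 < t -> vol.-integrable Om (EFin \o (fun x => en (t, x)))}.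
Proof.
move=> bal BBLp BLp enti.
pose h y := en y - 1 * ent y - dot (BB y.2) (B y).
have hi b : T + 3 <= b -> stvol.-integrable (`[T + 3, b] `*` Om) (EFin \o h).
  apply: window_integrable => // psi tpsi psi0.
  (* As [GtD] is empty, the constant 1 is an admissible reference temperature. *)
  have tt1 : temperature_extension d T (fun=> 1).
    split => //; first exact: Ck_cst.
    by move=> t x _; rewrite GtD0.
  by have [fi _ _ _ _] := bal psi _ tpsi psi0 tt1.
have H1 := ae_slab_integrable oOm hi.
have H2 := ae_slab_integrable oOm enti.
apply: (ae_imp2 H1 H2) => t h1 h2 t3.
have Tt : T < t by apply: lt_trans t3; rewrite ltrDl.
have two1 : 1 <= 2 :> R by rewrite ler1n.
have BBi i : vol.-integrable Om (EFin \o (fun x => BB x 0 i * B (t, x) 0 i)).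
  have [m1 i1] := BBLp 2 two1 0 i; have [m2 i2] := BLp t Tt 0 i.
  exact: (@L2_integrableM _ _ R vol _ _ _ mOm m1 i1 m2 i2).
have BBB : vol.-integrable Om (EFin \o (fun x => dot (BB x) (B (t, x)))).
  have -> : (fun x => dot (BB x) (B (t, x))) = (fun x => BB x 0 o0 * B (t, x) 0 o0
      + BB x 0 o1 * B (t, x) 0 o1 + BB x 0 o2 * B (t, x) 0 o2).
    by apply/funext => x; rewrite dot3.
  exact: (@integrableD_EFin _ _ _ vol _ _ _ mOm
    (@integrableD_EFin _ _ _ vol _ _ _ mOm (BBi o0) (BBi o1)) (BBi o2)).
have -> : (fun x => en (t, x)) =
    (fun x => h (t, x) + ent (t, x) + dot (BB x) (B (t, x))).
  by apply/funext => x; rewrite /h mul1r /=; move: (en _) (ent _) (dot _ _) => p q r; ring.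
exact: (@integrableD_EFin _ _ _ vol _ _ _ mOm
    (@integrableD_EFin _ _ _ vol _ _ _ mOm (h1 t3) (h2 t3)) BBB).
Qed.

(** The mass is prescribed as an extended real integral; with a nonnegative density its finiteness
    is integrability. *)
Lemma density_slice (r : pt R -> R) (m0 : R) : measurable_fun Om r ->
  {ae vol, forall x, Om x -> 0 <= r x} ->
  (\int[vol]_(x in Om) (r x)%:E)%E = m0%:E ->
  vol.-integrable Om (EFin \o r).
Proof.
move=> mr r0 rm; have mr' : measurable_fun Om (EFin \o r) by exact/measurable_EFinP.
apply/integrableP; split => //.
rewrite (_ : (\int[vol]_(x in Om) _)%E = m0%:E) ?ltry// -rm.
apply: ae_eq_integral => //; first exact: measurableT_comp.
by apply: (ae_imp2 r0 r0) => x + _ Ox => /(_ Ox) rx; rewrite /= ger0_norm.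
Qed.

End EnergyGrowth.

Theorem theorem5p1 (R : realType) (nu : R) (d : mhd R)
  (BB : pt R -> 'rV[R]_3) (DBB : pt R -> 'M[R]_3) (T : R)
  (rho th : spt R -> R) (u B : spt R -> 'rV[R]_3) :
  domain_assumptions d nu ->
  eos_assumptions d ->
  transport_assumptions d ->
  potential_assumptions d ->
  magnetic_data_assumptions d ->
  magnetic_extension d BB DBB ->
  GuD d !=set0 ->
  GtD d = set0 ->
  GBD d !=set0 ->
  (forall x, GBD d x -> dot (btau d x) (nrm d x) = 0) ->
  (exists x delta, [/\ GBD d x,
     surface_divergence (GBD d) (nrm d) (btau d) x delta & delta <> 0]) ->
  weak_solution d BB DBB T rho th u B ->
  standing_conventions d T rho B ->
  ess_cvg_pinfty (total_energy d rho th u B).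
Proof.
move=> dom eos tr _ _ mex _ GtD0 _ btn sdiv.
move=> [Du [Dth [Dlog [cB [cont mom ind ew bal]]]]] [[m0 m0_gt0 mass] _].
have [chi [chiC chi0 [cw bw] ic0 c00]] := exists_flux_test dom mex btn sdiv.
case: (dom) => _ [_ oOm _ bOm _] _ [_ _ [bsplit _ _ _]].
have mOm := open_measurable_pt oOm.
have [_ BB2 _ _ _] := mex.
have [_ BL2 cB2 H0s _] := ind.
have flux : {ae leb, forall t, T < t -> \int[vol]_(x in Omega d)
    dot (cB (t, x)) (grad chi x) =
    \int[vol]_(x in Omega d) dot (curl_of (DBB x)) (grad chi x)}.
  apply: (ae_imp2 H0s H0s) => t H _ Tt.
  apply: (flux_identity oOm bOm chiC cw bw _ ic0 (H Tt)).
  by move=> x [xb xD]; apply: chi0; move: xb; rewrite bsplit => -[].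
have [_ th0 _ _ _] := ew; have [[rhom _] rho0 _ _] := cont.
have [c c_gt0 Hc] := entropy_production oOm bOm Du Dth tr cw bw c00 flux cB2 th0.
have [A HA] := entropy_grows oOm GtD0 ew Hc.
have [C C0 HC] := rho_s_le eos.
have enti b : T + 3 <= b -> stvol.-integrable (`[T + 3, b] `*` Omega d)
    (EFin \o (fun y => rho_s d (rho y) (th y))).
  apply: window_integrable => // psi tpsi psi0.
  by have [] := entropy_time GtD0 ew tpsi psi0.
have eni := energy_slice oOm GtD0 bal (fun p p1 => (BB2 p p1).1) (fun t Tt => (BL2 t Tt).1) enti.
have entia := ae_slab_integrable oOm enti.
(* The entropy bound needs [0 <= rho] and [0 < th], known almost everywhere in space-time; slicing
   gives them almost everywhere in space at almost every time. *)
have pos := ae_imp2 (@ae_slice _ _ _ _ R leb vol _ rho0) (@ae_slice _ _ _ _ R leb vol _ th0)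
  (fun t h1 h2 => conj h1 h2).
pose V := fine (vol (Omega d)).
(* Since the total entropy is at most [C * (m0 + V + energy)], an entropy above [K'] forces the
   energy above [K]. *)
move=> K; pose K' := C * (m0 + V + K).
(* From here on the line [A + c * (t - (T + 5))] exceeds [K']; the absolute value keeps the
   threshold at or beyond [T + 5]. *)
exists (T + 5 + `|K' - A| / c).
have H1 := ae_imp2 mass HA (fun t h1 h2 => conj h1 h2).
have H2 := ae_imp2 eni entia (fun t h1 h2 => conj h1 h2).
have H3 := ae_imp2 H2 pos (fun t h1 h2 => conj h1 h2).
apply: (ae_imp2 H1 H3) => t [mt At] [[et st] [rt tt]] tK.
have q0 : 0 <= `|K' - A| / c by rewrite divr_ge0// ltW.
have t5 : T + 5 < t by apply: le_lt_trans tK; rewrite lerDl.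
have t3 : T + 3 < t by apply: lt_trans t5; rewrite ltrD2l ltr_nat.
have Tt : T < t by apply: lt_trans t3; rewrite ltrDl.
have {}At := At t5; have {}et := et t3; have {}st := st t3; have {}mt := mt Tt.
have Qt x : Omega d x -> Qcyl T (Omega d) (t, x).
  by move=> Ox; split => //=; rewrite in_itv/= Tt.
have r0 : {ae vol, forall x, Omega d x -> 0 <= rho (t, x)}.
  by apply: (ae_imp2 rt rt) => x h _ Ox; apply: h; exact: Qt.
have rm : measurable_fun (Omega d) (fun x => rho (t, x)).
  apply: (@measurable_slice _ _ _ _ R `]T, +oo[%classic (Omega d) rho t) => //.
  by rewrite /= in_itv/= Tt.
have ri := density_slice oOm rm r0 mt.
have i1 := @integrable_cst _ _ R vol _ 1 mOm (vol_bounded_lty oOm bOm).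
have ri1 := @integrableD_EFin _ _ _ vol _ _ _ mOm ri i1.
have rie := @integrableD_EFin _ _ _ vol _ _ _ mOm ri1 et.
have le1 : \int[vol]_(x in Omega d) rho_s d (rho (t, x)) (th (t, x)) <=
    \int[vol]_(x in Omega d) (C * (rho (t, x) + 1 +
      energy d (rho (t, x)) (th (t, x)) (u (t, x)) (B (t, x)))).
  apply: (@ae_le_Rintegral _ _ R vol) => //; first exact: integrableZ_EFin.
  apply: (ae_imp2 rt tt) => x hr ht Ox; apply: HC; first exact/hr/Qt.
  exact/ht/Qt.
rewrite volZ// volD// volD// in le1.
have E1 : \int[vol]_(x in Omega d) rho (t, x) = m0 by rewrite /Rintegral mt.
have EV : \int[vol]_(x in Omega d) (1 : R) = V by rewrite Rintegral_cst// mul1r.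
rewrite E1 EV in le1.
rewrite /total_energy -(fineK (@integrable_fin_num _ _ R vol _ mOm _ et)) lee_fin.
have le2 := le_trans At le1.
have lt3 : K' < A + c * (t - (T + 5)).
  rewrite -ltrBlDl; apply: le_lt_trans (ler_norm _) _.
  by rewrite mulrC -ltr_pdivrMr// ltrBrDl.
by have := lt_le_trans lt3 le2; rewrite /K' ltr_pM2l// ltrD2l => /ltW.
Qed.
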